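(* (Nikolskii inequality on domains.) Let $\Omega\subset\mathbb{R}^d$ be a bounded Lipschitz domain satisfying an interior cone condition and let $\phi_m$ be a positive definite kernel on $\mathbb{R}^d$ with $\widehat{\phi}_m(\xi)\sim(1+\|\xi\|_2^2)^{-m}$ for some real $m>d/2$. Let $\rho_*$ be a fixed constant. Then there exists a constant $C>0$, depending only on $d,\phi_m,\Omega$ and $\rho_*$, such that for every quasi-uniform finite set $X\subset\Omega$ (that is, with mesh ratio $\rho_{X,\Omega}\le\rho_*$) $$\|u\|_{L_\infty(\Omega)}\le C\,h_{X,\Omega}^{-d/2}\,\|u\|_{L_2(\Omega)}\qquad\text{for all }u\in V_{X,\phi_m,\Omega}.$$
   Context: Interior cone condition: there are $\theta\in(0,\pi/2)$ and $r>0$ such that for every $x\in\Omega$ there is a unit vector $\xi(x)$ with $\{x+\lambda y:\ \|y\|_2=1,\ y^T\xi(x)\ge\cos\theta,\ \lambda\in[0,r]\}\subset\Omega$. Point sets: $X=\{x_1,\dots,x_N\}\subset\Omega$ is a finite set of pairwise distinct points ($N\ge2$), with fill distance $h_{X,\Omega}=\sup_{x\in\Omega}\min_{j}\|x-x_j\|_2$, separation distance $q_{X,\Omega}=\frac12\min_{j\ne k}\|x_j-x_k\|_2$, and mesh ratio $\rho_{X,\Omega}=h_{X,\Omega}/q_{X,\Omega}$. Kernel: $\phi_m:\mathbb{R}^d\times\mathbb{R}^d\to\mathbb{R}$ is positive definite ($\sum_{i,j}a_ia_j\phi_m(x_i,x_j)\ge0$ for all finite point sets and real coefficients) and translation-invariant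 (for instance radial, $\phi_m(x,y)=\phi_m(\|x-y\|)$); $\widehat\phi_m$ is the Fourier transform of the associated function of $x-y$. The relation $A\sim B$ means $c_1B\le A\le c_2B$ with constants $0<c_1<c_2<\infty$ (here independent of $\xi$). The trial space is $V_{X,\phi_m,\Omega}=\mathrm{span}\{\phi_m(\cdot,x_j):x_j\in X\}$. *)

(* Defs.v *)
From HB Require Import structures.
From mathcomp Require Import all_boot all_order all_algebra.
From mathcomp Require Import all_classical all_reals all_analysis.

Set Implicit Arguments.
Unset Strict Implicit.
Unset Printing Implicit Defensive.

Import Order.TTheory GRing.Theory Num.Theory.
Import numFieldNormedType.Exports.

Local Open Scope classical_set_scope.
Local Open Scope ring_scope.

(* The sigma-algebra generated by the coordinates, i.e. the Borel sets of R^n. *)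
Definition rV_display : measure_display. Proof. exact. Qed.

Section rV_measurable.
Context (R : realType) (n : nat).

Definition rV_coord (i : 'I_n) (v : 'rV[R]_n) : measurableTypeR R := v ord0 i.

Let rV_set0 : g_sigma_preimage rV_coord set0.
Proof. exact: sigma_algebra0. Qed.

Let rV_setC A : g_sigma_preimage rV_coord A -> g_sigma_preimage rV_coord (~` A).
Proof. exact: sigma_algebraC. Qed.

Let rV_bigcup (F : _^nat) : (forall i, g_sigma_preimage rV_coord (F i)) ->
  g_sigma_preimage rV_coord (\bigcup_i (F i)).
Proof. exact: sigma_algebra_bigcup. Qed.

HB.instance Definition _ := @isMeasurable.Build rV_display
  'rV[R]_n (g_sigma_preimage rV_coord) rV_set0 rV_setC rV_bigcup.

End rV_measurable.

Section rV_measurable_fun.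
Context (R : realType).

Lemma measurable_rV_coord n (i : 'I_n) :
  measurable_fun [set: 'rV[R]_n] (@rV_coord R n i).
Proof.
move=> _ Y mY; rewrite setTI; apply: sub_sigma_algebra => /=.
rewrite -bigcup_seq/=; exists i => /=; first by rewrite mem_index_enum.
by exists Y => //; rewrite setTI.
Qed.

Lemma measurable_fun_rVP d (T : measurableType d) n (f : T -> 'rV[R]_n) :
  (forall i, measurable_fun [set: T] (@rV_coord R n i \o f)) ->
  measurable_fun [set: T] f.
Proof.
move=> mf _ A mA.
have : g_sigma_preimage (fun i => @rV_coord R n i \o f) `<=` measurable.
  apply: smallest_sub; first exact: sigma_algebra_measurable.
  rewrite -bigcup_seq/=; apply: bigcup_sub => i _.
  by move=> B [C mC <-]; exact: mf.
by apply; rewrite g_sigma_preimage_comp; exists A.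
Qed.

Definition rV_cons n (p : measurableTypeR R * 'rV[R]_n) : 'rV[R]_n.+1 :=
  row_mx (p.1%:M : 'rV[R]_1) p.2 : 'rV[R]_(1 + n).

Definition rV_uncons n (v : 'rV[R]_n.+1) : measurableTypeR R * 'rV[R]_n :=
  (v ord0 ord0, rsubmx (v : 'rV[R]_(1 + n))).

Lemma rV_unconsK n : cancel (@rV_uncons n) (@rV_cons n).
Proof.
move=> v; rewrite /rV_cons /rV_uncons /=; apply/rowP => i.
have [j|j] := @split_ordP 1 n i => ->; last by rewrite (@row_mxEr _ 1 1 n) mxE.
rewrite (@row_mxEl _ 1 1 n) mxE (ord1 j) eqxx mulr1n.
by congr (v _ _); exact/val_inj.
Qed.

Lemma rV_consK n : cancel (@rV_cons n) (@rV_uncons n).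
Proof.
move=> [t v]; rewrite /rV_cons /rV_uncons /=; congr pair.
  transitivity (row_mx (t%:M : 'rV[R]_1) v ord0 (lshift n ord0)).
    by congr (row_mx _ _ _ _); exact/val_inj.
  by rewrite (@row_mxEl _ 1 1 n) mxE eqxx mulr1n.
exact: (@row_mxKr _ 1 1 n).
Qed.

Lemma measurable_rV_cons n : measurable_fun setT (@rV_cons n).
Proof.
apply: measurable_fun_rVP => i.
have [j|j] := @split_ordP 1 n i => ->.
  rewrite (_ : _ \o _ = fst) //; apply/funext => -[t v] /=.
  by rewrite /rV_coord /rV_cons /= (@row_mxEl _ 1 1 n) mxE (ord1 j) eqxx mulr1n.
rewrite (_ : _ \o _ = @rV_coord R n j \o snd).
  apply: measurableT_comp => //; exact: measurable_rV_coord.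
by apply/funext => -[t v] /=; rewrite /rV_coord /rV_cons /= (@row_mxEr _ 1 1 n).
Qed.

Lemma measurable_rV_uncons n : measurable_fun setT (@rV_uncons n).
Proof.
apply/measurable_fun_pairP; split.
  exact: (@measurable_rV_coord n.+1 ord0).
apply: measurable_fun_rVP => i.
rewrite (_ : _ \o _ = @rV_coord R n.+1 (rshift 1 i)).
  exact: measurable_rV_coord.
by apply/funext => v; rewrite /rV_coord /= mxE.
Qed.

End rV_measurable_fun.

Fixpoint lebesgue_rV (R : realType) (n : nat) : set 'rV[R]_n -> \bar R :=
  match n with
  | 0 => dirac (0 : 'rV[R]_0)
  | k.+1 => pushforward (@lebesgue_measure R \x @lebesgue_rV R k)%E
                        (@rV_cons R k)
  end.

Section lebesgue_rV_measure.
Context (R : realType).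

Let is_sigma_finite_measure n (mu : set 'rV[R]_n -> \bar R) :=
  [/\ mu set0 = 0%E, forall A, (0 <= mu A)%E, semi_sigma_additive mu &
      sigma_finite setT mu].

Let lebesgue_rVP n : is_sigma_finite_measure (@lebesgue_rV R n).
Proof.
elim: n => [|n [mu0 mu_ge0 mu_add mu_fin]].
  by split=> //=; [exact: measure_semi_sigma_additive|exact: sigma_finiteT].
pose H1 := isMeasure.Build _ _ _ _ mu0 mu_ge0 mu_add.
pose m : {measure set _ -> \bar R} := HB.pack (@lebesgue_rV R n) H1.
pose H2 := Measure_isSigmaFinite.Build _ _ _ m mu_fin.
pose s : {sigma_finite_measure set _ -> \bar R} := HB.pack (@lebesgue_rV R n) m H2.
pose p : {measure set _ -> \bar R} :=
  [the {measure set _ -> \bar R} of (@lebesgue_measure R \x s)%E].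
have E : @lebesgue_rV R n.+1 = pushforward p (@rV_cons R n) by [].
rewrite E; split.
- by rewrite /pushforward preimage_set0 measure0.
- by move=> A; exact: (measure_ge0 p).
- have mcons := @measurable_rV_cons R n.
  exact: (@measure_semi_sigma_additive _ _ _ (pushforward p (@rV_cons R n))).
have /sigma_finiteP[F [TF ndF Foo]] := sigma_finiteT (@lebesgue_measure R).
have /sigma_finiteP[G [TG ndG Goo]] := sigma_finiteT s.
exists (fun k => @rV_uncons R n @^-1` (F k `*` G k)).
  rewrite -preimage_bigcup -(preimage_setT (@rV_uncons R n)); congr preimage.
  rewrite -setXTT TF TG predeqE => -[x y]; split.
    move=> [/= [i _ Fnx] [k _ Gky]]; exists (maxn i k) => //; split.
    - by move: x Fnx; exact/subsetPset/ndF/leq_maxl.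
    - by move: y Gky; exact/subsetPset/ndG/leq_maxr.
  by move=> [i _ []/= ? ?]; split; exists i.
move=> k; have [mF Fk] := Foo k; have [mG Gk] := Goo k.
have mFG : measurable (F k `*` G k) by exact: measurableX.
split.
  by rewrite -[X in measurable X]setTI; exact: measurable_rV_uncons.
rewrite /pushforward -comp_preimage.
rewrite (_ : _ \o _ = id) ?preimage_id.
  rewrite (_ : p _ = (@lebesgue_measure R (F k) * s (G k))%E).
    by rewrite lte_mul_pinfty// ge0_fin_numE.
  exact: product_measure1E.
by apply/funext => x /=; rewrite rV_consK.
Qed.

HB.instance Definition _ n := isMeasure.Build _ _ _ (@lebesgue_rV R n)
  (let: And4 h _ _ _ := lebesgue_rVP n in h)
  (let: And4 _ h _ _ := lebesgue_rVP n in h)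
  (let: And4 _ _ h _ := lebesgue_rVP n in h).

HB.instance Definition _ n := Measure_isSigmaFinite.Build _ _ _
  (@lebesgue_rV R n) (let: And4 _ _ _ h := lebesgue_rVP n in h).

End lebesgue_rV_measure.

(* The library norm [`|x|] on ['rV[R]_d] is the maximum norm. *)
Definition dotv (R : realType) (d : nat) (x y : 'rV[R]_d) : R :=
  \sum_(i < d) x 0 i * y 0 i.

Definition enorm (R : realType) (d : nat) (x : 'rV[R]_d) : R :=
  Num.sqrt (dotv x x).

Definition interior_cone_condition (R : realType) (d : nat)
    (Omega : set 'rV[R]_d) : Prop :=
  exists theta r : R, [/\ 0 < theta < pi / 2, 0 < r &
    forall x, Omega x -> exists2 xi : 'rV[R]_d, enorm xi = 1 &
      forall (y : 'rV[R]_d) (l : R), enorm y = 1 -> cos theta <= dotv y xi ->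
        0 <= l <= r -> Omega (x + l *: y)].

(* Near each boundary point [p], in orthonormal coordinates centred at [p]
   whose last axis is [nu], a point is written [p + z + t *: nu] with [z] in
   the hyperplane orthogonal to [nu]; inside the cylinder [|z| < r], [|t| < h]
   the set is the strict epigraph of a Lipschitz function on that
   hyperplane. *)
Definition lipschitz_boundary (R : realType) (d : nat)
    (Omega : set 'rV[R]_d) : Prop :=
  forall p, (closure Omega `\` Omega°) p ->
  exists (nu : 'rV[R]_d) (r h L : R) (g : 'rV[R]_d -> R),
    [/\ enorm nu = 1, 0 < r, 0 < h,
        forall z w, dotv z nu = 0 -> dotv w nu = 0 ->
          `|g z - g w| <= L * enorm (z - w) &
        forall z t, dotv z nu = 0 -> enorm z < r -> `|t| < h ->
          (Omega (p + z + t *: nu) <-> g z < t)].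

Definition bounded_lipschitz_domain (R : realType) (d : nat)
    (Omega : set 'rV[R]_d) : Prop :=
  [/\ open Omega, connected Omega, bounded_set Omega &
      lipschitz_boundary Omega].

Definition fill_distance (R : realType) (d N : nat) (Omega : set 'rV[R]_d)
    (X : 'I_N -> 'rV[R]_d) : R :=
  sup [set inf (range (fun j => enorm (x - X j))) | x in Omega].

Definition separation_distance (R : realType) (d N : nat)
    (X : 'I_N -> 'rV[R]_d) : R :=
  2^-1 * inf [set enorm (X jk.1 - X jk.2) | jk in [set jk | jk.1 != jk.2]].

Definition mesh_ratio (R : realType) (d N : nat) (Omega : set 'rV[R]_d)
    (X : 'I_N -> 'rV[R]_d) : R :=
  fill_distance Omega X / separation_distance X.

Definition iter_partial (R : realType) (d : nat) (s : seq 'I_d)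
    (f : 'rV[R]_d -> R) : 'rV[R]_d -> R :=
  foldr (fun i g => fun x => 'D_(delta_mx 0 i) g x) f s.

Definition schwartz (R : realType) (d : nat) (f : 'rV[R]_d -> R) : Prop :=
  (forall s x, differentiable (iter_partial s f) x) /\
  (forall s (k : nat), exists M : R,
     forall x, enorm x ^+ k * `|iter_partial s f x| <= M).

(* Real and imaginary parts of
   [(2 pi)^(-d/2) * \int f(x) exp(- i <x, xi>) dx] for real-valued [f]. *)
Definition fourier_re (R : realType) (d : nat) (f : 'rV[R]_d -> R)
    (xi : 'rV[R]_d) : R :=
  (2 * pi) `^ (- (d%:R / 2)) *
  \int[@lebesgue_rV R d]_x (f x * cos (dotv x xi)).

Definition fourier_im (R : realType) (d : nat) (f : 'rV[R]_d -> R)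
    (xi : 'rV[R]_d) : R :=
  - ((2 * pi) `^ (- (d%:R / 2)) *
     \int[@lebesgue_rV R d]_x (f x * sin (dotv x xi))).

(* [fhat] is the Fourier transform of [f] in the sense of tempered
   distributions, [<fhat, g> = <f, ghat>] for every Schwartz function [g].
   No integrability of [f] is required; for integrable [f] this is the usual
   integral almost everywhere. Only a real-valued [fhat] is needed, and
   real-valued [g] suffice by linearity, so the complex identity splits into
   its real and imaginary parts. *)
Definition is_fourier_transform (R : realType) (d : nat)
    (f fhat : 'rV[R]_d -> R) : Prop :=
  let mu := @lebesgue_rV R d in
  [/\ measurable_fun setT f, measurable_fun setT fhat &
   forall g, schwartz g ->
    [/\ mu.-integrable setT (fun x => (f x * fourier_re g x)%:E),
        mu.-integrable setT (fun x => (f x * fourier_im g x)%:E),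
        mu.-integrable setT (fun x => (fhat x * g x)%:E),
        \int[mu]_x (fhat x * g x) = \int[mu]_x (f x * fourier_re g x) &
        0 = \int[mu]_x (f x * fourier_im g x)]].

Definition positive_definite (R : realType) (d : nat)
    (phi : 'rV[R]_d -> 'rV[R]_d -> R) : Prop :=
  forall (n : nat) (x : 'I_n -> 'rV[R]_d) (a : 'I_n -> R), injective x ->
    0 <= \sum_(i < n) \sum_(j < n) a i * a j * phi (x i) (x j).

Definition translation_invariant (R : realType) (d : nat)
    (phi : 'rV[R]_d -> 'rV[R]_d -> R) : Prop :=
  forall x y z, phi (x + z) (y + z) = phi x y.

(* For a translation-invariant kernel, [phi x y = kernel_profile phi (x - y)]. *)
Definition kernel_profile (R : realType) (d : nat)
    (phi : 'rV[R]_d -> 'rV[R]_d -> R) : 'rV[R]_d -> R :=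
  fun z => phi z 0.

Definition comparable_funs (R : realType) (T : Type) (A B : T -> R) : Prop :=
  exists c1 c2 : R, [/\ 0 < c1, 0 < c2 &
    forall t, c1 * B t <= A t <= c2 * B t].

(* Functions on [Omega]; values outside [Omega] are irrelevant. *)
Definition trial_space (R : realType) (d N : nat) (X : 'I_N -> 'rV[R]_d)
    (phi : 'rV[R]_d -> 'rV[R]_d -> R) (Omega : set 'rV[R]_d) :
    set ('rV[R]_d -> R) :=
  [set u | exists a : 'I_N -> R,
     forall y, Omega y -> u y = \sum_(j < N) a j * phi y (X j)].

Definition Lp_norm_on (R : realType) (d : nat) (Omega : set 'rV[R]_d)
    (p : \bar R) (u : 'rV[R]_d -> R) : \bar R :=
  'N[@lebesgue_rV R d]_p[(EFin \o u) \_ Omega].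

(* Main.v *)
(* Write f for the profile of the kernel, w for its Fourier transform, q for the
   separation distance of X, and recall h <= rho q, so that it suffices to bound
   |u| by a multiple of q^(-d/2) times its L2 norm.

   Testing the Fourier relation against modulated Gaussians shows that f agrees
   almost everywhere with K(z) = c * \int w(xi) cos(xi.z) dxi, so u agrees almost
   everywhere with U(y) = sum_j a_j K(y - x_j), whose native norm is
   N = c * \int w |sum_j a_j e^(i xi.x_j)|^2.  Gaussian minorants of w and diagonal
   dominance give N <= C q^(d-2m) sum_j U(x_j)^2.  Dually, a k-th order difference
   of step s <= q with k >= m satisfies
   sum_j |Delta^k_(s y) U(z_j)|^2 <= C s^(2m-d) N on any separated family z_j.
   With s = delta q and delta small the differences are absorbed into the sample
   values, leaving sum_j U(x_j)^2 <= C sum_j sum_(1<=l<=k) U(x_j + l s y_j)^2.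
   The directions y_j are taken in the interior cones, with finitely many
   different choices up to a common perturbation ranging over a small cube;
   averaging over that cube turns the right-hand side into C s^(-d) times the
   integral of U^2 over Omega.  The same difference estimate for a single point
   then bounds U pointwise. *)

Require Import Defs.
From mathcomp Require Import all_boot all_order all_algebra.
From mathcomp Require Import all_classical all_reals all_analysis.
From mathcomp Require Import measurable_realfun ess_sup_inf ring lra.
Import Order.TTheory GRing.Theory Num.Theory.
Import numFieldNormedType.Exports.
Set Implicit Arguments.
Unset Strict Implicit.
Unset Printing Implicit Defensive.
Local Open Scope classical_set_scope.
Local Open Scope ring_scope.

(** The obstacle is that the argument samples at points, while the Fourier hypothesis fixes the
    kernel profile only almost everywhere. Its cosine transform representative is defined at every
    point, so sampling makes sense there, and both norms in the conclusion ignore null sets.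

    Differences are normalised so that the base point has coefficient 1: what remains are shifts by
    positive multiples of one direction, and these stay in the cone at that point, hence in the
    domain. The difference estimate, however, requires one step common to the whole family, while
    the cone axes change from point to point; rounding the axes to a finite grid reconciles the two,
    at the price of a factor counting the classes. Since a sample is not controlled by an integral,
    the rounded directions are all perturbed by the same small vector: the estimate is uniform in
    it, and integrating over it replaces the shifted samples by integrals over disjoint cubes.

    The hypothesis [m > d / 2] acts twice: it sums the dyadic Gaussian series that majorises the
    weight, and it makes [2 m - d] positive, so that a small [delta] does yield a small factor. *)

Lemma integrable_mul_bounded (R : realType) d (T : measurableType d) (nu : {measure set T -> \bar R})
  (f g : T -> R) (M : R) :
  nu.-integrable setT (EFin \o f) -> measurable_fun setT g ->
  (forall t, `|g t| <= M) -> nu.-integrable setT (EFin \o (fun t => f t * g t)).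
Proof.
move=> intf mg g1; have mf := measurable_int _ intf.
move/measurable_EFinP in mf.
apply: (@le_integrable _ _ _ nu setT measurableT _ (fun t => M%:E * (EFin \o f) t)%E) => //.
- by apply/measurable_EFinP; exact: measurable_funM.
- move=> t _; rewrite /= lee_fin !normrM mulrC ler_wpM2r// (le_trans (g1 t))//.
  exact: ler_norm.
- exact: integrableZl.
Qed.

(** * Lebesgue measure on row vectors *)

Section affine_line.
Context (R : realType).
Local Notation leb := (@lebesgue_measure R).

(** Both sides are measures in [A], so by uniqueness of Lebesgue measure it suffices to compare them
    on the intervals []u, v]]. *)
Lemma lebesgue_measure_affine (a l : R) (A : set (measurableTypeR R)) :
  0 < l -> measurable A ->
  leb A = (l%:E * leb ((fun t : R => (a + l * t)%R) @^-1` A))%E.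
Proof.
move=> l0 mA.
have mphi : measurable_fun [set: measurableTypeR R]
    (fun t : measurableTypeR R => (a + l * t : measurableTypeR R)).
  by apply: measurable_funD => //; exact: measurable_funM.
pose phi := fun t : measurableTypeR R => (a + l * t : measurableTypeR R).
have lnn : (0 <= l)%R by exact: ltW.
have := @lebesgue_measure_unique R (mscale (NngNum lnn) (pushforward leb phi)).
move=> /(_ mphi) /(_ _ A mA); rewrite /mscale /pushforward /=; apply.
move=> X [[u v] _ <-] /=; rewrite /mscale /=.
rewrite (_ : [set` _] = `]u, v]%classic)//.
have [uv|vu] := ltP u v; last first.
  by rewrite set_itv_ge ?bnd_simp -?leNgt// /pushforward preimage_set0 !measure0 mule0.
rewrite /pushforward.
have -> : phi @^-1` `]u, v] = `](u - a) / l, (v - a) / l]%classic.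
  apply/seteqP; split=> t /=; rewrite !in_itv/= => /andP[].
    by rewrite ltr_pdivrMr// ler_pdivlMr// !lerBrDl ltrBlDl (mulrC t) => -> ->.
  by rewrite ltr_pdivrMr// ler_pdivlMr// !lerBrDl ltrBlDl (mulrC t) => -> ->.
rewrite !lebesgue_measure_itv/= !lte_fin uv ltr_pM2r ?invr_gt0// ltrD2r uv.
rewrite -!EFinD -EFinM; congr EFin.
by rewrite -mulrBl mulrCA divff ?gt_eqF// mulr1; rewrite opprB addrA subrK.
Qed.

Lemma ge0_integral_affine (a l : R) (F : R -> \bar R) : 0 < l ->
  measurable_fun [set: R] F -> (forall x, 0 <= F x)%E ->
  (\int[leb]_x F x = l%:E * \int[leb]_t F (a + l * t)%R)%E.
Proof.
move=> l0 mF F0.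
have mphi : measurable_fun [set: measurableTypeR R]
    (fun t : measurableTypeR R => (a + l * t : measurableTypeR R)).
  by apply: measurable_funD => //; exact: measurable_funM.
pose phi := fun t : measurableTypeR R => (a + l * t : measurableTypeR R).
have lnn : (0 <= l)%R by exact: ltW.
have := @ge0_integral_pushforward _ _ _ _ _ _ mphi leb setT F measurableT mF (fun x _ => F0 x).
rewrite preimage_setT => <-.
have := @ge0_integral_mscale _ _ _ (pushforward leb phi) setT measurableT (NngNum lnn) F mF (fun x _ => F0 x).
move=> /(_ mphi) /= <-.
apply: eq_measure_integral => A mA _.
by rewrite /mscale /= (lebesgue_measure_affine a l0 mA).
Qed.

End affine_line.

Section lebesgue_rV_fubini.
Context (R : realType).
Local Notation leb := (@lebesgue_measure R).
Local Notation mu n := (@lebesgue_rV R n).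

Lemma ge0_integral_rVS n (F : 'rV[R]_n.+1 -> \bar R) :
  measurable_fun setT F -> (forall x, 0 <= F x)%E ->
  (\int[mu n.+1]_x F x = \int[leb]_t \int[mu n]_v F (rV_cons (t, v)))%E.
Proof.
move=> mF F0.
have mc := @measurable_rV_cons R n.
have := @ge0_integral_pushforward _ _ _ _ _ _ mc (leb \x mu n)%E setT F measurableT mF (fun x _ => F0 x).
rewrite preimage_setT => E.
(* The two measures agree as set functions but carry different measure structures, so the integral
   is transported by [eq_measure_integral]. *)
rewrite (_ : \int[_]_x F x = \int[pushforward (leb \x mu n)%E (@rV_cons R n)]_x F x)%E; last first.
  exact: eq_measure_integral.
rewrite E fubini_tonelli1//.
  exact: measurableT_comp.
by move=> x; exact: F0.
Qed.

Lemma integrable_rVS n (F : 'rV[R]_n.+1 -> \bar R) :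
  (mu n.+1).-integrable setT F <-> (leb \x mu n)%E.-integrable setT (F \o @rV_cons R n).
Proof.
have mc := @measurable_rV_cons R n.
have mu' := @measurable_rV_uncons R n.
split=> /integrableP[mF iF]; apply/integrableP.
  split; first exact: measurableT_comp.
  rewrite fubini_tonelli1//=; last first.
    by apply: measurableT_comp => //; exact: measurableT_comp.
  move: iF; rewrite ge0_integral_rVS//; exact: measurableT_comp.
have mF' : measurable_fun setT F.
  have -> : F = F \o @rV_cons R n \o @rV_uncons R n.
    by apply/funext => x /=; rewrite rV_unconsK.
  exact: measurableT_comp.
split => //.
rewrite ge0_integral_rVS//; last exact: measurableT_comp.
by move: iF; rewrite fubini_tonelli1//=; exact: measurableT_comp.
Qed.

Lemma integral_rVS n (F : 'rV[R]_n.+1 -> \bar R) :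
  (mu n.+1).-integrable setT F ->
  (\int[mu n.+1]_x F x = \int[leb]_t \int[mu n]_v F (rV_cons (t, v)))%E.
Proof.
move=> iF; have /integrable_rVS iF' := iF.
have mF := measurable_int _ iF.
have mc := @measurable_rV_cons R n.
have := @integral_pushforward _ _ _ _ _ _ mc (leb \x mu n)%E setT F mF.
rewrite preimage_setT => /(_ iF' measurableT) E.
rewrite (_ : \int[_]_x F x = \int[pushforward (leb \x mu n)%E (@rV_cons R n)]_x F x)%E; last first.
  exact: eq_measure_integral.
by rewrite E -(integral12_prod_meas1 iF').
Qed.

Lemma measurable_rV_affine n (a : 'rV[R]_n) (l : R) :
  measurable_fun setT (fun y : 'rV[R]_n => a + l *: y).
Proof.
apply: measurable_fun_rVP => i.
rewrite (_ : _ \o _ = fun y : 'rV[R]_n => a ord0 i + l * rV_coord i y); last first.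
  by apply/funext => y; rewrite /rV_coord /= !mxE.
apply: measurable_funD => //; apply: measurable_funM => //.
exact: measurable_rV_coord.
Qed.

Lemma rV_consD n (x y : measurableTypeR R * 'rV[R]_n) :
  rV_cons x + rV_cons y = rV_cons ((x.1 + y.1)%R, (x.2 + y.2)%R).
Proof.
by rewrite /rV_cons (@add_row_mx _ 1 1 n) /= raddfD.
Qed.

Lemma rV_consZ n (l : R) (y : measurableTypeR R * 'rV[R]_n) :
  l *: rV_cons y = rV_cons ((l * y.1)%R, (l *: y.2)%R).
Proof.
by rewrite /rV_cons (@scale_row_mx _ 1 1 n) /= scale_scalar_mx.
Qed.

(** Induction on the dimension, treating one coordinate at a time by Tonelli. Translations and
    dilations are the only changes of variable made in several dimensions. *)
Lemma ge0_integral_rV_affine n (a : 'rV[R]_n) (l : R) (F : 'rV[R]_n -> \bar R) :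
  0 < l -> measurable_fun setT F -> (forall x, 0 <= F x)%E ->
  (\int[mu n]_x F x = (l ^+ n)%:E * \int[mu n]_y F (a + l *: y)%R)%E.
Proof.
move=> l0; elim: n a F => [|n IH] a F mF F0.
  rewrite expr0 mul1e; apply: eq_integral => x _.
  by congr F; apply/rowP => -[].
have mFa := measurableT_comp mF (measurable_rV_affine a l).
rewrite ge0_integral_rVS//.
rewrite [in RHS]ge0_integral_rVS//.
pose p := rV_uncons a.
have ma t : measurable_fun setT (fun v : 'rV[R]_n => F (rV_cons (t, v))).
  apply: measurableT_comp => //; apply: measurableT_comp; first exact: measurable_rV_cons.
  exact: measurable_pair1.
have mI : measurable_fun setT (fun t : R => (\int[mu n]_v F (rV_cons (t, v)))%E).
  apply: (@measurable_fun_fubini_tonelli_F _ _ _ _ _ (mu n) (fun tv => F (rV_cons tv))) => //.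
  by apply: measurableT_comp => //; exact: measurable_rV_cons.
have I0 (t : R) : (0 <= \int[mu n]_v F (rV_cons (t, v)))%E by exact: integral_ge0.
rewrite (ge0_integral_affine p.1 l0 mI I0).
rewrite exprS EFinM -muleA; congr (_ * _)%E.
rewrite -ge0_integralZl//; last 3 first.
- apply: (@measurable_fun_fubini_tonelli_F _ _ _ _ _ (mu n) (fun tv => F (a + l *: rV_cons tv)%R)) => //.
  by apply: (measurableT_comp mFa); exact: measurable_rV_cons.
- by move=> t _; exact: integral_ge0.
- by rewrite lee_fin exprn_ge0// ltW.
apply: eq_integral => t _.
rewrite (IH p.2)//; congr (_ * _)%E; apply: eq_integral => v _; congr F.
by rewrite rV_consZ -[a](rV_unconsK) rV_consD.
Qed.

End lebesgue_rV_fubini.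

(** * Gaussians and their Fourier transforms *)

Section gauss_line.
Context (R : realType).
Implicit Types a z t : R.
Local Notation leb := (@lebesgue_measure R).

(** The integrals over [[-(n+1), n+1]] are boundary terms tending to 0, and dominated convergence
    passes to the line. This plays the role of integration by parts below. *)
Lemma integral_derivative_eq0 (F f : R -> R) :
  (forall x, is_derive x (1 : R) F (f x)) -> continuous f ->
  leb.-integrable setT (EFin \o f) ->
  F n%:R @[n --> \oo] --> 0 -> F (- n%:R) @[n --> \oo] --> 0 ->
  \int[leb]_x f x = 0.
Proof.
move=> dF cf intf Fy FNy.
pose I (n : nat) : set R := `[(- n.+1%:R), n.+1%:R]%classic.
pose g n := (EFin \o f) \_ (I n).
have mI n : measurable (I n : set (measurableTypeR R)) by exact: measurable_itv.
have mf := measurable_int _ intf.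
have mg n : measurable_fun [set: measurableTypeR R] (g n).
  by apply/(measurable_restrictT _ _).1 => //; exact: measurable_funTS.
have [] := @dominated_convergence _ (measurableTypeR R) R leb setT measurableT g
    (EFin \o f) (abse \o (EFin \o f)) mg mf.
- apply: aeW => x _; apply: cvg_near_cst.
  exists (Num.trunc `|x|) => // n /= xn; rewrite /g patchE ifT// inE /I /= in_itv/=.
  rewrite -ler_norml (le_trans (ltW (truncnS_gt _)))//.
  by rewrite ler_nat ltnS.
- exact: integrable_abse.
- apply: aeW => x n _; rewrite /g patchE; case: ifPn => //=.
  by rewrite normr0 lee_fin.
move=> _ _ /=.
have FE n : (\int[leb]_x g n x = (F n.+1%:R - F (- n.+1%:R))%:E)%E.
  rewrite /g -integral_mkcond (@continuous_FTC2 _ f F).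
  - by rewrite EFinB.
  - by rewrite -subr_gt0 opprK addr_gt0.
  - exact: continuous_subspaceT.
  - have cF x : {for x, continuous F}.
      apply: differentiable_continuous; apply/derivable1_diffP.
      by have [] := dF x.
    split.
    + by move=> x _; have [] := dF x.
    + by apply: cvg_at_right_filter; exact: cF.
    + by apply: cvg_at_left_filter; exact: cF.
  - by move=> x _; rewrite derive1E; have [_ ->] := dF x.
under eq_fun do rewrite FE.
move=> h1.
have h2 : ((F n.+1%:R - F (- n.+1%:R))%:E @[n --> \oo] --> 0%:E)%E.
  apply: cvg_EFin; first exact: nearW.
  rewrite -[X in _ --> X](subr0 0); apply: cvgB.
    by rewrite (cvg_shiftS (fun n => F n%:R)).
  by rewrite (cvg_shiftS (fun n => F (- n%:R))).
have : (\int[leb]_x (f x)%:E = 0)%E.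
  by apply: (cvg_unique _ h1 h2).
by rewrite /Rintegral => ->.
Qed.

Definition gauss1 (a t : R) := expR (- (a * t ^+ 2)).

Lemma gauss1_ge0 a t : 0 <= gauss1 a t. Proof. exact: expR_ge0. Qed.

Lemma is_derive_gauss1 a t : is_derive t (1 : R) (gauss1 a) (- (2 * a * t) * gauss1 a t).
Proof.
rewrite mulrC; apply: (@is_derive1_comp _ expR (fun t => - (a * t ^+ 2))).
have -> : (fun t : R => - (a * t ^+ 2)) = - (a \*: ((@idfun R) ^+ 2)) by [].
apply: is_derive_eq; rewrite /= expr1 /GRing.scale /=; ring.
Qed.

Lemma continuous_gauss1 a : continuous (gauss1 a).
Proof.
move=> t; apply: differentiable_continuous; apply/derivable1_diffP.
by have [] := is_derive_gauss1 a t.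
Qed.

Lemma measurable_gauss1 a : measurable_fun [set: R] (gauss1 a).
Proof.
apply: (measurableT_comp (@measurable_expR R)).
by apply: measurable_funN; apply: measurable_funM => //; exact: measurable_funX.
Qed.

Lemma gauss1_halfE a t : gauss1 a t = gauss1 (a / 2) t * gauss1 (a / 2) t.
Proof. by rewrite /gauss1 -expRD; congr expR; field. Qed.

Lemma gauss1_le1 a t : 0 <= a -> gauss1 a t <= 1.
Proof. by move=> a0; rewrite /gauss1 -expR0 ler_expR oppr_le0 mulr_ge0// sqr_ge0. Qed.

(** Half of the exponent absorbs the factor [|t|], and the other half is left as an integrable
    majorant. *)
Lemma norm_id_gauss1_le a t : 0 < a -> `|t| * gauss1 a t <= (2^-1 + a^-1) * gauss1 (a / 2) t.
Proof.
move=> a0; rewrite gauss1_halfE mulrA ler_wpM2r ?gauss1_ge0//.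
have h1 : `|t| <= 2^-1 * (1 + t ^+ 2).
  have := sqr_ge0 (`|t| - 1).
  have := real_normK (num_real t); nra.
have h2 : t ^+ 2 * gauss1 (a / 2) t <= 2 * a^-1.
  rewrite /gauss1 expRN ler_pdivrMr ?expR_gt0//.
  apply: (@le_trans _ _ (2 * a^-1 * (a / 2 * t ^+ 2))).
    by rewrite le_eqVlt; apply/orP; left; apply/eqP; field; lra.
  rewrite ler_wpM2l ?mulr_ge0 ?invr_ge0//; first exact: ltW.
  by apply: le_trans (expR_ge1Dx _); rewrite lerDr.
apply: (le_trans (ler_wpM2r (gauss1_ge0 _ _) h1)).
have := gauss1_le1 t (ltW (divr_gt0 a0 (ltr0Sn _ 1))); set g := gauss1 _ _ in h2 *.
by lra.
Qed.

Lemma ge0_integral_gauss1 a : 0 < a ->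
  (\int[leb]_t (gauss1 a t)%:E = (Num.sqrt (pi / a))%:E)%E.
Proof.
move=> a0.
have l0 : 0 < Num.sqrt a by rewrite sqrtr_gt0.
have mg : measurable_fun setT (EFin \o @gauss_fun R).
  by apply/measurable_EFinP; exact: measurable_gauss_fun.
have := ge0_integral_affine 0 l0 mg (fun x => gauss_fun_ge0 x).
rewrite /comp integralT_gauss; under eq_integral.
  move=> t _; rewrite add0r /gauss_fun exprMn sqr_sqrtr; last exact: ltW.
  over.
move=> /(congr1 (fun x => ((Num.sqrt a)^-1%:E * x)%E)).
rewrite [RHS]muleA -!EFinM mulVf ?gt_eqF// mul1e => <-.
by rewrite sqrtrM ?pi_ge0// sqrtrV 1?mulrC// ltW.
Qed.

Lemma integrable_gauss1 a : 0 < a -> leb.-integrable setT (EFin \o gauss1 a).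
Proof.
move=> a0; apply/integrableP; split; first by apply/measurable_EFinP; exact: measurable_gauss1.
under eq_integral do rewrite /= ger0_norm ?gauss1_ge0//.
by rewrite ge0_integral_gauss1// ltry.
Qed.

Lemma integrable_id_gauss1 a : 0 < a -> leb.-integrable setT (EFin \o (fun t => t * gauss1 a t)).
Proof.
move=> a0; apply: (@le_integrable _ _ _ leb setT measurableT _
    (EFin \o (fun t => (2^-1 + a^-1) * gauss1 (a / 2) t))).
- by apply/measurable_EFinP; apply: measurable_funM => //; exact: measurable_gauss1.
- move=> t _ /=; rewrite lee_fin normrM (ger0_norm (gauss1_ge0 _ _)).
  rewrite [leRHS]ger0_norm ?norm_id_gauss1_le// mulr_ge0 ?gauss1_ge0//.
  by rewrite addr_ge0// invr_ge0 ltW.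
- have := integrableZl measurableT (2^-1 + a^-1) (integrable_gauss1 (divr_gt0 a0 (ltr0Sn _ 1))).
  by apply: eq_integrable => //= t _; rewrite EFinM.
Qed.

Local Notation J a := (fun z => \int[leb]_t (gauss1 a t * cos (t * z))).

Lemma integrable_gauss1_cos a z : 0 < a ->
  leb.-integrable setT (EFin \o (fun t => gauss1 a t * cos (t * z))).
Proof.
move=> a0; apply: (integrable_mul_bounded (M := 1)); first exact: integrable_gauss1.
  apply: measurable_funTS; apply: (measurableT_comp (continuous_measurable_fun (@continuous_cos R))).
  exact: measurable_funM.
by move=> t; rewrite ler_norml cos_geN1 cos_le1.
Qed.

Lemma integrable_gauss1_sin a z : 0 < a ->
  leb.-integrable setT (EFin \o (fun t => gauss1 a t * sin (t * z))).
Proof.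
move=> a0; apply: (integrable_mul_bounded (M := 1)); first exact: integrable_gauss1.
  apply: measurable_funTS; apply: (measurableT_comp (continuous_measurable_fun (@continuous_sin R))).
  exact: measurable_funM.
by move=> t; rewrite ler_norml sin_geN1 sin_le1.
Qed.

Lemma integrable_id_gauss1_sin a z : 0 < a ->
  leb.-integrable setT (EFin \o (fun t => t * gauss1 a t * sin (t * z))).
Proof.
move=> a0; apply: (integrable_mul_bounded (M := 1)); first exact: integrable_id_gauss1.
  apply: measurable_funTS; apply: (measurableT_comp (continuous_measurable_fun (@continuous_sin R))).
  exact: measurable_funM.
by move=> t; rewrite ler_norml sin_geN1 sin_le1.
Qed.

Lemma is_derive_cosM (t z : R) : is_derive z (1 : R) (fun z => cos (t * z)) (- sin (t * z) * t).
Proof.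
apply: (@is_derive1_comp _ cos (fun z => t * z)).
have -> : (fun z : R => t * z) = t \*: (@idfun R) by [].
by apply: is_derive_eq; rewrite /GRing.scale /= mulr1.
Qed.

Lemma is_derive_sinM (t z : R) : is_derive t (1 : R) (fun t => sin (t * z)) (cos (t * z) * z).
Proof.
apply: (@is_derive1_comp _ sin (fun t => t * z)).
have -> : (fun t : R => t * z) = z \*: (@idfun R).
  by apply/funext => x /=; rewrite mulrC.
by apply: is_derive_eq; rewrite /GRing.scale /= mulr1.
Qed.

Lemma is_derive_gauss_cos a z : 0 < a ->
  is_derive z (1 : R) (J a) (- \int[leb]_t (t * gauss1 a t * sin (t * z))).
Proof.
move=> a0.
have zI : `]z - 1, z + 1[%classic z by rewrite /= in_itv/= ltrBlDr ltrDl ltr01.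
pose f z t := gauss1 a t * cos (t * z).
have dE t y : is_derive y (1 : R) (f ^~ t) (- (t * gauss1 a t * sin (t * y))).
  rewrite /f (_ : (fun x => _) = gauss1 a t \*: (fun z => cos (t * z)))//.
  have h := is_derive_cosM t y.
  apply: is_derive_eq; rewrite /GRing.scale /=; ring.
have pE y t : partial1of2 f y t = - (t * gauss1 a t * sin (t * y)).
  by rewrite partial1of2E; have [_ ->] := dE t y.
have d1 (x y : R) : `]z - 1, z + 1[%classic x -> setT y -> derivable (f^~ y) x 1.
  by move=> _ _; have [] := dE y x.
have int1 (x : R) : `]z - 1, z + 1[%classic x -> leb.-integrable setT (EFin \o f x).
  by move=> _; exact: integrable_gauss1_cos.
have intG : leb.-integrable setT (EFin \o (fun t => `|t * gauss1 a t|)).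
  exact: integrable_norm (integrable_id_gauss1 a0).
have ub (x y : R) : `]z - 1, z + 1[%classic x -> setT y ->
    `|partial1of2 f x y| <= `|y * gauss1 a y|.
  move=> _ _; rewrite pE normrN normrM ler_piMr//.
  by rewrite ler_norml sin_geN1 sin_le1.
have G0 (y : R) : 0 <= `|y * gauss1 a y| by [].
have hd := derivable_under_integral measurableT zI int1 d1 G0 intG ub.
have hE := differentiation_under_integral measurableT zI int1 d1 G0 intG ub.
split; first exact: hd.
rewrite -derive1E hE -mulN1r -RintegralZl//; last exact: integrable_id_gauss1_sin.
by apply: eq_Rintegral => t _; rewrite pE mulN1r.
Qed.

(** Integration by parts: the derivative of [gauss1 a t * sin (t * z)] has integral 0. Combined with
    [is_derive_gauss_cos], it gives the linear equation [J' = - z / (2 a) * J]. *)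
Lemma gauss_sin_cos a z : 0 < a ->
  \int[leb]_t (t * gauss1 a t * sin (t * z)) = z / (2 * a) * J a z.
Proof.
move=> a0.
pose F t := gauss1 a t * sin (t * z).
pose f t := - (2 * a) * (t * gauss1 a t * sin (t * z)) + z * (gauss1 a t * cos (t * z)).
have dF (t : R) : is_derive t (1 : R) F (f t).
  rewrite /F (_ : (fun x => _) = gauss1 a * (fun t => sin (t * z)))//.
  have h1 := is_derive_sinM t z; have h2 := is_derive_gauss1 a t.
  apply: is_derive_eq; rewrite /GRing.scale /= /f; ring.
have int1 := integrableZl measurableT (- (2 * a)) (integrable_id_gauss1_sin z a0).
have int2 := integrableZl measurableT z (integrable_gauss1_cos z a0).
have ctz (g : R -> R) : continuous g -> continuous (fun t : R => g (t * z)).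
  move=> cg t; apply: continuous_comp; last exact: cg.
  by apply: cvgMr_tmp; exact: cvg_id.
have cf : continuous f.
  move=> t; apply: cvgD.
    apply: cvgMl_tmp; apply: cvgM; last exact: ctz (@continuous_sin R) t.
    by apply: cvgM; [exact: cvg_id|exact: continuous_gauss1].
  apply: cvgMl_tmp; apply: cvgM; last exact: ctz (@continuous_cos R) t.
  exact: continuous_gauss1.
have h0 : gauss1 a n%:R @[n --> \oo] --> 0.
  rewrite (_ : (fun n : nat => _) = (fun n => expR (- (n%:R ^+ 2 * a)))); last first.
    by apply/funext => n; rewrite /gauss1 mulrC.
  apply: (@cvg_comp _ _ _ (fun n : nat => n%:R ^+ 2 * a) (fun x => expR (- x)) _ +oo%R).
    apply: (@cvg_comp _ _ _ (fun n : nat => n%:R ^+ 2) (fun x => x * a) _ +oo%R).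
      by apply: (@cvg_comp _ _ _ (fun n : nat => n%:R) (fun x => x ^+ 2) _ +oo%R);
        [exact: cvgr_idn|exact: cvgr_expr2].
    by apply: (@gt0_cvgMly R (nbhs +oo%R) _ a id a0); exact: cvg_id.
  exact: cvgr_expR.
have sq (u : nat -> R) : (forall n, `|u n| <= gauss1 a n%:R) -> u n @[n --> \oo] --> 0.
  move=> ub; apply: (@squeeze_cvgr _ _ _ _ (fun n : nat => - gauss1 a n%:R) (fun n : nat => gauss1 a n%:R)) => //.
    by near=> n; rewrite -ler_norml.
  by rewrite -[X in _ --> X]oppr0; exact: cvgN.
have sb (u x : R) : 0 <= u -> `|u * sin x| <= u.
  by move=> u0; rewrite normrM (ger0_norm u0) ler_piMr// ler_norml sin_geN1 sin_le1.
have intf : leb.-integrable setT (EFin \o f).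
  have := integrableD measurableT int1 int2.
  by apply: eq_integrable => //= t _; rewrite -!EFinM -EFinD.
have := integral_derivative_eq0 dF cf intf.
rewrite /f RintegralD// !RintegralZl//; last 2 first.
- exact: integrable_id_gauss1_sin.
- exact: integrable_gauss1_cos.
have Fy : F n%:R @[n --> \oo] --> 0.
  by apply: sq => n; exact: sb (gauss1_ge0 _ _).
have FNy : F (- n%:R) @[n --> \oo] --> 0.
  by apply: sq => n; rewrite /F /gauss1 sqrrN; exact: sb (expR_ge0 _).
move=> /(_ Fy FNy) /eqP; rewrite mulNr addrC subr_eq0 => /eqP h.
by rewrite mulrAC h mulrC mulKf// gt_eqF// mulr_gt0.
Unshelve. all: by end_near. Qed.

(** Solves that equation with the integrating factor [exp (z^2 / (4 a))], written as a [gauss1] with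
    negative parameter: the product [P] has zero derivative, hence equals its value at 0. *)
Lemma gauss_cos a z : 0 < a ->
  \int[leb]_t (gauss1 a t * cos (t * z)) = Num.sqrt (pi / a) * gauss1 (4 * a)^-1 z.
Proof.
move=> a0.
pose P z := J a z * gauss1 (- (4 * a)^-1) z.
have dP y : is_derive y (1 : R) P 0.
  have h1 := is_derive_gauss_cos y a0.
  have h2 := is_derive_gauss1 (- (4 * a)^-1) y.
  rewrite /P (_ : (fun x => _) = J a * gauss1 (- (4 * a)^-1))//.
  apply: is_derive_eq; rewrite /GRing.scale /= gauss_sin_cos//.
  by field; lra.
have := is_derive_0_is_cst z 0 dP.
rewrite /P.
have -> : \int[leb]_t (gauss1 a t * cos (t * 0)) = Num.sqrt (pi / a).
  under eq_Rintegral do rewrite mulr0 cos0 mulr1.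
  by rewrite /Rintegral ge0_integral_gauss1.
rewrite [gauss1 _ 0]/gauss1 expr0n/= mulr0 oppr0 expR0 mulr1 => <-.
rewrite -mulrA (_ : _ * gauss1 _ z = 1) ?mulr1//.
by rewrite /gauss1 -expRD mulNr opprK subrr expR0.
Qed.

Lemma Rintegral_opp (f : R -> R) : leb.-integrable setT (EFin \o f) ->
  \int[leb]_t f (- t) = \int[leb]_t f t.
Proof.
move=> intf; have mf := measurable_int _ intf.
have mN : measurable_fun setT (-%R : measurableTypeR R -> measurableTypeR R).
  exact: measurable_funN.
have eN D (g : R -> \bar R) : (\int[leb]_(t in D) g t = \int[pushforward leb (-%R : measurableTypeR R -> measurableTypeR R)]_(t in D) g t)%E.
  by apply: eq_measure_integral => A mA _; exact/esym/lebesgue_measureN.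
have iN : leb.-integrable setT ((EFin \o f) \o (-%R : measurableTypeR R -> measurableTypeR R)).
  apply/integrableP; split; first exact: measurableT_comp.
  move/integrableP : intf => [_]; rewrite eN ge0_integral_pushforward//.
  exact: measurableT_comp.
rewrite /Rintegral; congr fine; rewrite [RHS]eN integral_pushforward//.
Qed.

Lemma gauss_sin a z : 0 < a -> \int[leb]_t (gauss1 a t * sin (t * z)) = 0.
Proof.
move=> a0; have intf := integrable_gauss1_sin z a0.
have h := Rintegral_opp intf.
suff : \int[leb]_t (gauss1 a t * sin (t * z)) = - \int[leb]_t (gauss1 a t * sin (t * z)).
  by move=> /eqP; rewrite -addr_eq0 -mulr2n mulrn_eq0 => /eqP.
rewrite -{1}h -mulN1r -RintegralZl//; apply: eq_Rintegral => t _.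
by rewrite /gauss1 sqrrN mulNr sinN mulN1r mulrN.
Qed.

End gauss_line.

(** * Fourier transform of the Gaussian in several variables *)

Section gauss_rV.
Context (R : realType).
Local Notation leb := (@lebesgue_measure R).
Local Notation mu n := (@lebesgue_rV R n).

Lemma dotvC n (x y : 'rV[R]_n) : dotv x y = dotv y x.
Proof. by apply: eq_bigr => i _; rewrite mulrC. Qed.

Lemma dotvDl n (x y z : 'rV[R]_n) : dotv (x + y) z = dotv x z + dotv y z.
Proof. by rewrite /dotv -big_split /=; apply: eq_bigr => i _; rewrite !mxE mulrDl. Qed.

Lemma dotvDr n (x y z : 'rV[R]_n) : dotv z (x + y) = dotv z x + dotv z y.
Proof. by rewrite dotvC dotvDl !(dotvC _ z). Qed.

Lemma dotvZl n a (x z : 'rV[R]_n) : dotv (a *: x) z = a * dotv x z.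
Proof. by rewrite /dotv mulr_sumr; apply: eq_bigr => i _; rewrite !mxE mulrA. Qed.

Lemma dotvZr n a (x z : 'rV[R]_n) : dotv z (a *: x) = a * dotv z x.
Proof. by rewrite dotvC dotvZl dotvC. Qed.

Lemma dotvNl n (x z : 'rV[R]_n) : dotv (- x) z = - dotv x z.
Proof. by rewrite -scaleN1r dotvZl mulN1r. Qed.

Lemma dotvNr n (x z : 'rV[R]_n) : dotv z (- x) = - dotv z x.
Proof. by rewrite dotvC dotvNl dotvC. Qed.

Lemma dotvBl n (x y z : 'rV[R]_n) : dotv (x - y) z = dotv x z - dotv y z.
Proof. by rewrite dotvDl dotvNl. Qed.

Lemma dotvBr n (x y z : 'rV[R]_n) : dotv z (x - y) = dotv z x - dotv z y.
Proof. by rewrite dotvDr dotvNr. Qed.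

Lemma dotv0l n (z : 'rV[R]_n) : dotv 0 z = 0.
Proof. by rewrite /dotv big1// => i _; rewrite mxE mul0r. Qed.

Lemma dotvv_ge0 n (x : 'rV[R]_n) : 0 <= dotv x x.
Proof. by apply: sumr_ge0 => i _; rewrite -expr2 sqr_ge0. Qed.

Lemma enorm_ge0 n (x : 'rV[R]_n) : 0 <= enorm x.
Proof. exact: sqrtr_ge0. Qed.

Lemma enorm_sqr n (x : 'rV[R]_n) : enorm x ^+ 2 = dotv x x.
Proof. by rewrite sqr_sqrtr// dotvv_ge0. Qed.

Lemma dotv_cons n (t s : R) (u v : 'rV[R]_n) :
  dotv (rV_cons (t, u)) (rV_cons (s, v)) = t * s + dotv u v.
Proof.
have E (k : 'I_n) (t0 : R) (v0 : 'rV[R]_n) : rV_cons (t0, v0) 0 (lift ord0 k) = v0 0 k.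
  rewrite /rV_cons (_ : lift ord0 k = rshift 1 k); last exact: val_inj.
  by rewrite (@row_mxEr _ 1 1 n).
have E0 (t0 : R) (v0 : 'rV[R]_n) : rV_cons (t0, v0) 0 ord0 = t0.
  exact: (congr1 fst (rV_consK (t0, v0))).
rewrite /dotv big_ord_recl !E0; congr (_ + _); apply: eq_bigr => i _.
by rewrite !E.
Qed.

Lemma rV0E (v : 'rV[R]_0) : v = 0. Proof. by apply/rowP => -[]. Qed.

Lemma measurable_dotvl n (z : 'rV[R]_n) : measurable_fun setT (fun x : 'rV[R]_n => dotv x z).
Proof.
apply: measurable_sum => i; apply: measurable_funM => //.
exact: (@measurable_rV_coord R n i).
Qed.

Lemma measurable_dotvv n : measurable_fun setT (fun x : 'rV[R]_n => dotv x x).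
Proof.
apply: measurable_sum => i; apply: measurable_funM;
exact: (@measurable_rV_coord R n i).
Qed.

Definition gauss n (a : R) (x : 'rV[R]_n) := expR (- (a * dotv x x)).

Lemma gauss_gt0 n a (x : 'rV[R]_n) : 0 < gauss a x.
Proof. exact: expR_gt0. Qed.

Lemma gauss_ge0 n a (x : 'rV[R]_n) : 0 <= gauss a x.
Proof. exact: expR_ge0. Qed.

Lemma measurable_gauss n a : measurable_fun setT (@gauss n a).
Proof.
apply: (measurableT_comp (@measurable_expR R)).
apply: measurable_funN; apply: measurable_funM => //; exact: measurable_dotvv.
Qed.

Lemma gauss_cons n a (t : R) (v : 'rV[R]_n) : gauss a (rV_cons (t, v)) = gauss1 a t * gauss a v.
Proof. by rewrite /gauss /gauss1 dotv_cons mulrDr opprD expRD expr2. Qed.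

Lemma ge0_integral_gauss n a : 0 < a ->
  (\int[mu n]_x (gauss a x)%:E = (Num.sqrt (pi / a) ^+ n)%:E)%E.
Proof.
move=> a0; elim: n => [|n IH].
  rewrite integral_dirac//=; last by apply/measurable_EFinP; exact: measurable_gauss.
  by rewrite diracT mul1e /gauss dotv0l mulr0 oppr0 expR0 expr0.
rewrite ge0_integral_rVS; last 2 first.
- by apply/measurable_EFinP; exact: measurable_gauss.
- by move=> x; rewrite lee_fin gauss_ge0.
under eq_integral => t _.
  under eq_integral do rewrite gauss_cons EFinM.
  rewrite ge0_integralZl//=; last 3 first.
  - by apply/measurable_EFinP; exact: measurable_gauss.
  - by move=> x _; rewrite lee_fin gauss_ge0.
  - by rewrite lee_fin gauss1_ge0.
  rewrite IH; over.
rewrite ge0_integralZr//=; last 2 first.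
- by apply/measurable_EFinP; exact: measurable_gauss1.
- by move=> x _; rewrite lee_fin gauss1_ge0.
by rewrite ge0_integral_gauss1// -EFinM exprS.
Qed.

Lemma integrable_gauss n a : 0 < a -> (mu n).-integrable setT (EFin \o gauss a).
Proof.
move=> a0; apply/integrableP; split; first by apply/measurable_EFinP; exact: measurable_gauss.
under eq_integral do rewrite /= ger0_norm ?gauss_ge0//.
by rewrite ge0_integral_gauss// ltry.
Qed.

Lemma measurable_cos_dotv n (z : 'rV[R]_n) : measurable_fun setT (fun x : 'rV[R]_n => cos (dotv x z)).
Proof.
apply: (measurableT_comp (continuous_measurable_fun (@continuous_cos R))).
exact: measurable_dotvl.
Qed.

Lemma measurable_sin_dotv n (z : 'rV[R]_n) : measurable_fun setT (fun x : 'rV[R]_n => sin (dotv x z)).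
Proof.
apply: (measurableT_comp (continuous_measurable_fun (@continuous_sin R))).
exact: measurable_dotvl.
Qed.

Lemma norm_cos_le1 (x : R) : `|cos x| <= 1.
Proof. by rewrite ler_norml cos_geN1 cos_le1. Qed.

Lemma norm_sin_le1 (x : R) : `|sin x| <= 1.
Proof. by rewrite ler_norml sin_geN1 sin_le1. Qed.

Lemma integrable_gauss_cos n a (z : 'rV[R]_n) : 0 < a ->
  (mu n).-integrable setT (EFin \o (fun x => gauss a x * cos (dotv x z))).
Proof.
move=> a0; apply: (integrable_mul_bounded (M := 1)).
- exact: integrable_gauss.
- exact: measurable_cos_dotv.
- by move=> x; exact: norm_cos_le1.
Qed.

Lemma integrable_gauss_sin n a (z : 'rV[R]_n) : 0 < a ->
  (mu n).-integrable setT (EFin \o (fun x => gauss a x * sin (dotv x z))).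
Proof.
move=> a0; apply: (integrable_mul_bounded (M := 1)).
- exact: integrable_gauss.
- exact: measurable_sin_dotv.
- by move=> x; exact: norm_sin_le1.
Qed.

(** The cosine and sine formulas are proved together, because splitting off a coordinate mixes them
    through the addition formulas. *)
Lemma gauss_rV_fourier n a (z : 'rV[R]_n) : 0 < a ->
  \int[mu n]_x (gauss a x * cos (dotv x z)) =
    Num.sqrt (pi / a) ^+ n * gauss (4 * a)^-1 z /\
  \int[mu n]_x (gauss a x * sin (dotv x z)) = 0.
Proof.
move=> a0; elim: n z => [|n IH] z.
  rewrite /Rintegral !integral_dirac//=; last 2 first.
  - by apply/measurable_EFinP; apply: measurable_funM;
      [exact: measurable_gauss|exact: measurable_sin_dotv].
  - by apply/measurable_EFinP; apply: measurable_funM;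
      [exact: measurable_gauss|exact: measurable_cos_dotv].
  by rewrite indicT !mul1r /gauss (rV0E z) !dotv0l sin0 cos0 !mulr0 oppr0 expR0 !mulr1.
rewrite -(rV_unconsK z); case: (rV_uncons z) => s v.
have [IHc IHs] := IH v.
have ic := integrable_gauss_cos v a0.
have is_ := integrable_gauss_sin v a0.
have finE (f : 'rV[R]_n -> R) : (mu n).-integrable setT (EFin \o f) ->
    (\int[mu n]_x (f x)%:E = (\int[mu n]_x f x)%:E)%E.
  by move=> fi; rewrite /Rintegral fineK//; exact: integrable_fin_num.
have tE (f : R -> R) (A : R) : leb.-integrable setT (EFin \o f) ->
  (\int[leb]_x (f x * A)%:E = (\int[leb]_x f x * A)%:E)%E.
  move=> fi; under eq_integral do rewrite EFinM.
  rewrite integralZr//= /Rintegral EFinM fineK//; exact: integrable_fin_num.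
split.
  rewrite {1}/Rintegral integral_rVS; last exact: integrable_gauss_cos.
  under eq_integral => t _.
    rewrite (_ : \int[_]_v _ = (gauss1 a t * cos (t * s) * (Num.sqrt (pi / a) ^+ n * gauss (4 * a)^-1 v))%:E)%E.
      over.
    rewrite -IHc; transitivity (\int[mu n]_u (gauss1 a t * cos (t * s) * (gauss a u * cos (dotv u v))
       - gauss1 a t * sin (t * s) * (gauss a u * sin (dotv u v)))%:E)%E.
      apply: eq_integral => u _; rewrite gauss_cons dotv_cons cosD; congr EFin; ring.
    rewrite finE.
      rewrite RintegralB//; last 2 first.
        exact: (integrableZl measurableT (gauss1 a t * cos (t * s)) ic).
        exact: (integrableZl measurableT (gauss1 a t * sin (t * s)) is_).
      by rewrite !RintegralZl// IHs mulr0 subr0.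
    apply: (integrableB measurableT (integrableZl measurableT (gauss1 a t * cos (t * s)) ic)
       (integrableZl measurableT (gauss1 a t * sin (t * s)) is_)).
  rewrite tE; last exact: integrable_gauss1_cos.
  by rewrite /= gauss_cos// gauss_cons exprS; ring.
rewrite {1}/Rintegral integral_rVS; last exact: integrable_gauss_sin.
under eq_integral => t _.
  rewrite (_ : \int[_]_v _ = (gauss1 a t * sin (t * s) * (Num.sqrt (pi / a) ^+ n * gauss (4 * a)^-1 v))%:E)%E.
    over.
  rewrite -IHc; transitivity (\int[mu n]_u (gauss1 a t * sin (t * s) * (gauss a u * cos (dotv u v))
     + gauss1 a t * cos (t * s) * (gauss a u * sin (dotv u v)))%:E)%E.
    apply: eq_integral => u _; rewrite gauss_cons dotv_cons sinD; congr EFin; ring.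
  rewrite finE.
    rewrite RintegralD//; last 2 first.
      exact: (integrableZl measurableT (gauss1 a t * sin (t * s)) ic).
      exact: (integrableZl measurableT (gauss1 a t * cos (t * s)) is_).
    by rewrite !RintegralZl// IHs mulr0 addr0.
  apply: (integrableD measurableT (integrableZl measurableT (gauss1 a t * sin (t * s)) ic)
     (integrableZl measurableT (gauss1 a t * cos (t * s)) is_)).
rewrite tE; last exact: integrable_gauss1_sin.
by rewrite /= gauss_sin// mul0r.
Qed.

End gauss_rV.

(** * Gaussian sums over separated points *)

Section cube.
Context (R : realType).
Local Notation leb := (@lebesgue_measure R).
Local Notation mu n := (@lebesgue_rV R n).

Implicit Types r : R.

Definition cube n (r : R) : set 'rV[R]_n := [set y | forall i, `|y 0 i| < r].
Arguments cube : clear implicits.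

Lemma measurable_cube n r : measurable (cube n r).
Proof.
have -> : cube n r = \big[setI/setT]_(i < n) (@rV_coord R n i @^-1` `]- r, r[%classic).
  apply/seteqP; split => [y cy|y].
    rewrite -bigcap_seq => i _ /=; rewrite in_itv/= -ltr_norml; exact: cy.
  rewrite -bigcap_seq => cy i; move: (cy i); rewrite /= mem_index_enum in_itv/= -ltr_norml.
  exact.
apply: big_ind => //; first exact: measurableI.
move=> i _; rewrite -[X in measurable X]setTI; exact: measurable_rV_coord.
Qed.

Lemma integral_cube n r : 0 < r -> (\int[mu n]_v (\1_(cube n r) v)%:E = ((2 * r) ^+ n)%:E)%E.
Proof.
move=> r0; elim: n => [|n IH].
  rewrite integral_dirac//=; last first.
    by apply/measurable_EFinP; apply: measurable_indic; exact: measurable_cube.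
  by rewrite expr0 diracT mul1e indicE mem_set// => -[].
rewrite ge0_integral_rVS//; last first.
  by apply/measurable_EFinP; apply: measurable_indic; exact: measurable_cube.
have E (t : R) (v : 'rV[R]_n) : (\1_(cube n.+1 r) (rV_cons (t, v)) : R) =
    \1_(`]- r, r[%classic : set R) t * \1_(cube n r) v.
  have h : cube n.+1 r (rV_cons (t, v)) <-> (`]- r, r[%classic : set R) t /\ cube n r v.
    have e0 : rV_cons (t, v) 0 ord0 = t by exact: (congr1 fst (rV_consK (t, v))).
    have e1 i : rV_cons (t, v) 0 (lift ord0 i) = v 0 i.
      rewrite /rV_cons (_ : lift ord0 i = rshift 1 i); last exact: val_inj.
      by rewrite (@row_mxEr _ 1 1 n).
    split=> [c|[c1 c2] i].
      split; first by rewrite /= in_itv/= -ltr_norml -e0; exact: c.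
      by move=> i; rewrite -e1; exact: c.
    have [j ->|->] := unliftP ord0 i; first by rewrite e1.
    by rewrite e0; move: c1; rewrite /= in_itv/= -ltr_norml.
  rewrite !indicE -natrM mulnb; congr (nat_of_bool _)%:R.
  apply/idP/idP; first by rewrite inE => /h[a b]; apply/andP; rewrite !inE.
  by move/andP; rewrite !inE => ab; exact/h.
under eq_integral => t _.
  under eq_integral do rewrite E EFinM.
  rewrite ge0_integralZl//=; last first.
    by apply/measurable_EFinP; apply: measurable_indic; exact: measurable_cube.
  rewrite IH; over.
rewrite ge0_integralZr//=; last 2 first.
- by apply/measurable_EFinP; exact: measurable_indic.
- by rewrite lee_fin exprn_ge0// mulr_ge0// ltW.
have L : leb (`]- r, r[%classic : set R) = (2 * r)%:E.
  rewrite lebesgue_measure_itv/= lte_fin ifT; last lra.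
  by rewrite -EFinD; congr EFin; lra.
rewrite integral_indic// setIT [X in (X * _)%E](_ : _ = (2 * r)%:E)//.
by rewrite -EFinM exprS.
Qed.

Lemma dotv_sq_le n (x : 'rV[R]_n) (r : R) : (forall i, `|x 0 i| <= r) -> dotv x x <= n%:R * r ^+ 2.
Proof.
move=> xr; rewrite /dotv; apply: (@le_trans _ _ (\sum_(i < n) r ^+ 2)).
  apply: ler_sum => i _; rewrite -expr2 -real_normK ?num_real//.
  by rewrite lerXn2r// ?nnegrE//; exact: le_trans (xr i).
by rewrite sumr_const card_ord mulr_natl.
Qed.

Lemma sum_disjoint_indic_le1 (T : Type) N (A : 'I_N -> set T) (x : T) :
  (forall i j, A i x -> A j x -> i = j) -> \sum_(i < N) (\1_(A i) x : R) <= 1.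
Proof.
move=> dA; have [[i Ai]|nA] := pselect (exists i, A i x); last first.
  rewrite big1 ?ler01// => i _; rewrite indicE memNset// => Ai; apply: nA; by exists i.
rewrite (bigD1 i)//= big1 ?addr0; first by rewrite indicE; case: (_ \in _); rewrite ?ler01.
move=> j /eqP ij; rewrite indicE memNset// => Aj; apply: ij; exact: dA.
Qed.

End cube.
Arguments cube {R} n r.

Section row_sum.
Context (R : realType).
Local Notation mu n := (@lebesgue_rV R n).

(** The factor 2 matches the [1/2] in the separation distance: [q] is a radius for which open balls
    around the points are disjoint. *)
Definition well_separated n N (x : 'I_N -> 'rV[R]_n) (q : R) :=
  forall i j, i != j -> 2 * q <= enorm (x i - x j).

(* Each term is dominated by the mean of a wider Gaussian over a small cube
   around [x j], and these cubes are disjoint. *)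
Lemma gauss_row_sum n : exists2 S : R, 0 < S &
  forall N (x : 'I_N -> 'rV[R]_n) (q : R), 0 < q -> well_separated x q ->
  forall y, \sum_(j < N) gauss (4 * q ^+ 2)^-1 (y - x j) <= S.
Proof.
(* With this choice [n * r^2 < 1], so the cube lies in the open Euclidean unit ball. After rescaling
   by [q] the points are at distance at least 2, which makes the cubes around them disjoint. *)
pose r : R := n.+1%:R^-1.
have r0 : 0 < r by rewrite invr_gt0.
pose V := (2 * r) ^+ n.
have V0 : 0 < V by rewrite exprn_gt0// mulr_gt0.
have nr1 : n%:R * r ^+ 2 < 1.
  rewrite expr2 mulrA; have : n%:R * r < 1 by rewrite ltr_pdivrMr// mul1r ltr_nat.
  have : r <= 1 by rewrite invf_le1// ler1n.
  have : 0 <= n%:R * r by rewrite mulr_ge0// ltW.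
  nra.
have nr := ltW nr1.
exists (expR 1 * Num.sqrt (pi / 8^-1) ^+ n / V).
  rewrite divr_gt0// mulr_gt0 ?expR_gt0// exprn_gt0// sqrtr_gt0 divr_gt0// ?pi_gt0//.
move=> N x q q0 sep y.
pose z j := q^-1 *: (y - x j).
have gE j : gauss (4 * q ^+ 2)^-1 (y - x j) = gauss 4^-1 (z j).
  rewrite /gauss /z dotvZl dotvZr; congr (expR (- _)).
  by field; rewrite gt_eqF.
have sepz i j : i != j -> 4 <= dotv (z i - z j) (z i - z j).
  move=> ij; rewrite -scalerBr opprB [y - x i + _]addrC addrA subrK.
  rewrite dotvZl dotvZr mulrA -expr2 -enorm_sqr -exprMn.
  have -> : (4 : R) = 2 ^+ 2 by rewrite -natrX.
  rewrite lerXn2r ?nnegrE ?mulr_ge0 ?enorm_ge0 ?invr_ge0 ?(ltW q0)//.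
  by rewrite ler_pdivlMl// mulrC sep// eq_sym.
rewrite ler_pdivlMr// mulr_suml.
under eq_bigr do rewrite gE.
rewrite -lee_fin -sumEFin.
have mind j : measurable_fun setT (fun v : 'rV[R]_n => (\1_(cube n r) (- z j + 1 *: v) : R)).
  apply: (measurableT_comp _ (measurable_rV_affine (- z j) 1)).
  by apply: measurable_indic; exact: measurable_cube.
have VE j : (V%:E = \int[mu n]_v (\1_(cube n r) (- z j + 1 *: v))%:E)%E.
  have := @ge0_integral_rV_affine R n (- z j) 1 (fun v => (\1_(cube n r) v)%:E) ltr01.
  rewrite integral_cube// expr1n mul1e => ->//.
  by apply/measurable_EFinP; apply: measurable_indic; exact: measurable_cube.
have step : (\sum_(j < N) (gauss 4^-1 (z j) * V)%:E <=
    \int[mu n]_v (\sum_(j < N) (expR 1 * gauss 8^-1 v * \1_(cube n r) (- z j + 1 *: v))%:E))%E.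
  rewrite ge0_integral_sum//; last 2 first.
  - move=> j; apply/measurable_EFinP; apply: measurable_funM => //.
    by apply: measurable_funM => //; exact: measurable_gauss.
  - by move=> j v _; rewrite lee_fin !mulr_ge0 ?expR_ge0// indicE.
  apply: lee_sum => j _; rewrite EFinM (VE j) -ge0_integralZl//=; last 2 first.
  - exact/measurable_EFinP.
  - by rewrite lee_fin gauss_ge0.
  apply: ge0_le_integral => //.
  - by move=> v _; rewrite -EFinM lee_fin mulr_ge0 ?gauss_ge0.
  - by apply/measurable_EFinP; exact: measurable_funM.
  - apply/measurable_EFinP; apply: measurable_funM => //.
    by apply: measurable_funM => //; exact: measurable_gauss.
  move=> v _; rewrite -EFinM lee_fin indicE.
  have [|_] := boolP (_ \in _); last by rewrite !mulr0.
  rewrite inE scale1r !mulr1 => cv.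
  rewrite /gauss -expRD ler_expR.
  have h1 : dotv (- z j + v) (- z j + v) <= 1.
    by apply: le_trans nr; apply: dotv_sq_le => i; exact: ltW.
  pose e := - z j + v.
  have -> : v = z j + e by rewrite /e addrA subrr add0r.
  (* This gives [|z + e|^2 <= 2 |z|^2 + 2 |e|^2]: with [|e| <= 1], halving the Gaussian parameter
     costs at most a factor [expR 1]. *)
  have := dotvv_ge0 (z j - e).
  rewrite -/e in h1; move: e h1 => e h1.
  rewrite !(dotvDl, dotvDr, dotvNl, dotvNr) (dotvC e) => h2.
  lra.
apply: (le_trans step).
rewrite EFinM -ge0_integral_gauss// -ge0_integralZl//=; last 2 first.
- by apply/measurable_EFinP; exact: measurable_gauss.
- by move=> v _; rewrite lee_fin gauss_ge0.
apply: ge0_le_integral => //.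
- by move=> v _; apply: sume_ge0 => j _; rewrite lee_fin !mulr_ge0 ?expR_ge0// indicE.
- apply: emeasurable_sum => j; apply/measurable_EFinP; apply: measurable_funM => //.
  by apply: measurable_funM => //; exact: measurable_gauss.
- apply/measurable_EFinP; apply: measurable_funM => //; exact: measurable_gauss.
move=> v _; rewrite sumEFin lee_fin -mulr_sumr ler_piMr ?mulr_ge0 ?expR_ge0//.
apply: (@sum_disjoint_indic_le1 R _ N (fun j => [set v | cube n r (- z j + 1 *: v)]) v).
move=> i j /= ci cj; apply/eqP; apply: contraT => /sepz.
have -> : z i - z j = (- z j + 1 *: v) - (- z i + 1 *: v).
  by rewrite opprD opprK addrACA subrr addr0 addrC.
move: (- z i + _) (- z j + _) ci cj => a b ca cb.
have ha : dotv a a < 1 by apply: le_lt_trans nr1; apply: dotv_sq_le => k; exact: ltW.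
have hb : dotv b b < 1 by apply: le_lt_trans nr1; apply: dotv_sq_le => k; exact: ltW.
have := dotvv_ge0 (a + b).
rewrite !(dotvDl, dotvDr, dotvNl, dotvNr) (dotvC b a) => h1 h2.
lra.
Qed.

End row_sum.

Section schur.
Context (R : realType).

(** Schur's test: [|c i * c j|] is at most the mean of [c i ^+ 2] and [c j ^+ 2], and by symmetry of
    [G] both halves are controlled by the row sums. *)
Lemma schur_bound N (c : 'I_N -> R) (G : 'I_N -> 'I_N -> R) (S : R) :
  (forall i j, 0 <= G i j) -> (forall i j, G i j = G j i) ->
  (forall i, \sum_(j < N) G i j <= S) ->
  `|\sum_(i < N) \sum_(j < N) c i * c j * G i j| <= S * \sum_(i < N) c i ^+ 2.
Proof.
move=> G0 Gs GS.
have h : \sum_(i < N) \sum_(j < N) c i ^+ 2 * G i j <= S * \sum_(i < N) c i ^+ 2.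
  rewrite mulr_sumr; apply: ler_sum => i _; rewrite -mulr_sumr mulrC.
  by rewrite ler_wpM2r// sqr_ge0.
have h' : \sum_(i < N) \sum_(j < N) c j ^+ 2 * G i j <= S * \sum_(i < N) c i ^+ 2.
  rewrite exchange_big /=; apply: le_trans h; apply: ler_sum => i _.
  by apply: ler_sum => j _; rewrite Gs.
have k : \sum_(i < N) \sum_(j < N) `|c i * c j * G i j| <=
    2^-1 * (\sum_(i < N) \sum_(j < N) c i ^+ 2 * G i j + \sum_(i < N) \sum_(j < N) c j ^+ 2 * G i j).
  rewrite -big_split /= mulr_sumr; apply: ler_sum => i _.
  rewrite -big_split /= mulr_sumr; apply: ler_sum => j _.
  rewrite normrM (ger0_norm (G0 _ _)) -mulrDl mulrA ler_wpM2r// normrM.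
  have := sqr_ge0 (`|c i| - `|c j|).
  rewrite -(real_normK (num_real (c i))) -(real_normK (num_real (c j))).
  nra.
apply: le_trans (ler_norm_sum _ _ _) _.
apply: le_trans.
  by apply: ler_sum => i _; exact: ler_norm_sum.
apply: (le_trans k); lra.
Qed.

End schur.

(** * Gaussian-weighted integrals of exponential sums *)

Section trig_polynomial.
Context (R : realType).
Local Notation mu n := (@lebesgue_rV R n).

Definition cos_sum n N (x : 'I_N -> 'rV[R]_n) (c : 'I_N -> R) (xi : 'rV[R]_n) : R :=
  \sum_(j < N) c j * cos (dotv xi (x j)).

Definition sin_sum n N (x : 'I_N -> 'rV[R]_n) (c : 'I_N -> R) (xi : 'rV[R]_n) : R :=
  \sum_(j < N) c j * sin (dotv xi (x j)).

(** The squared modulus of the exponential sum with terms [c j * e^(i xi.x_j)]. *)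
Definition trig_sq n N (x : 'I_N -> 'rV[R]_n) (c : 'I_N -> R) (xi : 'rV[R]_n) : R :=
  cos_sum x c xi ^+ 2 + sin_sum x c xi ^+ 2.

Lemma trig_sqE n N (x : 'I_N -> 'rV[R]_n) (c : 'I_N -> R) (xi : 'rV[R]_n) :
  trig_sq x c xi = \sum_(i < N) \sum_(j < N) c i * c j * cos (dotv xi (x i - x j)).
Proof.
rewrite /trig_sq /cos_sum /sin_sum !expr2 !big_distrlr /= -big_split /=; apply: eq_bigr => i _.
rewrite -big_split /=; apply: eq_bigr => j _; rewrite dotvBr cosB; ring.
Qed.

Lemma trig_sq_ge0 n N (x : 'I_N -> 'rV[R]_n) c xi : 0 <= trig_sq x c xi.
Proof. by rewrite addr_ge0// sqr_ge0. Qed.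

Lemma measurable_cos_sum n N (x : 'I_N -> 'rV[R]_n) c : measurable_fun setT (cos_sum x c).
Proof.
apply: measurable_sum => i; apply: measurable_funM => //; exact: measurable_cos_dotv.
Qed.

Lemma measurable_sin_sum n N (x : 'I_N -> 'rV[R]_n) c : measurable_fun setT (sin_sum x c).
Proof.
apply: measurable_sum => i; apply: measurable_funM => //; exact: measurable_sin_dotv.
Qed.

Lemma measurable_trig_sq n N (x : 'I_N -> 'rV[R]_n) c : measurable_fun setT (trig_sq x c).
Proof.
by apply: measurable_funD; apply: measurable_funX;
  [exact: measurable_cos_sum|exact: measurable_sin_sum].
Qed.

Lemma cos_sum_le n N (x : 'I_N -> 'rV[R]_n) c xi : `|cos_sum x c xi| <= \sum_(j < N) `|c j|.
Proof.
apply: (le_trans (ler_norm_sum _ _ _)); apply: ler_sum => j _.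
by rewrite normrM ler_piMr// norm_cos_le1.
Qed.

Lemma sin_sum_le n N (x : 'I_N -> 'rV[R]_n) c xi : `|sin_sum x c xi| <= \sum_(j < N) `|c j|.
Proof.
apply: (le_trans (ler_norm_sum _ _ _)); apply: ler_sum => j _.
by rewrite normrM ler_piMr// norm_sin_le1.
Qed.

Lemma trig_sq_le n N (x : 'I_N -> 'rV[R]_n) c xi : `|trig_sq x c xi| <= 2 * (\sum_(j < N) `|c j|) ^+ 2.
Proof.
rewrite ger0_norm ?trig_sq_ge0// /trig_sq -(real_normK (num_real (cos_sum _ _ _))) -(real_normK (num_real (sin_sum _ _ _))).
rewrite mulr2n mulrDl !mul1r lerD// lerXn2r// ?nnegrE//; [| exact: cos_sum_le| |exact: sin_sum_le].
all: by apply: sumr_ge0.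
Qed.

Lemma integrable_trig_sq n N (x : 'I_N -> 'rV[R]_n) c (w : 'rV[R]_n -> R) :
  (mu n).-integrable setT (EFin \o w) ->
  (mu n).-integrable setT (EFin \o (fun xi => w xi * trig_sq x c xi)).
Proof.
move=> iw; apply: integrable_mul_bounded => //; first exact: measurable_trig_sq.
exact: trig_sq_le.
Qed.

Lemma integrable_cos n (w : 'rV[R]_n -> R) (z : 'rV[R]_n) :
  (mu n).-integrable setT (EFin \o w) ->
  (mu n).-integrable setT (EFin \o (fun xi => w xi * cos (dotv xi z))).
Proof.
move=> iw; apply: integrable_mul_bounded => //; first exact: measurable_cos_dotv.
by move=> t; exact: norm_cos_le1.
Qed.

Lemma Rintegral_sum d (T : measurableType d) (nu : {measure set T -> \bar R}) (I : Type)
  (s : seq I) (f : I -> T -> R) :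
  (forall i, nu.-integrable setT (EFin \o f i)) ->
  nu.-integrable setT (EFin \o (fun t => \sum_(i <- s) f i t)) /\
  \int[nu]_t (\sum_(i <- s) f i t) = \sum_(i <- s) \int[nu]_t f i t.
Proof.
move=> fi; elim: s => [|i s [IHi IHe]].
  have -> : (fun t : T => \sum_(i <- [::]) f i t) = cst 0.
    by apply/funext => t; rewrite big_nil.
  split; first exact: integrable0.
  by rewrite big_nil /Rintegral integral0.
have -> : (fun t : T => \sum_(j <- i :: s) f j t) = (fun t => f i t + \sum_(j <- s) f j t).
  by apply/funext => t; rewrite big_cons.
split; last by rewrite RintegralD// IHe big_cons.
exact: (integrableD measurableT (fi i) IHi).
Qed.

Lemma integral_trig_sq n N (x : 'I_N -> 'rV[R]_n) c (w : 'rV[R]_n -> R) :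
  (mu n).-integrable setT (EFin \o w) ->
  \int[mu n]_xi (w xi * trig_sq x c xi) =
  \sum_(i < N) \sum_(j < N) c i * c j * \int[mu n]_xi (w xi * cos (dotv xi (x i - x j))).
Proof.
move=> iw.
have E xi : w xi * trig_sq x c xi =
    \sum_(i < N) \sum_(j < N) c i * c j * (w xi * cos (dotv xi (x i - x j))).
  rewrite trig_sqE mulr_sumr; apply: eq_bigr => i _; rewrite mulr_sumr; apply: eq_bigr => j _.
  by rewrite mulrCA.
under eq_Rintegral do rewrite E.
have ij i j : (mu n).-integrable setT (EFin \o (fun xi => c i * c j * (w xi * cos (dotv xi (x i - x j))))).
  exact: (integrableZl measurableT (c i * c j) (integrable_cos (x i - x j) iw)).
rewrite (Rintegral_sum _ _).2; last by move=> i; exact: (Rintegral_sum _ (ij i)).1.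
apply: eq_bigr => i _; rewrite (Rintegral_sum _ (ij i)).2; apply: eq_bigr => j _.
by rewrite RintegralZl//; exact: integrable_cos.
Qed.

Lemma integral_gauss_trig_sq n N (x : 'I_N -> 'rV[R]_n) c a : 0 < a ->
  \int[mu n]_xi (gauss a xi * trig_sq x c xi) =
  Num.sqrt (pi / a) ^+ n * \sum_(i < N) \sum_(j < N) c i * c j * gauss (4 * a)^-1 (x i - x j).
Proof.
move=> a0; rewrite integral_trig_sq; last exact: integrable_gauss.
rewrite mulr_sumr; apply: eq_bigr => i _; rewrite mulr_sumr; apply: eq_bigr => j _.
by rewrite (gauss_rV_fourier _ a0).1 mulrCA.
Qed.

Lemma gaussN n a (x : 'rV[R]_n) : gauss a (- x) = gauss a x.
Proof. by rewrite /gauss dotvNl dotvNr opprK. Qed.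

Lemma gauss0 n a : gauss a (0 : 'rV[R]_n) = 1.
Proof. by rewrite /gauss dotv0l mulr0 oppr0 expR0. Qed.

Lemma gauss_le n a b (x : 'rV[R]_n) : b <= a -> gauss a x <= gauss b x.
Proof. by move=> ba; rewrite /gauss ler_expR lerN2 ler_wpM2r ?dotvv_ge0. Qed.

(** The integral is a quadratic form in Gaussian values. For [a <= q^2] these decay at least as fast
    as those of [gauss_row_sum], so the row sums are bounded and Schur's test applies. *)
Lemma gauss_trig_sq_ub n : exists2 S : R, 0 < S &
  forall N (x : 'I_N -> 'rV[R]_n) c q a, 0 < q -> well_separated x q -> 0 < a <= q ^+ 2 ->
  \int[mu n]_xi (gauss a xi * trig_sq x c xi) <=
    Num.sqrt (pi / a) ^+ n * (S * \sum_(i < N) c i ^+ 2).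
Proof.
have [S S0 HS] := gauss_row_sum R n; exists S => // N x c q a q0 sep /andP[a0 aq].
rewrite integral_gauss_trig_sq// ler_wpM2l//.
apply: le_trans (ler_norm _) _; apply: schur_bound.
- by move=> i j; exact: gauss_ge0.
- by move=> i j; rewrite -gaussN opprB.
- move=> i; apply: le_trans (HS N x q q0 sep (x i)); apply: ler_sum => j _.
  by apply: gauss_le; rewrite lef_pV2 ?posrE ?mulr_gt0 ?exprn_gt0// ler_pM2l.
Qed.

(** Diagonal dominance: the matrix of Gaussian values has unit diagonal, and once [T * q] is large
    its off-diagonal rows sum to at most [1/2]. *)
Lemma gauss_trig_sq_lb n : exists2 M : R, 1 <= M &
  forall N (x : 'I_N -> 'rV[R]_n) c q T, 0 < q -> well_separated x q -> 0 < T -> M <= T * q ->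
  (Num.sqrt pi * T) ^+ n / 2 * (\sum_(i < N) c i ^+ 2) <=
  \int[mu n]_xi (gauss (T ^- 2) xi * trig_sq x c xi).
Proof.
have [S S0 HS] := gauss_row_sum R n.
exists (1 + 2 * S); first by rewrite lerDl mulr_ge0// ltW.
move=> N x c q T q0 sep T0 MT.
rewrite integral_gauss_trig_sq ?invr_gt0 ?exprn_gt0//.
have -> : Num.sqrt (pi / T ^- 2) = Num.sqrt pi * T.
  by rewrite invrK sqrtrM ?pi_ge0// sqrtr_sqr gtr0_norm.
rewrite -mulrA ler_wpM2l//; first by rewrite exprn_ge0// mulr_ge0// ltW.
pose G i j := if i == j then 0 else gauss (4 * T ^- 2)^-1 (x i - x j).
have GE i j : gauss (4 * T ^- 2)^-1 (x i - x j) = (i == j)%:R + G i j.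
  rewrite /G; case: eqP => [->|_]; first by rewrite subrr gauss0 addr0.
  by rewrite add0r.
have G0 i j : 0 <= G i j by rewrite /G; case: ifP => // _; exact: gauss_ge0.
have GC i j : G i j = G j i.
  by rewrite /G eq_sym; case: ifP => // _; rewrite -gaussN opprB.
have GS i : \sum_(j < N) G i j <= 2^-1.
  (* Off the diagonal, [1 + 2 * S <= T * q] makes the exponent exceed that of [gauss_row_sum] by at
     least [2 S]. The row sum is then at most [S * exp (- 2 S)], which is below [1/2]. *)
  have h j : G i j <= expR (- (2 * S)) * gauss (4 * q ^+ 2)^-1 (x i - x j).
    rewrite /G; case: eqP => [_|/eqP /sep ij].
      by rewrite mulr_ge0 ?expR_ge0.
    rewrite /gauss -expRD ler_expR.
    have d4 : 4 * q ^+ 2 <= dotv (x i - x j) (x i - x j).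
      rewrite -enorm_sqr (_ : 4 * q ^+ 2 = (2 * q) ^+ 2); last by rewrite exprMn -natrX.
      by rewrite lerXn2r ?nnegrE ?enorm_ge0 ?mulr_ge0 ?(ltW q0).
    set D := dotv _ _ in d4 *.
    have -> : (4 * T ^- 2)^-1 * D = (T * q) ^+ 2 * ((4 * q ^+ 2)^-1 * D).
      by field; rewrite !gt_eqF.
    have : 1 <= (4 * q ^+ 2)^-1 * D.
      by rewrite ler_pdivlMl ?mulr1// mulr_gt0// exprn_gt0.
    set e := _ * D => e1.
    have hP : 1 + 2 * S <= (T * q) ^+ 2.
      by rewrite expr2; move: (T * q) MT => t tS; nra.
    move: (_ ^+ 2) hP => P hP.
    have p1 : 0 <= (P - 1 - 2 * S) * e by rewrite mulr_ge0; lra.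
    have p2 : 0 <= S * (e - 1) by rewrite mulr_ge0; lra.
    lra.
  apply: (@le_trans _ _ (expR (- (2 * S)) * S)).
    apply: le_trans (ler_wpM2l (expR_ge0 _) (HS N x q q0 sep (x i))).
    by rewrite mulr_sumr; apply: ler_sum => j _; exact: h.
  rewrite expRN mulrC ler_pdivrMr ?expR_gt0//.
  have := expR_ge1Dx (2 * S); lra.
have := schur_bound c G0 GC GS.
rewrite ler_norml => /andP[h _].
under [leRHS]eq_bigr => i _.
  under eq_bigr => j _ do rewrite GE mulrDr.
  rewrite big_split /= (bigD1 i)//= eqxx mulr1 big1 ?addr0; last first.
    by move=> j ji; rewrite eq_sym (negbTE ji) mulr0.
  over.
rewrite big_split /=.
under [X in _ <= X + _]eq_bigr do rewrite -expr2.
set A := \sum_(i < N) c i ^+ 2 in h *; set B := \sum_(i < N) _ in h *; lra.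
Qed.

End trig_polynomial.

(** * The Bessel weight *)

Section bessel_weight.
Context (R : realType).
Local Notation mu n := (@lebesgue_rV R n).
Implicit Types m s t T : R.

Definition bessel n m (xi : 'rV[R]_n) : R := (1 + dotv xi xi) `^ (- m).

Lemma bessel_gt0 n m (xi : 'rV[R]_n) : 0 < bessel m xi.
Proof. by rewrite powR_gt0// ltr_pwDl// dotvv_ge0. Qed.

Lemma measurable_bessel n m : measurable_fun setT (@bessel n m).
Proof.
have h : measurable_fun setT (fun xi : 'rV[R]_n => 1 + dotv xi xi).
  by apply: measurable_funD => //; exact: measurable_dotvv.
exact: (measurableT_comp (@measurable_powR R (- m)) h).
Qed.

Lemma expr4_bracket (y : R) : 1 <= y -> exists k, 4 ^+ k <= y < 4 ^+ k.+1.
Proof.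
move=> y1.
have ex : exists k, y < 4 ^+ k.
  exists (Num.trunc y).+1; apply: lt_le_trans (truncnS_gt y) _.
  rewrite -natrX ler_nat; apply: ltnW; exact: ltn_expl.
case: (ex_minnP ex) => -[|k] yk kmin; first by move: yk; rewrite expr0 ltNge y1.
exists k; rewrite yk andbT leNgt; apply/negP => /kmin; by rewrite ltnn.
Qed.

Lemma ler_npowR m t u : 0 <= m -> 0 < t -> t <= u -> u `^ (- m) <= t `^ (- m).
Proof.
move=> m0 t0 tu; have u0 := lt_le_trans t0 tu.
rewrite !powRN lef_pV2 ?posrE ?powR_gt0//.
by apply: ge0_ler_powR; rewrite ?nnegrE// ltW.
Qed.

Lemma powR_npow4 m k : 0 <= m -> (4 ^+ k) `^ (- m) = (4 `^ (- m)) ^+ k.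
Proof.
by move=> m0; rewrite -powR_mulrn// -!powRrM mulrC powRrM powR_mulrn ?powR_ge0.
Qed.

(* Splitting [1 + t] dyadically bounds the weight by a geometric sum of
   Gaussians, so that only Gaussian Fourier transforms are ever needed. *)
Lemma bessel_le_dyadic m s n (xi : 'rV[R]_n) : 0 <= m ->
  exists k, (1 + s ^+ 2 * dotv xi xi) `^ (- m) <=
    expR 4 * (4 `^ (- m)) ^+ k * gauss (s ^+ 2 / 4 ^+ k) xi.
Proof.
move=> m0; set t := s ^+ 2 * _.
have t0 : 0 <= t by rewrite mulr_ge0 ?sqr_ge0 ?dotvv_ge0.
have [k /andP[k1 k2]] : exists k, 4 ^+ k <= 1 + t < 4 ^+ k.+1.
  by apply: expr4_bracket; rewrite lerDl.
(* Since [4^k <= 1 + t < 4^(k+1)], the Gaussian exponent [t / 4^k] stays below 4, which [expR 4]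
   compensates. *)
exists k; rewrite mulrAC -[leLHS]mul1r; apply: ler_pM => //.
- exact: powR_ge0.
- rewrite /gauss -expRD -[X in X <= _]expR0 ler_expR subr_ge0 mulrAC -/t ler_pdivrMr ?exprn_gt0//.
  by rewrite -exprS; lra.
- by rewrite -powR_npow4//; apply: ler_npowR; rewrite ?exprn_gt0.
Qed.

Lemma ge0_integral_gauss_trig_sq n N (x : 'I_N -> 'rV[R]_n) c a : 0 < a ->
  (\int[mu n]_xi (gauss a xi * trig_sq x c xi)%:E =
   (\int[mu n]_xi (gauss a xi * trig_sq x c xi))%:E)%E.
Proof.
move=> a0; rewrite /Rintegral fineK//; apply: integrable_fin_num => //.
exact: (integrable_trig_sq x c (integrable_gauss n a0)).
Qed.

Lemma geo_sum_le (r : R) k : 0 <= r < 1 -> \sum_(0 <= i < k) r ^+ i <= (1 - r)^-1.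
Proof.
move=> /andP[r0 r1]; rewrite -[leRHS]mul1r ler_pdivlMr ?subr_gt0// big_mkord.
have := subrX1 r k; have := exprn_ge0 k r0; set A := \sum_(i < k) _; move=> h1 h2.
have -> : A * (1 - r) = - ((r - 1) * A) by ring.
by rewrite -h2; lra.
Qed.

(** By [gauss_trig_sq_ub] the [k]-th dyadic Gaussian contributes a multiple of [(2^k / s)^n] with
    coefficient [4^(- m k)]. The ratio [rho] of the resulting geometric series is below 1 because
    [n / 2 < m]. *)
Lemma integral_bessel_trig_sq n m : n%:R / 2 < m -> exists2 C : R, 0 < C &
  forall N (x : 'I_N -> 'rV[R]_n) c q s, 0 < s <= q -> well_separated x q ->
  (\int[mu n]_xi ((1 + s ^+ 2 * dotv xi xi) `^ (- m) * trig_sq x c xi)%:E <=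
   (C * s ^- n * \sum_(i < N) c i ^+ 2)%:E)%E.
Proof.
move=> nm; have m0 : 0 <= m by rewrite (le_trans _ (ltW nm))// divr_ge0.
have [S S0 HS] := gauss_trig_sq_ub R n.
pose rho := 2 ^+ n * 4 `^ (- m).
have rho0 : 0 < rho by rewrite mulr_gt0 ?exprn_gt0 ?powR_gt0.
have rho1 : rho < 1.
  rewrite /rho powRN ltr_pdivrMr ?powR_gt0// mul1r.
  have -> : (4 : R) = 2 `^ 2%:R by rewrite powR_mulrn// -natrX.
  rewrite -powRrM -powR_mulrn// /powR gt_eqF// ltr_expR ltr_pM2r ?ln_gt0 ?ltr1n//.
  by lra.
pose A := expR 4 * Num.sqrt pi ^+ n * S.
have A0 : 0 < A by rewrite !mulr_gt0 ?expR_gt0 ?exprn_gt0 ?sqrtr_gt0 ?pi_gt0.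
exists (A / (1 - rho)); first by rewrite divr_gt0// subr_gt0.
move=> N x c q s /andP[s0 sq] sep; have q0 := lt_le_trans s0 sq.
set c2 := \sum_(i < N) _; have c20 : 0 <= c2 by apply: sumr_ge0 => i _; exact: sqr_ge0.
pose F k xi := (expR 4 * (4 `^ (- m)) ^+ k) * (gauss (s ^+ 2 / 4 ^+ k) xi * trig_sq x c xi).
have F0 k xi : 0 <= F k xi.
  by rewrite /F !mulr_ge0 ?expR_ge0 ?exprn_ge0 ?powR_ge0 ?trig_sq_ge0.
have mF k : measurable_fun setT (fun xi => (F k xi)%:E).
  apply/measurable_EFinP; apply: measurable_funM => //; apply: measurable_funM.
    exact: measurable_gauss.
  exact: measurable_trig_sq.
have step1 : (\int[mu n]_xi ((1 + s ^+ 2 * dotv xi xi) `^ (- m) * trig_sq x c xi)%:E <=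
    \int[mu n]_xi \sum_(0 <= k <oo) (F k xi)%:E)%E.
  apply: ge0_le_integral => //.
  - by move=> xi _; rewrite lee_fin mulr_ge0 ?powR_ge0 ?trig_sq_ge0.
  - apply/measurable_EFinP; apply: measurable_funM; last exact: measurable_trig_sq.
    have h : measurable_fun setT (fun xi : 'rV[R]_n => 1 + s ^+ 2 * dotv xi xi).
      by apply: measurable_funD => //; apply: measurable_funM => //; exact: measurable_dotvv.
    exact: (measurableT_comp (@measurable_powR R (- m)) h).
  - apply: ge0_emeasurable_sum => //; by move=> k xi _ _; rewrite lee_fin.
  move=> xi _; have [k hk] := bessel_le_dyadic s xi m0.
  apply: (@le_trans _ _ (F k xi)%:E).
    by rewrite lee_fin /F mulrA ler_wpM2r ?trig_sq_ge0.
  apply: le_trans (nneseries_lim_ge k.+1 _); last by move=> j _ _; rewrite lee_fin.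
  rewrite big_nat_recr//= leeDr//; apply: sume_ge0 => j _; by rewrite lee_fin.
apply: (le_trans step1); rewrite integral_nneseries//; last first.
  by move=> k xi _; rewrite lee_fin.
have step2 k : (\int[mu n]_xi (F k xi)%:E <= (A * s ^- n * c2 * rho ^+ k)%:E)%E.
  rewrite /F; under eq_integral do rewrite EFinM.
  have ak : 0 < s ^+ 2 / 4 ^+ k by rewrite divr_gt0 ?exprn_gt0.
  have ak' : 0 < s ^+ 2 / 4 ^+ k <= q ^+ 2.
    rewrite ak/= ler_pdivrMr ?exprn_gt0//; apply: (@le_trans _ _ (q ^+ 2)).
      by rewrite lerXn2r ?nnegrE// ltW.
    by rewrite ler_peMr ?sqr_ge0// exprn_ege1// ler1n.
  rewrite ge0_integralZl//=; last 2 first.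
  - apply/measurable_EFinP; apply: measurable_funM; [exact: measurable_gauss|exact: measurable_trig_sq].
  - by move=> xi _; rewrite lee_fin mulr_ge0 ?gauss_ge0 ?trig_sq_ge0.
  rewrite ge0_integral_gauss_trig_sq// -EFinM lee_fin.
  have := HS N x c q _ q0 sep ak'; rewrite -/c2 => h.
  apply: le_trans (ler_wpM2l _ h) _.
    by rewrite mulr_ge0 ?expR_ge0 ?exprn_ge0 ?powR_ge0.
  rewrite le_eqVlt; apply/orP; left; apply/eqP.
  have -> : Num.sqrt (pi / (s ^+ 2 / 4 ^+ k)) = Num.sqrt pi * (2 ^+ k / s).
    rewrite -[RHS]ger0_norm; last by rewrite mulr_ge0 ?divr_ge0 ?exprn_ge0// ltW.
    have e4 : (2 ^+ k / s) ^+ 2 = 4 ^+ k / s ^+ 2.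
      by rewrite expr_div_n -exprM mulnC exprM; congr (_ ^+ _ / _); rewrite expr2 -natrM.
    by rewrite -sqrtr_sqr exprMn sqr_sqrtr ?pi_ge0// e4 invf_div.
  rewrite /A /rho !exprMn -!exprM (mulnC k n) exprVn; ring.
apply: lime_le.
  by apply: is_cvg_nneseries => k _ _; apply: integral_ge0 => xi _; rewrite lee_fin.
apply: nearW => k.
apply: (@le_trans _ _ (\sum_(0 <= i < k) (A * s ^- n * c2 * rho ^+ i)%:E)%E).
  by apply: lee_sum => i _; exact: step2.
rewrite sumEFin lee_fin -mulr_sumr.
rewrite (_ : A / (1 - rho) * s ^- n * c2 = A * s ^- n * c2 * (1 - rho)^-1); last ring.
rewrite ler_wpM2l//; last by apply: geo_sum_le; rewrite (ltW rho0).
by rewrite mulr_ge0// divr_ge0 ?exprn_ge0 ?(ltW A0) ?(ltW s0).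
Qed.

(** Specialises the preceding bound to a single node at the origin with coefficient 1, for which
    [trig_sq] is identically 1. *)
Lemma integrable_bessel n m : n%:R / 2 < m -> (mu n).-integrable setT (EFin \o @bessel n m).
Proof.
move=> nm; have [C C0 HC] := integral_bessel_trig_sq nm.
apply/integrableP; split; first by apply/measurable_EFinP; exact: measurable_bessel.
have sep : well_separated (fun _ : 'I_1 => (0 : 'rV[R]_n)) 1.
  by move=> i j; rewrite (ord1 i) (ord1 j) eqxx.
have := HC 1%N (fun=> 0) (fun=> 1) 1 1.
rewrite lexx ltr01 => /(_ isT sep).
have E xi : trig_sq (fun _ : 'I_1 => (0 : 'rV[R]_n)) (fun=> 1) xi = 1.
  by rewrite /trig_sq /cos_sum /sin_sum !big_ord1 dotvC dotv0l cos0 sin0 mulr1 mulr0 expr1n expr0n addr0.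
under eq_integral do rewrite E expr1n mul1r mulr1.
move=> h; apply: (@le_lt_trans _ _ (C * 1 ^- n * \sum_(i < 1) 1 ^+ 2)%:E); last exact: ltry.
apply: le_trans h; apply: ge0_le_integral => //.
- by apply/measurable_EFinP; apply: measurableT_comp => //; exact: measurable_bessel.
- by apply/measurable_EFinP; exact: measurable_bessel.
- by move=> xi _; rewrite /= ger0_norm ?powR_ge0.
Qed.

(** From [1 + t <= k * exp (t / k)] follows [(1 + t)^k <= k^k * exp t], so a power dominates a
    Gaussian. The factor [T^(- 2 m)] comes from [1 + |xi|^2 <= T^2 * (1 + t)], where [T >= 1]
    enters. The integer [k] only rounds up the real exponent [m]. *)
Lemma bessel_ge_gauss n m T (xi : 'rV[R]_n) k : 0 <= m -> m <= k%:R -> (0 < k)%N -> 1 <= T ->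
  (k%:R `^ (- k%:R)) * T `^ (- (2 * m)) * gauss (T ^- 2) xi <= bessel m xi.
Proof.
move=> m0 mk k0 T1; have T0 : 0 < T by apply: lt_le_trans T1.
rewrite /bessel /gauss expRN.
set t := T ^- 2 * _; have t0 : 0 <= t.
  by rewrite mulr_ge0 ?dotvv_ge0// invr_ge0 exprn_ge0// ltW.
have h1 : 1 + dotv xi xi <= T ^+ 2 * (1 + t).
  have T2 : 1 <= T ^+ 2 by rewrite expr_ge1// ltW.
  rewrite mulrDr mulr1 /t mulrA divff ?mul1r ?lerD2r// gt_eqF// exprn_gt0//.
have h2 : (T ^+ 2 * (1 + t)) `^ (- m) <= bessel m xi.
  by apply: ler_npowR => //; rewrite ltr_pwDl// dotvv_ge0.
apply: le_trans h2.
rewrite powRM ?exprn_ge0 ?(ltW T0)//; last by rewrite addr_ge0.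
have -> : (T ^+ 2) `^ (- m) = T `^ (- (2 * m)).
  by rewrite -powR_mulrn ?(ltW T0)// -powRrM mulrN.
rewrite mulrAC mulrC ler_wpM2l ?powR_ge0//.
rewrite !powRN -invfM lef_pV2 ?posrE ?mulr_gt0 ?powR_gt0 ?expR_gt0 ?ltr0n//; last lra.
apply: (@le_trans _ _ ((1 + t) `^ k%:R)); first by rewrite ler_powR// lerDl.
rewrite !powR_mulrn//; last by rewrite addr_ge0.
have kr : 0 < k%:R :> R by rewrite ltr0n.
have : 1 + t <= k%:R * expR (t / k%:R).
  have := expR_ge1Dx (t / k%:R) => h.
  apply: le_trans (ler_wpM2l (ltW kr) h).
  by rewrite mulrDr mulr1 (mulrC k%:R) divfK ?gt_eqF// lerD2r ler1n.
move=> h; apply: (@le_trans _ _ ((k%:R * expR (t / k%:R)) ^+ k)).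
  apply: lerXn2r => //; rewrite nnegrE; first exact: addr_ge0.
  by rewrite mulr_ge0 ?expR_ge0.
by rewrite exprMn -expRM_natl [k%:R * (t / _)]mulrC divfK ?gt_eqF.
Qed.

(** Here [th] stands for [|1 - e^(i s xi.y)|^2], the squared symbol of one difference. For
    [s |xi| >= 1] the bound [th <= 4] suffices; for [s |xi| < 1] the factor [th^k] is at most a
    multiple of [(s |xi|)^(2 m)] because [m <= k], which cancels the weight and leaves [s^(2 m)]. *)
Lemma bessel_mul_le n m s k (xi : 'rV[R]_n) th : (0 < k)%N -> 0 <= m -> m <= k%:R -> 0 < s ->
  0 <= th -> th <= 4 -> th <= 4 * (s ^+ 2 * dotv xi xi) ->
  bessel m xi * th ^+ k <= 4 ^+ k * 2 `^ m * s `^ (2 * m) * (1 + s ^+ 2 * dotv xi xi) `^ (- m).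
Proof.
move=> k0 m0 mk s0 th0 th4 ths.
set D := dotv xi xi in ths *; have D0 : 0 <= D by exact: dotvv_ge0.
set t := s ^+ 2 * D in ths *; have t0 : 0 <= t by rewrite mulr_ge0 ?sqr_ge0.
have sE : s `^ (2 * m) = (s ^+ 2) `^ m by rewrite -powR_mulrn ?(ltW s0)// -powRrM.
have s20 : 0 < s ^+ 2 by rewrite exprn_gt0.
have [t1|t1] := leP 1 t.
  have h : bessel m xi <= 2 `^ m * s `^ (2 * m) * (1 + t) `^ (- m).
    have e : 2 `^ m * s `^ (2 * m) = (2 * s ^+ 2)^-1 `^ (- m).
      have s2 : 0 <= 2 * s ^+ 2 by rewrite ltW// mulr_gt0.
      rewrite sE -powRM ?(ltW s20)// -[in RHS]powR_inv1//.
      by rewrite -powRrM mulN1r opprK.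
    rewrite e -powRM; last 2 first.
    - by rewrite invr_ge0 ltW// mulr_gt0.
    - by rewrite addr_ge0.
    apply: ler_npowR => //; first by rewrite mulr_gt0 ?invr_gt0 ?mulr_gt0// ltr_pwDl.
    rewrite -/D ler_pdivrMl ?mulr_gt0//.
    have : 2 * s ^+ 2 * (1 + D) = 2 * s ^+ 2 + 2 * t by rewrite /t; ring.
    lra.
  rewrite mulrC -!mulrA; apply: ler_pM; rewrite ?exprn_ge0 ?(ltW (bessel_gt0 _ _))//.
    by rewrite lerXn2r ?nnegrE.
  by rewrite mulrA.
have h1 : 1 <= 2 `^ m * (1 + t) `^ (- m).
  rewrite powRN -ler_pdivrMl ?powR_gt0// mulr1 lef_pV2 ?posrE ?powR_gt0//; last lra.
  by apply: ge0_ler_powR; rewrite ?nnegrE//; lra.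
have h2 : bessel m xi * th ^+ k <= 4 ^+ k * s `^ (2 * m).
  (* At the zero frequency the power [D^(- m)] is not infinite in [powR] and cannot serve as an
     upper bound; there [th] vanishes, and [k > 0] makes the left side 0. *)
  have [D1|D1] := eqVneq D 0.
    have th_0 : th = 0 by apply/eqP; rewrite eq_le th0 andbT; move: ths; rewrite /t D1; lra.
    by rewrite th_0 expr0n gtn_eqF// mulr0 mulr_ge0 ?exprn_ge0 ?powR_ge0.
  have Dp : 0 < D by rewrite lt_neqAle eq_sym D1.
  have tp : 0 < t by rewrite mulr_gt0.
  have b : bessel m xi <= D `^ (- m) by apply: ler_npowR => //; rewrite -/D; lra.
  have a : th ^+ k <= 4 ^+ k * t `^ m.
    apply: (@le_trans _ _ ((4 * t) ^+ k)).
      by rewrite lerXn2r ?nnegrE// mulr_ge0.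
    rewrite exprMn ler_wpM2l ?exprn_ge0// -powR_mulrn//.
    by apply: ger_powR => //; rewrite tp ltW.
  apply: (@le_trans _ _ (D `^ (- m) * (4 ^+ k * t `^ m))).
    by apply: ler_pM; rewrite ?exprn_ge0 ?(ltW (bessel_gt0 _ _)).
  rewrite /t powRM ?(ltW s20)// -sE mulrCA ler_wpM2l ?exprn_ge0// mulrCA powRN.
  by rewrite mulVf ?mulr1// gt_eqF// powR_gt0.
apply: (le_trans h2).
have s2m : 0 <= 4 ^+ k * s `^ (2 * m) by rewrite mulr_ge0 ?exprn_ge0 ?powR_ge0.
have := ler_wpM2l s2m h1; set v := (1 + t) `^ _; lra.
Qed.

End bessel_weight.

(** * Native norm and finite differences *)

Section elementary.
Context (R : realType).

Lemma norm_sin_le (x : R) : `|sin x| <= `|x|.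
Proof.
wlog x0 : x / 0 < x => [h|].
  have [/h//|] := ltP 0 x.
  rewrite le_eqVlt => /orP[/eqP->|x0]; first by rewrite sin0.
  by rewrite -normrN -sinN -(normrN x) h// oppr_gt0.
have [c _] := @MVT R sin cos 0 x x0 (fun x _ => is_derive_sin x)
   (continuous_subspaceT (@continuous_sin R)).
rewrite sin0 !subr0 => ->; rewrite normrM ler_piMl//.
exact: norm_cos_le1.
Qed.

Lemma twoB_cos_ge0 (x : R) : 0 <= 2 - 2 * cos x.
Proof. have := cos_le1 x; lra. Qed.

Lemma twoB_cos_le4 (x : R) : 2 - 2 * cos x <= 4.
Proof. have := cos_geN1 x; lra. Qed.

(** The left side is [4 * sin (x / 2) ^ 2], so this is [|sin x| <= |x|] at [x / 2]. *)
Lemma twoB_cos_le (x : R) : 2 - 2 * cos x <= x ^+ 2.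
Proof.
have -> : cos x = cos (x / 2 + x / 2) by congr cos; lra.
rewrite cosD -!expr2; have := cos2Dsin2 (x / 2) => h.
have : sin (x / 2) ^+ 2 <= (x / 2) ^+ 2.
  rewrite -(real_normK (num_real (sin _))) -(real_normK (num_real (x / 2))).
  by rewrite lerXn2r ?nnegrE// norm_sin_le.
rewrite expr_div_n -natrX; set u := sin _ ^+ 2 in h *; set v := cos _ ^+ 2 in h *.
lra.
Qed.

Lemma dotv_CS n (x y : 'rV[R]_n) : dotv x y ^+ 2 <= dotv x x * dotv y y.
Proof.
have [y0|y0] := eqVneq (dotv y y) 0.
  have : y = 0.
    apply/rowP => i; rewrite mxE; apply/eqP; rewrite -sqrf_eq0 expr2.
    move/eqP : y0; rewrite psumr_eq0; last by move=> j _; rewrite -expr2 sqr_ge0.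
    by move/allP => /(_ i (mem_index_enum _)) /eqP ->.
  by move=> ->; rewrite dotvC !dotv0l expr0n mulr0.
have yp : 0 < dotv y y by rewrite lt_neqAle eq_sym y0 dotvv_ge0.
have := dotvv_ge0 (dotv y y *: x - dotv x y *: y).
rewrite !(dotvDl, dotvDr, dotvZl, dotvZr, dotvNl, dotvNr) (dotvC y x).
set a := dotv x x; set b := dotv x y; set c := dotv y y in yp *.
have -> : c * (c * a - b * b) + (c * - (b * b) - b * - (b * c)) =
   c * (a * c - b ^+ 2) by ring.
by rewrite pmulr_rge0// subr_ge0.
Qed.

End elementary.

Section kernel_space.
Context (R : realType).
Local Notation mu n := (@lebesgue_rV R n).

(** The [k]-th power of the identity minus the shift by [y]: up to sign the usual forward
    difference, normalised so that [f x] has coefficient 1. *)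
Fixpoint diffop n (k : nat) (y : 'rV[R]_n) (f : 'rV[R]_n -> R) (x : 'rV[R]_n) : R :=
  if k is k'.+1 then diffop k' y f x - diffop k' y f (x + y) else f x.

(** Because of that normalisation, the value at [x] cancels in [f x - diffop k y f x] and only the
    shifts by [y, ..., k y] remain. This is how a sample is traded for values further inside the
    cone. *)
Lemma diffop_bound n k y (f : 'rV[R]_n -> R) x :
  `|f x - diffop k y f x| <= 2 ^+ k * \sum_(1 <= l < k.+1) `|f (x + y *+ l)|.
Proof.
have h k' : forall x, `|diffop k' y f x| <= 2 ^+ k' * \sum_(0 <= l < k'.+1) `|f (x + y *+ l)|.
  elim: k' => [|k' IH] {}x /=; first by rewrite expr0 mul1r big_nat1 mulr0n addr0.
  apply: (le_trans (ler_normB _ _)).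
  have h1 := IH x; have h2 := IH (x + y).
  have e : \sum_(0 <= l < k'.+1) `|f (x + y + y *+ l)| = \sum_(1 <= l < k'.+2) `|f (x + y *+ l)|.
    rewrite big_add1 /=; apply: eq_bigr => l _; by rewrite -addrA -mulrS.
  rewrite e in h2.
  have s1 : \sum_(0 <= l < k'.+1) `|f (x + y *+ l)| <= \sum_(0 <= l < k'.+2) `|f (x + y *+ l)|.
    by rewrite [leRHS]big_nat_recr//= lerDl.
  have s2 : \sum_(1 <= l < k'.+2) `|f (x + y *+ l)| <= \sum_(0 <= l < k'.+2) `|f (x + y *+ l)|.
    by rewrite [leRHS]big_nat_recl//= big_add1 /= lerDr.
  have p : 0 <= 2 ^+ k' :> R by rewrite exprn_ge0.
  have := ler_wpM2l p s1; have := ler_wpM2l p s2; rewrite exprS.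
  lra.
elim: k => [|k IH] /=; first by rewrite subrr normr0 mulr_ge0// sumr_ge0.
have -> : f x - (diffop k y f x - diffop k y f (x + y)) =
  (f x - diffop k y f x) + diffop k y f (x + y) by ring.
apply: (le_trans (ler_normD _ _)).
have h2 := h k (x + y).
have e : \sum_(0 <= l < k.+1) `|f (x + y + y *+ l)| = \sum_(1 <= l < k.+2) `|f (x + y *+ l)|.
  rewrite [RHS]big_add1 /=; apply: eq_bigr => l _; by rewrite -addrA -mulrS.
rewrite e in h2.
have s1 : \sum_(1 <= l < k.+1) `|f (x + y *+ l)| <= \sum_(1 <= l < k.+2) `|f (x + y *+ l)|.
  by rewrite [leRHS]big_nat_recr//= lerDl.
have p : 0 <= 2 ^+ k :> R by rewrite exprn_ge0.
have := ler_wpM2l p s1; rewrite exprS.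
lra.
Qed.

Context (n : nat) (w : 'rV[R]_n -> R) (m c1 c2 : R).
Context (nm : n%:R / 2 < m) (mw : measurable_fun setT w) (c10 : 0 < c1) (c20 : 0 < c2).
Context (wb : forall xi, c1 * bessel m xi <= w xi <= c2 * bessel m xi).

Let m0 : 0 <= m. Proof. by rewrite (le_trans _ (ltW nm))// divr_ge0. Qed.

Let w0 xi : 0 <= w xi.
Proof.
have /andP[h _] := wb xi; apply: le_trans h.
by rewrite mulr_ge0 ?(ltW c10)// ltW// bessel_gt0.
Qed.

Let wi : (mu n).-integrable setT (EFin \o w).
Proof.
apply: (@le_integrable _ _ _ (mu n) setT measurableT _ (EFin \o (fun xi => c2 * bessel m xi))).
- exact/measurable_EFinP.
- move=> xi _; rewrite /= lee_fin !ger0_norm//.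
    by have /andP[] := wb xi.
  by rewrite mulr_ge0 ?(ltW c20)// ltW// bessel_gt0.
- exact: (integrableZl measurableT c2 (integrable_bessel nm)).
Qed.

(** Defined at every point, without the normalising power of [2 * pi], which is restored in
    [fourier_profile_ae]. *)
Definition kern (z : 'rV[R]_n) : R := \int[mu n]_xi (w xi * cos (dotv xi z)).

Definition kcomb N (x : 'I_N -> 'rV[R]_n) (a : 'I_N -> R) (y : 'rV[R]_n) : R :=
  \sum_(j < N) a j * kern (y - x j).

Lemma native_normE N (x : 'I_N -> 'rV[R]_n) a :
  \int[mu n]_xi (w xi * trig_sq x a xi) = \sum_(i < N) a i * kcomb x a (x i).
Proof.
rewrite integral_trig_sq//; apply: eq_bigr => i _; rewrite /kcomb mulr_sumr.
by apply: eq_bigr => j _; rewrite mulrA.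
Qed.

Lemma native_norm_ge0 N (x : 'I_N -> 'rV[R]_n) a : 0 <= \int[mu n]_xi (w xi * trig_sq x a xi).
Proof. by apply: Rintegral_ge0 => xi _; rewrite mulr_ge0// trig_sq_ge0. Qed.

(** The native norm [NN] is at least [L] times the sum of the [a i ^+ 2], by the Gaussian minorant
    of the weight, and also equals the pairing of [a] with the samples. AM-GM on the pairing with
    weight [L] gives [NN <= NN / 2 + V / (2 L)], that is [NN <= V / L]. *)
Lemma native_norm_le (qm : R) : 0 < qm -> exists2 C : R, 0 < C &
  forall N (x : 'I_N -> 'rV[R]_n) (a : 'I_N -> R) (q : R), 0 < q <= qm -> well_separated x q ->
  \int[mu n]_xi (w xi * trig_sq x a xi) <=
    C * q `^ (n%:R - 2 * m) * \sum_(i < N) kcomb x a (x i) ^+ 2.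
Proof.
move=> qm0; have [M M1 HM] := gauss_trig_sq_lb R n.
have [k mk k0] : exists2 k : nat, m <= k%:R & (0 < k)%N.
  by exists (Num.trunc m).+1 => //; exact: ltW (truncnS_gt _).
pose M' := Num.max M qm.
have M'0 : 0 < M' by rewrite lt_max qm0 orbT.
pose B := c1 * k%:R `^ (- k%:R) * (Num.sqrt pi ^+ n / 2).
have B0 : 0 < B.
  by rewrite !mulr_gt0 ?powR_gt0 ?ltr0n ?invr_gt0 ?exprn_gt0 ?sqrtr_gt0 ?pi_gt0.
exists (B^-1 * M' `^ (2 * m - n%:R)).
  by rewrite mulr_gt0 ?invr_gt0 ?powR_gt0.
move=> N x a q /andP[q0 qqm] sep.
(* The scale must satisfy [M <= T * q] for diagonal dominance and [1 <= T] for the minorant;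
   [M' = max M qm] gives both, the latter since [q <= qm]. *)
pose T := M' / q; have T0 : 0 < T by rewrite divr_gt0.
have T1 : 1 <= T by rewrite ler_pdivlMr// mul1r le_max qqm orbT.
have MT : M <= T * q by rewrite divfK ?gt_eqF// le_max lexx.
have lb := HM N x a q T q0 sep T0 MT.
have P0 := native_norm_ge0 x a.
pose L := B * T `^ (n%:R - 2 * m).
have L0 : 0 < L by rewrite mulr_gt0// powR_gt0.
set NN := \int[_]_xi _ in P0 *.
have h1 : L * \sum_(i < N) a i ^+ 2 <= NN.
  apply: (@le_trans _ _ (c1 * k%:R `^ (- k%:R) * T `^ (- (2 * m)) *
      \int[mu n]_xi (gauss (T ^- 2) xi * trig_sq x a xi))).
    have p : 0 <= c1 * k%:R `^ (- k%:R) * T `^ (- (2 * m)).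
      by rewrite !mulr_ge0 ?powR_ge0// ltW.
    apply: le_trans (ler_wpM2l p lb); rewrite /L /B.
    rewrite exprMn -(powR_mulrn n (ltW T0)) powRD; last by rewrite (gt_eqF T0) implybT.
    by rewrite le_eqVlt; apply/orP; left; apply/eqP; ring.
  have T2 : 0 < T ^- 2 by rewrite invr_gt0 exprn_gt0.
  have gi := integrable_trig_sq x a (integrable_gauss n T2).
  rewrite -RintegralZl//.
  apply: le_Rintegral => //.
  - exact: (integrableZl measurableT (c1 * k%:R `^ (- k%:R) * T `^ (- (2 * m))) gi).
  - exact: integrable_trig_sq.
  move=> xi _; rewrite mulrA ler_wpM2r ?trig_sq_ge0//.
  have /andP[h _] := wb xi; apply: le_trans h.
  rewrite -!mulrA ler_wpM2l ?(ltW c10)// mulrA.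
  exact: bessel_ge_gauss.
have NE := native_normE x a; rewrite -/NN in NE.
set V := \sum_(i < N) _ ^+ 2.
have h2 : NN <= L / 2 * (\sum_(i < N) a i ^+ 2) + (2 * L)^-1 * V.
  rewrite NE /V !mulr_sumr -big_split /=; apply: ler_sum => i _.
  set u := kcomb _ _ _; set b := a i.
  have := sqr_ge0 (L * b - u) => h.
  rewrite -subr_ge0 -(pmulr_rge0 _ (_ : 0 < 2 * L)); last by rewrite mulr_gt0.
  have -> : 2 * L * (L / 2 * b ^+ 2 + (2 * L)^-1 * u ^+ 2 - b * u) = (L * b - u) ^+ 2.
    by field; rewrite gt_eqF.
  by [].
have h3 : NN <= L^-1 * V by rewrite invfM in h2; lra.
apply: (le_trans h3); rewrite ler_wpM2r ?sumr_ge0//; first by move=> i _; exact: sqr_ge0.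
rewrite /L invfM -mulrA ler_wpM2l ?invr_ge0 ?(ltW B0)// -powRN opprB /T powRM ?invr_ge0 ?(ltW M'0) ?(ltW q0)//.
rewrite ler_wpM2l ?powR_ge0// -powR_inv1 ?(ltW q0)// -powRrM mulN1r opprB//.
Qed.

(** The real part of the integral of [w (A - i B) e^(i xi.x)]; this class of functions is stable
    under differences. *)
Definition cos_sin_transform (A B : 'rV[R]_n -> R) (x : 'rV[R]_n) : R :=
  \int[mu n]_xi (w xi * (A xi * cos (dotv xi x) + B xi * sin (dotv xi x))).

Definition bounded_measurable (A : 'rV[R]_n -> R) :=
  measurable_fun setT A /\ exists M, forall xi, `|A xi| <= M.

Lemma bounded_measurableD A B : bounded_measurable A -> bounded_measurable B -> bounded_measurable (fun xi => A xi + B xi).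
Proof.
move=> [mA [M hM]] [mB [M' hM']]; split; first exact: measurable_funD.
by exists (M + M') => xi; rewrite (le_trans (ler_normD _ _))// lerD.
Qed.

Lemma bounded_measurableM A B : bounded_measurable A -> bounded_measurable B -> bounded_measurable (fun xi => A xi * B xi).
Proof.
move=> [mA [M hM]] [mB [M' hM']]; split; first exact: measurable_funM.
by exists (M * M') => xi; rewrite normrM ler_pM.
Qed.

Lemma bounded_measurableN A : bounded_measurable A -> bounded_measurable (fun xi => - A xi).
Proof.
move=> [mA [M hM]]; split; first exact: measurable_funN.
by exists M => xi; rewrite normrN.
Qed.

Lemma bounded_measurable_cos y : bounded_measurable (fun xi => cos (dotv xi y)).
Proof. by split; [exact: measurable_cos_dotv|exists 1 => xi; exact: norm_cos_le1]. Qed.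

Lemma bounded_measurable_sin y : bounded_measurable (fun xi => sin (dotv xi y)).
Proof. by split; [exact: measurable_sin_dotv|exists 1 => xi; exact: norm_sin_le1]. Qed.

Lemma bounded_measurable_cst (r : R) : bounded_measurable (fun=> r).
Proof. by split; [exact: measurable_cst|exists `|r|]. Qed.

Lemma bounded_measurable_cos_sum N (x : 'I_N -> 'rV[R]_n) a : bounded_measurable (cos_sum x a).
Proof. by split; [exact: measurable_cos_sum|exists (\sum_(j < N) `|a j|); exact: cos_sum_le]. Qed.

Lemma bounded_measurable_sin_sum N (x : 'I_N -> 'rV[R]_n) a : bounded_measurable (sin_sum x a).
Proof. by split; [exact: measurable_sin_sum|exists (\sum_(j < N) `|a j|); exact: sin_sum_le]. Qed.

Lemma integrable_bounded_measurable A : bounded_measurable A ->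
  (mu n).-integrable setT (EFin \o (fun xi => w xi * A xi)).
Proof. by move=> [mA [M hM]]; exact: integrable_mul_bounded hM. Qed.

Lemma cos_sin_transform_diff A B x y : bounded_measurable A -> bounded_measurable B ->
  cos_sin_transform A B x - cos_sin_transform A B (x + y) =
  cos_sin_transform (fun xi => A xi + - (A xi * cos (dotv xi y) + B xi * sin (dotv xi y)))
       (fun xi => B xi + - (B xi * cos (dotv xi y) + - (A xi * sin (dotv xi y)))) x.
Proof.
move=> bA bB; rewrite /cos_sin_transform -RintegralB//; last 2 first.
- apply: integrable_bounded_measurable; apply: bounded_measurableD; apply: bounded_measurableM => //;
    [exact: bounded_measurable_cos|exact: bounded_measurable_sin].
- apply: integrable_bounded_measurable; apply: bounded_measurableD; apply: bounded_measurableM => //;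
    [exact: bounded_measurable_cos|exact: bounded_measurable_sin].
apply: eq_Rintegral => xi _; rewrite dotvDr cosD sinD; ring.
Qed.

Lemma kcomb_cos_sin_transform N (x : 'I_N -> 'rV[R]_n) a y : kcomb x a y = cos_sin_transform (cos_sum x a) (sin_sum x a) y.
Proof.
rewrite /kcomb /cos_sin_transform.
have ij j : (mu n).-integrable setT (EFin \o (fun xi => a j * (w xi * cos (dotv xi (y - x j))))).
  exact: (integrableZl measurableT (a j) (integrable_cos (y - x j) wi)).
transitivity (\int[mu n]_xi (\sum_(j < N) a j * (w xi * cos (dotv xi (y - x j))))).
  rewrite (Rintegral_sum _ ij).2; apply: eq_bigr => j _.
  by rewrite RintegralZl//; exact: integrable_cos.
apply: eq_Rintegral => xi _; rewrite /cos_sum /sin_sum !mulr_suml -big_split /= mulr_sumr.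
by apply: eq_bigr => j _; rewrite dotvBr cosB; ring.
Qed.

(** Each difference multiplies the amplitude [A - i B] by [1 - e^(i xi.y)], whose squared modulus is
    [2 - 2 cos (xi.y)]. Only the modulus of the new amplitude matters later, so [A'] and [B'] stay
    existential. *)
Lemma diffop_cos_sin_transform k y A B : bounded_measurable A -> bounded_measurable B ->
  exists A' B', [/\ bounded_measurable A', bounded_measurable B',
    forall x, diffop k y (cos_sin_transform A B) x = cos_sin_transform A' B' x &
    forall xi, A' xi ^+ 2 + B' xi ^+ 2 = (A xi ^+ 2 + B xi ^+ 2) * (2 - 2 * cos (dotv xi y)) ^+ k].
Proof.
move=> bA bB; elim: k => [|k [A' [B' [bA' bB' dE E]]]].
  by exists A, B; split=> // xi; rewrite expr0 mulr1.
have bc := bounded_measurable_cos y; have bs := bounded_measurable_sin y.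
exists (fun xi => A' xi + - (A' xi * cos (dotv xi y) + B' xi * sin (dotv xi y))).
exists (fun xi => B' xi + - (B' xi * cos (dotv xi y) + - (A' xi * sin (dotv xi y)))).
split.
- by apply: bounded_measurableD => //; apply: bounded_measurableN; apply: bounded_measurableD; exact: bounded_measurableM.
- apply: bounded_measurableD => //; apply: bounded_measurableN; apply: bounded_measurableD; first exact: bounded_measurableM.
  by apply: bounded_measurableN; exact: bounded_measurableM.
- by move=> x /=; rewrite !dE cos_sin_transform_diff.
move=> xi; rewrite [_ ^+ k.+1]exprSr mulrA -E.
have := cos2Dsin2 (dotv xi y); set c := cos _; set s := sin _ => cs.
set a := A' xi; set b := B' xi.
have -> : (a + - (a * c + b * s)) ^+ 2 + (b + - (b * c + - (a * s))) ^+ 2 =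
  (a ^+ 2 + b ^+ 2) * (1 - 2 * c + (c ^+ 2 + s ^+ 2)) by ring.
by rewrite cs; ring.
Qed.

(* Duality: with [c i] the value of the difference at [z i], the sum of the
   [c i ^+ 2] is a [w]-weighted pairing of the differenced transform with the
   trigonometric sum of [c] over [z], to which AM-GM is applied. *)
Lemma diffop_sample_bound k : (0 < k)%N -> m <= k%:R -> exists2 C : R, 0 < C &
  forall N (x : 'I_N -> 'rV[R]_n) (a : 'I_N -> R) N' (z : 'I_N' -> 'rV[R]_n) (q s : R) (y : 'rV[R]_n),
  0 < s <= q -> well_separated z q -> dotv y y <= 4 ->
  \sum_(i < N') diffop k (s *: y) (kcomb x a) (z i) ^+ 2 <=
    C * s `^ (2 * m - n%:R) * \int[mu n]_xi (w xi * trig_sq x a xi).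
Proof.
move=> k0 mk; have [C C0 HC] := integral_bessel_trig_sq nm.
pose C1 := c2 * 4 ^+ k * 2 `^ m * C.
have C10 : 0 < C1 by rewrite !mulr_gt0 ?exprn_gt0 ?powR_gt0.
exists C1 => // N x a N' z q s y /andP[s0 sq] sep y4.
set U := kcomb x a.
have UE : U = cos_sin_transform (cos_sum x a) (sin_sum x a) by apply/funext => v; exact: kcomb_cos_sin_transform.
have [A [B [bA bB dE E]]] := diffop_cos_sin_transform k (s *: y) (bounded_measurable_cos_sum x a) (bounded_measurable_sin_sum x a).
pose c i := diffop k (s *: y) U (z i).
have cE i : c i = cos_sin_transform A B (z i) by rewrite /c UE dE.
pose th xi := 2 - 2 * cos (dotv xi (s *: y)).
(* The AM-GM weight: with this value [step3] bounds the second term of [step2] by half of the left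
   side, which can then be absorbed. *)
pose t := C1 * s `^ (2 * m - n%:R).
have t0 : 0 < t by rewrite mulr_gt0// powR_gt0.
have bc := bounded_measurable_cos_sum z c; have bs := bounded_measurable_sin_sum z c.
have bpz : bounded_measurable (trig_sq z c).
  by split; [exact: measurable_trig_sq|eexists; move=> xi; exact: trig_sq_le].
have bth : bounded_measurable th.
  by apply: bounded_measurableD; [exact: bounded_measurable_cst|apply: bounded_measurableN;
    apply: bounded_measurableM; [exact: bounded_measurable_cst|exact: bounded_measurable_cos]].
have bthk : bounded_measurable (fun xi => th xi ^+ k).
  elim: (k) => [|k' IH].
    by under eq_fun do rewrite expr0; exact: bounded_measurable_cst.
  by under eq_fun do rewrite exprS; exact: bounded_measurableM.
have iQ : (mu n).-integrable setT (EFin \o (fun xi => w xi * (th xi ^+ k * trig_sq z c xi))).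
  by apply: integrable_bounded_measurable; exact: bounded_measurableM.
have iP := integrable_trig_sq x a wi.
have step1 : \sum_(i < N') c i ^+ 2 = \int[mu n]_xi (w xi * (A xi * cos_sum z c xi + B xi * sin_sum z c xi)).
  have ii i : (mu n).-integrable setT (EFin \o (fun xi => c i * (w xi * (A xi * cos (dotv xi (z i)) + B xi * sin (dotv xi (z i)))))).
    apply: (integrableZl measurableT (c i) (f := EFin \o (fun xi => w xi * (A xi * cos (dotv xi (z i)) + B xi * sin (dotv xi (z i)))))).
    apply: integrable_bounded_measurable; apply: bounded_measurableD; apply: bounded_measurableM => //;
      [exact: bounded_measurable_cos|exact: bounded_measurable_sin].
  transitivity (\int[mu n]_xi (\sum_(i < N') c i * (w xi * (A xi * cos (dotv xi (z i)) + B xi * sin (dotv xi (z i)))))).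
    rewrite (Rintegral_sum _ ii).2; apply: eq_bigr => i _.
    rewrite RintegralZl//; last first.
      apply: integrable_bounded_measurable; apply: bounded_measurableD; apply: bounded_measurableM => //;
      [exact: bounded_measurable_cos|exact: bounded_measurable_sin].
    by rewrite -[\int[_]_(_ in _) _]cE expr2.
  apply: eq_Rintegral => xi _; rewrite /cos_sum /sin_sum !mulr_sumr -big_split /= mulr_sumr.
  by apply: eq_bigr => j _; ring.
have step2 : \sum_(i < N') c i ^+ 2 <= t / 2 * (\int[mu n]_xi (w xi * trig_sq x a xi)) +
    (2 * t)^-1 * \int[mu n]_xi (w xi * (th xi ^+ k * trig_sq z c xi)).
  have i1 := integrableZl measurableT (t / 2) iP.
  have i2 := integrableZl measurableT (2 * t)^-1 iQ.
  rewrite step1 -RintegralZl// -RintegralZl// -RintegralD//.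
  apply: le_Rintegral => //.
  - by apply: integrable_bounded_measurable; apply: bounded_measurableD; exact: bounded_measurableM.
  - exact: (integrableD measurableT i1 i2).
  move=> xi _; rewrite (mulrCA _ (w xi)) (mulrCA (2 * t)^-1) -mulrDr ler_wpM2l//.
  have := E xi; rewrite -/(trig_sq x a xi) -/(th xi) => Exi.
  set u := A xi in Exi *; set v := B xi in Exi *; set p := cos_sum _ _ _; set r := sin_sum _ _ _.
  have th0 : 0 <= th xi ^+ k by rewrite exprn_ge0// twoB_cos_ge0.
  set P := trig_sq x a xi in Exi *; set Q := th xi ^+ k in th0 Exi *.
  have P0 : 0 <= P by exact: trig_sq_ge0.
  rewrite (_ : trig_sq z c xi = p ^+ 2 + r ^+ 2)//.
  set L := u * p + v * r; set M := t / 2 * P + (2 * t)^-1 * (Q * (p ^+ 2 + r ^+ 2)).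
  have pr0 : 0 <= p ^+ 2 + r ^+ 2 by rewrite addr_ge0// sqr_ge0.
  have t2 : 0 <= t / 2 by lra.
  have t3 : 0 <= (2 * t)^-1 by rewrite invr_ge0 mulr_ge0// ltW.
  have M0 : 0 <= M.
    by apply: addr_ge0; apply: mulr_ge0 => //; exact: mulr_ge0.
  have CS : L ^+ 2 <= (u ^+ 2 + v ^+ 2) * (p ^+ 2 + r ^+ 2).
    have := sqr_ge0 (u * r - v * p); rewrite /L; nra.
  have AG : P * Q * (p ^+ 2 + r ^+ 2) <= M ^+ 2.
    have := sqr_ge0 (t / 2 * P - (2 * t)^-1 * (Q * (p ^+ 2 + r ^+ 2))).
    set Z := Q * _.
    have -> : P * Q * (p ^+ 2 + r ^+ 2) = P * Z by rewrite /Z; ring.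
    have -> : M ^+ 2 = (t / 2 * P - (2 * t)^-1 * Z) ^+ 2 + P * Z.
      by rewrite /M -/Z; field; rewrite gt_eqF.
    by rewrite lerDr.
  rewrite Exi in CS.
  have LM := le_trans CS AG.
  have [L0|L0] := leP L 0; first exact: le_trans M0.
  by rewrite -(@ler_pXn2r _ 2)// nnegrE ltW.
(* The symbol [th^k] converts the weight [w] into the Bessel weight rescaled by [s], for which
   [integral_bessel_trig_sq] applies to the family [z]. *)
have step3 : \int[mu n]_xi (w xi * (th xi ^+ k * trig_sq z c xi)) <= t * \sum_(i < N') c i ^+ 2.
  rewrite -lee_fin /Rintegral fineK; last exact: integrable_fin_num.
  have mbes : measurable_fun setT (fun xi : 'rV[R]_n => (1 + s ^+ 2 * dotv xi xi) `^ (- m)).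
    have h : measurable_fun setT (fun xi : 'rV[R]_n => 1 + s ^+ 2 * dotv xi xi).
      by apply: measurable_funD => //; apply: measurable_funM => //; exact: measurable_dotvv.
    exact: (measurableT_comp (@measurable_powR R (- m)) h).
  pose K := c2 * (4 ^+ k * 2 `^ m * s `^ (2 * m)).
  apply: (@le_trans _ _ (\int[mu n]_xi (K%:E * ((1 + s ^+ 2 * dotv xi xi) `^ (- m) * trig_sq z c xi)%:E))%E).
    apply: ge0_le_integral => //.
    - move=> xi _; rewrite lee_fin !mulr_ge0 ?trig_sq_ge0//.
      by rewrite exprn_ge0// twoB_cos_ge0.
    - exact: measurable_int iQ.
    - apply/measurable_EFinP; apply: measurable_funM => //; apply: measurable_funM => //.
      exact: measurable_trig_sq.
    move=> xi _; rewrite -EFinM lee_fin !mulrA ler_wpM2r ?trig_sq_ge0//.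
    have /andP[_ wle] := wb xi.
    have thk0 : 0 <= th xi ^+ k by rewrite exprn_ge0// twoB_cos_ge0.
    apply: (le_trans (ler_wpM2r thk0 wle)); rewrite /K -!mulrA ler_wpM2l ?(ltW c20)//.
    rewrite !mulrA; apply: bessel_mul_le => //.
    - exact: twoB_cos_ge0.
    - exact: twoB_cos_le4.
    apply: (le_trans (twoB_cos_le _)); rewrite dotvZr exprMn.
    rewrite (_ : 4 * _ = s ^+ 2 * (4 * dotv xi xi)); last ring.
    rewrite ler_wpM2l ?sqr_ge0//.
    apply: (le_trans (dotv_CS _ _)); rewrite mulrC ler_wpM2r ?dotvv_ge0//.
  have mF : measurable_fun setT (fun xi : 'rV[R]_n => ((1 + s ^+ 2 * dotv xi xi) `^ (- m) * trig_sq z c xi)%:E).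
    by apply/measurable_EFinP; apply: measurable_funM => //; exact: measurable_trig_sq.
  have F0 (xi : 'rV[R]_n) : setT xi -> (0 <= ((1 + s ^+ 2 * dotv xi xi) `^ (- m) * trig_sq z c xi)%:E)%E.
    by move=> _; rewrite lee_fin mulr_ge0 ?powR_ge0 ?trig_sq_ge0.
  have K0 : (0 <= K%:E)%E by rewrite lee_fin !mulr_ge0 ?exprn_ge0 ?powR_ge0 ?(ltW c20).
  rewrite (ge0_integralZl _ measurableT mF F0 K0).
  have sqq : 0 < s <= q by rewrite s0.
  have h := HC N' z c q s sqq sep.
  apply: (le_trans (lee_wpmul2l K0 h)); rewrite -EFinM lee_fin.
  rewrite le_eqVlt; apply/orP; left; apply/eqP.
  rewrite /t /C1 /K powRD; last by rewrite (gt_eqF s0) implybT.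
  by rewrite powRN powR_mulrn ?(ltW s0)//; ring.
have -> : \sum_(i < N') diffop k (s *: y) U (z i) ^+ 2 = \sum_(i < N') c i ^+ 2 by [].
rewrite -/t.
move: step2 step3; move: (\int[mu n]_xi (w xi * trig_sq x a xi)) => P.
move: (\int[mu n]_xi (w xi * (th xi ^+ k * trig_sq z c xi))) => Q step2 step3.
have h : (2 * t)^-1 * Q <= 2^-1 * \sum_(i < N') c i ^+ 2.
  by rewrite invfM -mulrA ler_wpM2l ?invr_ge0// ler_pdivrMl//.
lra.
Qed.

End kernel_space.

(** * Averaging over the interior cones *)

Section cone_average.
Context (R : realType).
Local Notation mu n := (@lebesgue_rV R n).

Lemma enormN n (x : 'rV[R]_n) : enorm (- x) = enorm x.
Proof. by rewrite /enorm dotvNl dotvNr opprK. Qed.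

Lemma enormZ n (a : R) (x : 'rV[R]_n) : enorm (a *: x) = `|a| * enorm x.
Proof. by rewrite /enorm dotvZl dotvZr mulrA -expr2 sqrtrM ?sqr_ge0// sqrtr_sqr. Qed.

Lemma dotv_le_enorm n (x y : 'rV[R]_n) : dotv x y <= enorm x * enorm y.
Proof.
apply: le_trans (ler_norm _) _.
rewrite -(@ler_pXn2r _ 2)// ?nnegrE ?mulr_ge0 ?enorm_ge0//.
by rewrite real_normK ?num_real// exprMn !enorm_sqr dotv_CS.
Qed.

Lemma enorm_triangle n (x y : 'rV[R]_n) : enorm (x + y) <= enorm x + enorm y.
Proof.
rewrite -(@ler_pXn2r _ 2)// ?nnegrE ?addr_ge0 ?enorm_ge0//.
rewrite sqrrD !enorm_sqr dotvDl !dotvDr (dotvC y x).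
have := dotv_le_enorm x y; lra.
Qed.

Lemma enorm_le_sqr n (x : 'rV[R]_n) (r : R) : 0 <= r -> (enorm x <= r) = (dotv x x <= r ^+ 2).
Proof. by move=> r0; rewrite -enorm_sqr ler_pXn2r ?nnegrE ?enorm_ge0. Qed.

(** A full cube of directions around [p] is required, since they will be averaged. The length bound
    2 serves both the hypothesis [dotv y y <= 4] of the difference estimate and the disjointness of
    the averaging cubes. *)
Definition cone_direction n (Omega : set 'rV[R]_n) (x : 'rV[R]_n) (l0 eta : R) (p : 'rV[R]_n) :=
  forall v, cube n eta v -> enorm (p + v) <= 2 /\
    forall l, 0 <= l <= l0 -> Omega (x + l *: (p + v)).

(** A vector within [(1 - cos theta) / 2] of the axis still makes an angle at most [theta] with it.
    It may be longer than 1, but is shorter than 2, so halving the height suffices. *)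
Lemma cone_near n (Omega : set 'rV[R]_n) : interior_cone_condition Omega ->
  exists eps r : R, [/\ 0 < eps <= 1, 0 < r & forall x, Omega x ->
    exists2 xi : 'rV[R]_n, enorm xi = 1 &
    forall y, enorm (y - xi) <= eps -> forall l, 0 <= l <= r -> Omega (x + l *: y)].
Proof.
move=> [theta [r [/andP[th0 thpi] r0 cone]]].
pose c := cos theta.
have c1 : c < 1.
  have s0 : 0 < sin theta by apply: sin_gt0_pi; rewrite th0/=; have := pi_gt0 R; lra.
  have := cos2sin2 theta; have := cos_le1 theta; rewrite -/c => h1 h2.
  have : 0 < sin theta ^+ 2 by rewrite exprn_gt0.
  have [//|h3 h4] := ltP c 1; nra.
have c0 : 0 < c by apply: cos_gt0_pihalf; rewrite thpi andbT; lra.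
exists ((1 - c) / 2), (r / 2); split; [lra|lra|].
move=> x Ox; have [xi xi1 H] := cone x Ox; exists xi => // y yxi l /andP[l0 lr].
pose e := y - xi; have yE : y = xi + e by rewrite /e addrC subrK.
have n1 : enorm y <= 1 + (1 - c) / 2.
  by rewrite yE; apply: le_trans (enorm_triangle _ _) _; rewrite xi1 lerD2l.
have d1 : 1 - (1 - c) / 2 <= dotv y xi.
  rewrite yE dotvDl -enorm_sqr xi1 expr1n.
  have := dotv_le_enorm (- e) xi; rewrite dotvNl enormN xi1 mulr1.
  have : enorm e <= (1 - c) / 2 by []; lra.
have y0 : 0 < enorm y.
  rewrite lt_neqAle enorm_ge0 andbT eq_sym; apply/eqP => y0.
  have := dotv_le_enorm y xi; rewrite y0 mul0r; lra.
have -> : l *: y = (l * enorm y) *: ((enorm y)^-1 *: y).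
  by rewrite scalerA mulfK// gt_eqF.
apply: H.
- by rewrite enormZ ger0_norm ?invr_ge0 ?(ltW y0)// mulVf// gt_eqF.
- rewrite dotvZl ler_pdivlMl// mulrC -/c.
  have := ler_wpM2l (ltW c0) n1; nra.
- by rewrite mulr_ge0 ?(ltW y0)//=; nra.
Qed.

(** Rounds the coordinates of the axis, which lie in [[-1, 1]], down to a grid of mesh [h]; the grid
    is finite and independent of the point. *)
Lemma cone_directions n (Omega : set 'rV[R]_n) : interior_cone_condition Omega ->
  exists (T : finType) (P : T -> 'rV[R]_n) (l0 eta : R), [/\ 0 < l0, 0 < eta &
    forall x, Omega x -> exists t, cone_direction Omega x l0 eta (P t)].
Proof.
move=> /cone_near[eps [r [/andP[eps0 eps1] r0 H]]].
(* Rounding and the perturbation in the cube each cost at most [h] per coordinate;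
   [2 h = eps / (n + 1)] keeps the Euclidean error within [eps]. *)
pose h := eps / (2 * n.+1%:R).
have h0 : 0 < h by rewrite divr_gt0// mulr_gt0.
pose L := (Num.trunc (2 / h)).+1.
exists {ffun 'I_n -> 'I_L}, (fun t : {ffun 'I_n -> 'I_L} => \row_i ((t i)%:R * h - 1)), r, h; split=> // x Ox.
have [xi xi1 Hxi] := H x Ox.
have xib i : `|xi 0 i| <= 1.
  rewrite -(@ler_pXn2r _ 2)// ?nnegrE// real_normK ?num_real// expr1n.
  have : dotv xi xi = 1 by rewrite -enorm_sqr xi1 expr1n.
  rewrite /dotv (bigD1 i)//= -expr2 => <-; rewrite lerDl.
  by apply: sumr_ge0 => j _; rewrite -expr2 sqr_ge0.
have u0 i : 0 <= (xi 0 i + 1) / h.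
  by rewrite divr_ge0 ?(ltW h0)//; have := xib i; rewrite ler_norml => /andP[]; lra.
have kL i : (Num.trunc ((xi 0 i + 1) / h)%R < L)%N.
  rewrite ltnS; apply: le_truncn; rewrite ler_pM2r ?invr_gt0//.
  by have := xib i; rewrite ler_norml => /andP[]; lra.
exists [ffun i => Ordinal (kL i)] => v cv.
set p := \row_i _.
have pv : enorm (p + v - xi) <= eps.
  rewrite enorm_le_sqr ?(ltW eps0)//.
  have pc i : `|(p + v - xi) 0 i| <= 2 * h.
    rewrite !mxE ffunE /=.
    have := cv i; have /andP[a b] := truncn_itv (u0 i).
    move: a b; rewrite ler_pdivlMr// ltr_pdivrMr//.
    set t := (_%:R : R); rewrite -natr1 -/t mulrDl mul1r ltr_norml => a b /andP[v1 v2].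
    rewrite ler_norml; apply/andP; split; lra.
  apply: (le_trans (dotv_sq_le pc)).
  have -> : 2 * h = eps / n.+1%:R.
    have N0 : n.+1%:R != 0 :> R by rewrite pnatr_eq0.
    by rewrite /h; move: (n.+1%:R) N0 => u u0'; field.
  rewrite expr_div_n mulrCA ler_piMr ?sqr_ge0//.
  rewrite ler_pdivrMr ?exprn_gt0// mul1r expr2 -natrM ler_nat.
  by rewrite (leq_trans (leqnSn n))// leq_pmulr.
split; last by move=> l lr; exact: Hxi.
have -> : p + v = (p + v - xi) + xi by rewrite subrK.
apply: le_trans (enorm_triangle _ _) _; rewrite xi1; lra.
Qed.

(** Substituting [y = x i + t (p i + v)] gives [t^(- n)] times an integral over a small cube inside
    [Omega]. Its points lie within [2 t < q] of [x i], while nodes are [2 q] apart, so different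
    cubes are disjoint and the integrals add up to at most one over [Omega]. *)
Lemma sum_cone_average n (Omega : set 'rV[R]_n) (f : 'rV[R]_n -> R) l0 eta N
    (x p : 'I_N -> 'rV[R]_n) (q t : R) :
  measurable Omega -> measurable_fun setT f -> (forall y, 0 <= f y) ->
  0 < eta -> well_separated x q -> (forall i, cone_direction Omega (x i) l0 eta (p i)) ->
  0 < t -> t <= l0 -> 2 * t < q ->
  (\sum_(i < N) \int[mu n]_v (\1_(cube n eta) v * f (x i + t *: (p i + v)))%:E <=
   (t ^- n)%:E * \int[mu n]_(y in Omega) (f y)%:E)%E.
Proof.
move=> mO mf f0 eta0 sep dir t0 tl0 tq.
have tn0 : 0 < t ^+ n by rewrite exprn_gt0.
pose c i := x i + t *: p i.
pose A i := [set y | cube n eta (t^-1 *: (y - c i))].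
have mA i : measurable (A i).
  rewrite /A -[X in measurable X]setTI.
  have := measurable_rV_affine (- (t^-1 *: c i)) t^-1 measurableT (@measurable_cube R n eta).
  by congr measurable; congr (_ `&` _); apply/seteqP; split=> y /=; rewrite scalerBr addrC.
pose F i y := \1_(A i) y * f y.
have mF i : measurable_fun setT (fun y => (F i y)%:E).
  by apply/measurable_EFinP; apply: measurable_funM => //; exact: measurable_indic.
have F0 i y : (0 <= (F i y)%:E)%E by rewrite lee_fin mulr_ge0// indicE.
have E i : (\int[mu n]_v (\1_(cube n eta) v * f (x i + t *: (p i + v)))%:E =
    (t ^- n)%:E * \int[mu n]_y (F i y)%:E)%E.
  rewrite (ge0_integral_rV_affine (c i) t0 (mF i) (F0 i)) muleA -EFinM mulVf ?gt_eqF// mul1e.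
  apply: eq_integral => v _; rewrite /F /c scalerDr addrA; congr (_ * _)%:E.
  rewrite !indicE; congr (nat_of_bool _)%:R; apply/idP/idP; rewrite !inE /A /=.
    by rewrite addrAC subrr add0r scalerA mulVf ?gt_eqF// scale1r.
  by rewrite addrAC subrr add0r scalerA mulVf ?gt_eqF// scale1r.
under eq_bigr do rewrite E.
rewrite -ge0_sume_distrr; last by move=> i _; apply: integral_ge0 => y _.
apply: lee_wpmul2l; first by rewrite lee_fin invr_ge0 ltW.
rewrite -ge0_integral_sum// [leRHS]integral_mkcond.
have fO : measurable_fun setT (fun y => (f y)%:E) by exact/measurable_EFinP.
apply: ge0_le_integral => //.
- by move=> y _; apply: sume_ge0.
- by apply: emeasurable_sum.
- by apply/(measurable_restrictT _ _).1 => //; exact: measurable_funTS.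
have AO i y : A i y -> exists2 v, cube n eta v & y = x i + t *: (p i + v).
  move=> Ay; exists (t^-1 *: (y - c i)) => //.
  by rewrite scalerDr addrA scalerA mulfV ?gt_eqF// scale1r addrC subrK.
move=> y _; rewrite patchE; case: ifPn => [_|yO].
  rewrite sumEFin lee_fin -mulr_suml ler_piMl//.
  apply: sum_disjoint_indic_le1 => i j /AO[v cv yv] /AO[u cu yu].
  apply/eqP; apply: contraT => /sep.
  have -> : x i - x j = t *: (p j + u) + - (t *: (p i + v)).
    have ei : x i = y - t *: (p i + v) by rewrite yv addrK.
    have ej : x j = y - t *: (p j + u) by rewrite yu addrK.
    by rewrite ei ej opprB addrC addrA subrK.
  have h1 := enorm_triangle (t *: (p j + u)) (- (t *: (p i + v))).
  have [h2 _] := dir j u cu; have [h3 _] := dir i v cv.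
  move: h1; rewrite enormN !enormZ (ger0_norm (ltW t0)) => h1.
  have := ler_wpM2l (ltW t0) h2; have := ler_wpM2l (ltW t0) h3; lra.
rewrite big1// => i _; rewrite /F indicE memNset ?mul0r// => /AO[v cv yv].
move/negP: yO; apply; rewrite inE yv; apply: (dir i v cv).2.
by rewrite (ltW t0).
Qed.

End cone_average.

(** * Absorption of the differences and the pointwise bound *)

Section pointwise_bound.
Context (R : realType).
Local Notation mu n := (@lebesgue_rV R n).

Lemma sqr_sum_le (k : nat) (g : nat -> R) :
  (\sum_(1 <= l < k.+1) g l) ^+ 2 <= k%:R * \sum_(1 <= l < k.+1) g l ^+ 2.
Proof.
elim: k => [|k IH]; first by rewrite !big_geq// expr0n mul0r.
rewrite -natr1 [X in X ^+ 2 <= _]big_nat_recr//= [X in _ <= _ * X]big_nat_recr//=.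
set A := \sum_(1 <= l < k.+1) g l in IH *; set B := \sum_(1 <= l < k.+1) g l ^+ 2 in IH *.
set c := g k.+1; have k0 : 0 <= k%:R :> R by [].
have B0 : 0 <= B by apply: sumr_ge0 => l _; exact: sqr_ge0.
have [kE|k1] := eqVneq k 0%N.
  have A0 : A = 0 by rewrite /A kE big_geq.
  rewrite A0 kE; nra.
have kp : 0 < k%:R :> R by rewrite ltr0n lt0n.
have h : 2 * A * c <= A ^+ 2 / k%:R + k%:R * c ^+ 2.
  rewrite -(ler_pM2r kp) [X in _ <= X]mulrDl divfK ?gt_eqF//.
  have := sqr_ge0 (A - k%:R * c); nra.
have h2 : A ^+ 2 / k%:R <= B by rewrite ler_pdivrMr// mulrC.
nra.
Qed.

Lemma sqr_le_diffop n k (y : 'rV[R]_n) f x :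
  f x ^+ 2 <= 2 * diffop k y f x ^+ 2 +
    2 * (4 ^+ k * k%:R * \sum_(1 <= l < k.+1) f (x + y *+ l) ^+ 2).
Proof.
have h := diffop_bound k y f x.
set a := f x in h *; set b := diffop k y f x in h *.
set S := \sum_(1 <= l < k.+1) _ in h.
have S0 : 0 <= S by apply: sumr_ge0.
have h2 : (a - b) ^+ 2 <= 4 ^+ k * (k%:R * \sum_(1 <= l < k.+1) f (x + y *+ l) ^+ 2).
  apply: (@le_trans _ _ ((2 ^+ k * S) ^+ 2)).
    rewrite -(real_normK (num_real (a - b))) lerXn2r ?nnegrE ?mulr_ge0 ?exprn_ge0//.
  rewrite exprMn -exprM mulnC exprM (_ : 2 ^+ 2 = 4); last by rewrite expr2 -natrM.
  rewrite ler_wpM2l ?exprn_ge0//; apply: (le_trans (sqr_sum_le _ _)).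
  rewrite ler_wpM2l//; apply: ler_sum => l _; by rewrite real_normK ?num_real.
rewrite -mulrA; set Z := 4 ^+ k * _ in h2 *.
have := sqr_ge0 (a - 2 * b); nra.
Qed.

Context (n : nat) (w : 'rV[R]_n -> R) (m c1 c2 : R).
Context (nm : n%:R / 2 < m) (mw : measurable_fun setT w) (c10 : 0 < c1) (c20 : 0 < c2).
Context (wb : forall xi, c1 * bessel m xi <= w xi <= c2 * bessel m xi).

(** Within a class all steps coincide, and a subfamily of a separated family is separated, so
    [diffop_sample_bound] applies to each class; the bounds are added. *)
Lemma diffop_classes_bound k (T : finType) (P : T -> 'rV[R]_n) : (0 < k)%N -> m <= k%:R ->
  exists2 C : R, 0 < C &
  forall N (x : 'I_N -> 'rV[R]_n) (a : 'I_N -> R) N' (z : 'I_N' -> 'rV[R]_n) (ka : 'I_N' -> T)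
    (q s : R) (v : 'rV[R]_n),
  0 < s <= q -> well_separated z q -> (forall i, enorm (P (ka i) + v) <= 2) ->
  \sum_(i < N') diffop k (s *: (P (ka i) + v)) (kcomb w x a) (z i) ^+ 2 <=
    C * s `^ (2 * m - n%:R) * \int[mu n]_xi (w xi * trig_sq x a xi).
Proof.
move=> k0 mk; have [C C0 HC] := diffop_sample_bound nm mw c10 c20 wb k0 mk.
(* The successor keeps the constant positive even for an empty [T]. *)
exists (#|T|.+1%:R * C); first by rewrite mulr_gt0.
move=> N x a N' z ka q s v sq sep P2.
set NN := \int[_]_xi _.
have NN0 : 0 <= NN by apply: (native_norm_ge0 c10 wb).
have E : 0 <= C * s `^ (2 * m - n%:R) * NN by rewrite !mulr_ge0 ?powR_ge0 ?(ltW C0).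
rewrite (partition_big ka predT)//=.
apply: (@le_trans _ _ (\sum_(t : T) C * s `^ (2 * m - n%:R) * NN)); last first.
  rewrite sumr_const -mulrA -mulrA mulrA -[leLHS]mulr_natl -!mulrA ler_wpM2r ?ler_nat//.
  by rewrite mulrA.
apply: ler_sum => t _.
have [j tj|/(_ _) nt] := pickP [pred i | ka i == t]; last first.
  by rewrite big_pred0// => i; have := nt i.
pose J := [pred i | ka i == t].
have -> : \sum_(i < N' | ka i == t) diffop k (s *: (P (ka i) + v)) (kcomb w x a) (z i) ^+ 2 =
   \sum_(i < #|J|) diffop k (s *: (P t + v)) (kcomb w x a) (z (enum_val i)) ^+ 2.
  rewrite -(big_enum_val (A := J) (fun i => diffop k (s *: (P t + v)) (kcomb w x a) (z i) ^+ 2)).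
  by apply: eq_big => i; rewrite ?inE// => /eqP ->.
apply: (HC N x a #|J| (fun i => z (enum_val i)) q s (P t + v) sq).
  by move=> i i' ii'; apply: sep; apply: contra ii' => /eqP /enum_val_inj ->.
have := P2 j; move/eqP: tj => /= ->; rewrite enorm_le_sqr//.
by rewrite expr2 -natrM.
Qed.

(** Replacing [cos] by [1 + cos] makes the integrand nonnegative, so Tonelli gives measurability;
    the added constant, the integral of [w], is subtracted afterwards. *)
Lemma measurable_kern : measurable_fun setT (kern w).
Proof.
have w0 xi : 0 <= w xi.
  have /andP[h _] := wb xi; apply: le_trans h.
  by rewrite mulr_ge0 ?(ltW c10)// ltW// bessel_gt0.
have wi : (mu n).-integrable setT (EFin \o w).
  apply: (@le_integrable _ _ _ (mu n) setT measurableT _ (EFin \o (fun xi => c2 * bessel m xi))).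
  - exact/measurable_EFinP.
  - move=> xi _; rewrite /= lee_fin !ger0_norm//.
      by have /andP[] := wb xi.
    by rewrite mulr_ge0 ?(ltW c20)// ltW// bessel_gt0.
  - exact: (integrableZl measurableT c2 (integrable_bessel nm)).
pose F (p : 'rV[R]_n * 'rV[R]_n) := (w p.2 * (1 + cos (dotv p.2 p.1)))%:E.
have mF : measurable_fun setT F.
  apply/measurable_EFinP; apply: measurable_funM; first exact: measurableT_comp.
  apply: measurable_funD => //.
  apply: (measurableT_comp (continuous_measurable_fun (@continuous_cos R))).
  apply: measurable_sum => i; apply: measurable_funM.
    exact: (measurableT_comp (@measurable_rV_coord R n i) measurable_snd).
  exact: (measurableT_comp (@measurable_rV_coord R n i) measurable_fst).
have F0 p : (0 <= F p)%E.
  by rewrite lee_fin mulr_ge0//; have := cos_geN1 (dotv p.2 p.1); lra.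
have mI : measurable_fun setT (fubini_F (mu n) F).
  exact: (@measurable_fun_fubini_tonelli_F _ _ _ _ _ (mu n) F).
have -> : kern w = (fun x => fine (fubini_F (mu n) F x) - \int[mu n]_xi w xi).
  apply/funext => x; rewrite /kern /fubini_F /F /=.
  have -> : fine (\int[mu n]_y (w y * (1 + cos (dotv y x)))%:E)%E =
     \int[mu n]_y (w y + w y * cos (dotv y x)).
    by rewrite /Rintegral; congr fine; apply: eq_integral => y _; rewrite mulrDr mulr1.
  rewrite RintegralD//; last exact: integrable_cos.
  by rewrite addrAC subrr add0r.
by apply: measurable_funB => //; apply: measurableT_comp => //.
Qed.

Lemma measurable_kcomb N (x : 'I_N -> 'rV[R]_n) a : measurable_fun setT (kcomb w x a).
Proof.
apply: measurable_sum => j; apply: measurable_funM => //.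
have h := measurableT_comp measurable_kern (measurable_rV_affine (- x j) 1).
by move: h; congr measurable_fun; apply/funext => y /=; rewrite scale1r addrC.
Qed.

(* The factor [s `^ (2 * m - n) * q `^ (n - 2 * m) = delta `^ (2 * m - n)] is
   made small by the choice of [delta], so that the finite differences can be
   absorbed into the sample values. *)
Lemma kcomb_pointwise_bound (Omega : set 'rV[R]_n) (qm : R) : measurable Omega ->
  interior_cone_condition Omega -> 0 < qm ->
  exists2 C : R, 0 < C &
  forall N (x : 'I_N -> 'rV[R]_n) (a : 'I_N -> R) (q : R),
  0 < q <= qm -> well_separated x q -> (forall j, Omega (x j)) ->
  forall p, Omega p ->
  ((kcomb w x a p ^+ 2)%:E <=
    (C * q ^- n)%:E * \int[mu n]_(y in Omega) (kcomb w x a y ^+ 2)%:E)%E.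
Proof.
move=> mO cone qm0.
have [T [P [l0 [eta [l00 eta0 dirs]]]]] := cone_directions cone.
have [k mk k0] : exists2 k : nat, m <= k%:R & (0 < k)%N.
  by exists (Num.trunc m).+1 => //; exact: ltW (truncnS_gt _).
have kr0 : 0 < k%:R :> R by rewrite ltr0n.
have [C1 C10 HC1] := diffop_classes_bound P k0 mk.
have [C2 C20 HC2] := native_norm_le nm mw c10 c20 wb qm0.
pose e := 2 * m - n%:R; have e0 : 0 < e by rewrite /e; have := nm; lra.
pose B := 4 * C1 * C2.
have B0 : 0 < B by rewrite !mulr_gt0.
(* The three bounds serve, in order, the absorption ([B * delta^e <= 1]), the disjointness of the
   averaging cubes ([k s <= q / 4]), and the height of the cones ([k s <= l0]). *)
pose delta := Num.min (B^-1 `^ e^-1) (Num.min (4 * k%:R)^-1 (l0 / (k%:R * qm))).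
have d0 : 0 < delta.
  by rewrite !lt_min powR_gt0 ?invr_gt0//= ?mulr_gt0 ?invr_gt0 ?mulr_gt0.
have dB : B * delta `^ e <= 1.
  rewrite -ler_pdivlMl// mulr1.
  apply: (@le_trans _ _ ((B^-1 `^ e^-1) `^ e)).
    by apply: ge0_ler_powR; rewrite ?nnegrE ?(ltW e0) ?(ltW d0) ?powR_ge0// ge_min lexx.
  by rewrite -powRrM mulVf ?gt_eqF// powRr1// invr_ge0 ltW.
have dk : k%:R * delta <= 4^-1.
  have : delta <= (4 * k%:R)^-1 by rewrite !ge_min lexx orbT.
  move=> h; apply: (le_trans (ler_wpM2l (ltW kr0) h)).
  by rewrite invfM mulrCA divff ?mulr1// gt_eqF.
have dl : k%:R * (delta * qm) <= l0.
  have : delta <= l0 / (k%:R * qm) by rewrite !ge_min lexx !orbT.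
  by rewrite ler_pdivlMr ?mulr_gt0// mulrCA.
pose Vol := (2 * eta) ^+ n; have Vol0 : 0 < Vol by rewrite exprn_gt0// mulr_gt0.
pose A : R := 2 * (4 ^+ k * k%:R); have A0 : 0 < A by rewrite !mulr_gt0 ?exprn_gt0.
pose D := A * k%:R * delta ^- n / Vol.
have D0 : 0 < D.
  apply: divr_gt0 => //; apply: mulr_gt0; first exact: mulr_gt0.
  by rewrite invr_gt0 exprn_gt0.
exists (3 * D); first by rewrite mulr_gt0.
move=> N x a q /andP[q0 qqm] sep xO p pO.
set U := kcomb w x a.
pose s := delta * q; have s0 : 0 < s by rewrite mulr_gt0.
have d1 : delta <= 1.
  have : delta <= k%:R * delta by rewrite ler_peMl ?(ltW d0)// ler1n.
  lra.
have sq : 0 < s <= q by rewrite s0 /s ler_piMl ?(ltW q0).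
set NN := (\int[mu n]_xi (w xi * trig_sq x a xi)).
set V := \sum_(i < N) U (x i) ^+ 2.
set I := (\int[mu n]_(y in Omega) _)%E.
have V0 : 0 <= V by apply: sumr_ge0 => i _; exact: sqr_ge0.
have small : C1 * s `^ e * NN <= 4^-1 * V.
  have h : NN <= C2 * q `^ (n%:R - 2 * m) * V.
    by apply: HC2 => //; rewrite q0 qqm.
  have p0 : 0 <= C1 * s `^ e by rewrite mulr_ge0 ?powR_ge0// ltW.
  apply: (le_trans (ler_wpM2l p0 h)).
  rewrite /s powRM ?(ltW d0) ?(ltW q0)//.
  have -> : C1 * (delta `^ e * q `^ e) * (C2 * q `^ (n%:R - 2 * m) * V) =
     4^-1 * (B * delta `^ e) * (q `^ e * q `^ (n%:R - 2 * m)) * V by rewrite /B; field.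
  rewrite -powRD; last by rewrite (gt_eqF q0) implybT.
  have -> : e + (n%:R - 2 * m) = 0 by rewrite /e; ring.
  rewrite powRr0 mulr1 ler_wpM2r//; lra.
have mU : measurable_fun setT U by exact: measurable_kcomb.
pose f y := U y ^+ 2.
have mf : measurable_fun setT f by exact: measurable_funX.
have f0 y : 0 <= f y by exact: sqr_ge0.
have I0 : (0 <= I)%E by apply: integral_ge0 => y _; rewrite lee_fin f0.
(* Stated for an arbitrary separated family because it is used twice: for the nodes themselves, and
   for the single point [p], where separation is vacuous. In both cases the differences are bounded
   through the samples at the nodes. *)
have avg N' (z : 'I_N' -> 'rV[R]_n) : well_separated z q -> (forall i, Omega (z i)) ->
   ((\sum_(i < N') U (z i) ^+ 2)%:E <= (2^-1 * V)%:E + (D * q ^- n)%:E * I)%E.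
  move=> sepz zO.
  have /choice[ka kaP] : forall i, exists t, cone_direction Omega (z i) l0 eta (P t).
    by move=> i; exact: dirs (zO i).
  pose g l i v := \1_(cube n eta) v * f (z i + (l%:R * s) *: (P (ka i) + v)).
  pose S := \sum_(i < N') U (z i) ^+ 2.
  have g0 l i v : 0 <= g l i v by rewrite /g mulr_ge0// indicE.
  have mcube : measurable_fun setT (\1_(cube n eta) : 'rV[R]_n -> R).
    by apply: measurable_indic; exact: measurable_cube.
  have mg l i : measurable_fun setT (fun v => (g l i v)%:E).
    apply/measurable_EFinP; apply: measurable_funM => //.
    have h := measurableT_comp mf (measurable_rV_affine (z i + (l%:R * s) *: P (ka i)) (l%:R * s)).
    by move: h; congr measurable_fun; apply/funext => v /=; rewrite scalerDr addrA.
  (* The estimate holds for each [v] in the cube with the same constant; the indicator turns it into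
     one valid for all [v], ready to be integrated. *)
  have pw v : S * \1_(cube n eta) v <= 2^-1 * V * \1_(cube n eta) v +
      A * \sum_(1 <= l < k.+1) \sum_(i < N') g l i v.
    rewrite /g indicE; have [|_] := boolP (_ \in _); last first.
      rewrite !mulr0 add0r big1 ?mulr0// => l _; rewrite big1// => i _.
      by rewrite mul0r.
    rewrite inE => cv; rewrite !mulr1.
    have hd : \sum_(i < N') diffop k (s *: (P (ka i) + v)) U (z i) ^+ 2 <= 4^-1 * V.
      apply: le_trans small; apply: (HC1 _ x a _ z ka q s v sq sepz) => i.
      exact: (kaP i v cv).1.
    apply: (@le_trans _ _ (2 * (\sum_(i < N') diffop k (s *: (P (ka i) + v)) U (z i) ^+ 2) +
        A * \sum_(1 <= l < k.+1) \sum_(i < N') f (z i + (l%:R * s) *: (P (ka i) + v)))).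
      rewrite exchange_big /= !mulr_sumr -big_split /=; apply: ler_sum => i _.
      apply: le_trans (sqr_le_diffop k (s *: (P (ka i) + v)) U (z i)) _.
      rewrite lerD2l mulrA -/A.
      rewrite le_eqVlt; apply/orP; left; apply/eqP; congr (_ * _); apply: eq_bigr => l _.
      by rewrite /f -scaler_nat scalerA.
    have -> : \sum_(1 <= l < k.+1) \sum_(i < N') 1 * f (z i + (l%:R * s) *: (P (ka i) + v)) =
       \sum_(1 <= l < k.+1) \sum_(i < N') f (z i + (l%:R * s) *: (P (ka i) + v)).
      by apply: eq_bigr => l _; apply: eq_bigr => i _; rewrite mul1r.
    rewrite lerD2r; lra.
  have int1 (r : R) : 0 <= r -> (\int[mu n]_v (r * \1_(cube n eta) v)%:E = (r * Vol)%:E)%E.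
    move=> r0; under eq_integral do rewrite EFinM.
    rewrite ge0_integralZl//=; last exact/measurable_EFinP.
    by rewrite integral_cube.
  have S0 : 0 <= S by apply: sumr_ge0 => i _; exact: sqr_ge0.
  have V20 : 0 <= 2^-1 * V by lra.
  have step : ((S * Vol)%:E <= (2^-1 * V * Vol)%:E + (A * k%:R * s ^- n)%:E * I)%E.
    rewrite -int1//.
    apply: (@le_trans _ _ (\int[mu n]_v ((2^-1 * V * \1_(cube n eta) v)%:E +
       A%:E * \sum_(1 <= l < k.+1) \sum_(i < N') (g l i v)%:E))%E).
      apply: ge0_le_integral => //.
      - by move=> v _; rewrite lee_fin mulr_ge0// indicE.
      - by apply/measurable_EFinP; exact: measurable_funM.
      - apply: emeasurable_funD; first by apply/measurable_EFinP; exact: measurable_funM.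
        apply: measurable_funeM; apply: emeasurable_sum => l.
        exact: emeasurable_sum.
      move=> v _; under eq_bigr do rewrite sumEFin.
      by rewrite sumEFin -EFinM -EFinD lee_fin pw.
    rewrite ge0_integralD//; last 4 first.
    - by move=> v _; rewrite lee_fin mulr_ge0// indicE.
    - by apply/measurable_EFinP; exact: measurable_funM.
    - move=> v _; rewrite mule_ge0 ?lee_fin ?(ltW A0)//.
      by apply: sume_ge0 => l _; apply: sume_ge0 => i _; rewrite lee_fin.
    - apply: measurable_funeM; apply: emeasurable_sum => l.
      exact: emeasurable_sum.
    rewrite int1// leeD2l//.
    rewrite ge0_integralZl//=; last 3 first.
    - by apply: emeasurable_sum => l; exact: emeasurable_sum.
    - by move=> v _; apply: sume_ge0 => l _; apply: sume_ge0 => i _; rewrite lee_fin.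
    - by rewrite lee_fin ltW.
    have -> : ((A * k%:R * s ^- n)%:E * I = A%:E * ((k%:R * s ^- n)%:E * I))%E.
      by rewrite muleA -EFinM mulrA.
    rewrite lee_wpmul2l ?lee_fin ?(ltW A0)//.
    rewrite ge0_integral_sum//; last 2 first.
    - by move=> l; exact: emeasurable_sum.
    - by move=> l v _; apply: sume_ge0 => i _; rewrite lee_fin.
    apply: (@le_trans _ _ (\sum_(1 <= l < k.+1) (s ^- n)%:E * I)%E).
      rewrite !big_nat; apply: lee_sum => l /andP[l1 lk].
      have lr1 : 1 <= l%:R :> R by rewrite ler1n.
      have lrk : l%:R <= k%:R :> R by rewrite ler_nat -ltnS.
      have t0 : 0 < l%:R * s by rewrite mulr_gt0//; lra.
      have tk : l%:R * s <= k%:R * s by rewrite ler_wpM2r ?(ltW s0).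
      rewrite ge0_integral_sum//; last by move=> i v _; rewrite lee_fin.
      have := @sum_cone_average R n Omega f l0 eta N' z (fun i => P (ka i)) q (l%:R * s)
         mO mf f0 eta0 sepz kaP t0.
      have h1 : l%:R * s <= l0.
        apply: (le_trans tk); apply: le_trans dl; rewrite ler_wpM2l ?(ltW kr0)//.
        by rewrite ler_wpM2l ?(ltW d0).
      have h2 : 2 * (l%:R * s) < q.
        have : k%:R * s <= 4^-1 * q by rewrite /s mulrA ler_wpM2r ?(ltW q0).
        lra.
      move=> /(_ h1 h2) h3; apply: (le_trans h3); rewrite lee_wpmul2r// lee_fin.
      rewrite lef_pV2 ?posrE ?exprn_gt0// lerXn2r ?nnegrE ?(ltW s0) ?(ltW t0)//.
      by rewrite ler_peMl ?(ltW s0).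
    rewrite -ge0_sume_distrl; last by move=> l _; rewrite lee_fin invr_ge0 exprn_ge0// ltW.
    by rewrite sumEFin sumr_const_nat subSS subn0 mulr_natl.
  have Dq : D * q ^- n = A * k%:R * s ^- n / Vol.
    by rewrite /D /s exprMn invfM; ring.
  rewrite -/S Dq; clearbody I; move: I0 step.
  have c0 : 0 < A * k%:R * s ^- n by rewrite !mulr_gt0// invr_gt0 exprn_gt0.
  case: I => [r||]// r0.
    rewrite -!EFinM -!EFinD !lee_fin => h.
    rewrite -(ler_pM2r Vol0) mulrDl; apply: (le_trans h); rewrite lerD2l.
    by rewrite [leRHS]mulrAC divfK ?gt_eqF.
  by move=> _; rewrite gt0_muley ?addey ?leey// lte_fin divr_gt0.
(* For the nodes this reads [V <= V / 2 + D q^(- n) I] with [V] a finite real, so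
   [V <= 2 D q^(- n) I]. Inserting it in the estimate at [p] bounds [U p ^+ 2] by
   [2 D q^(- n) I]. *)
have hV := avg N x sep xO; rewrite -/V in hV.
have sepp : well_separated (fun _ : 'I_1 => p) q.
  by move=> i j; rewrite (ord1 i) (ord1 j) eqxx.
have := avg 1%N (fun=> p) sepp (fun=> pO); rewrite big_ord1.
have Dq0 : 0 < D * q ^- n by rewrite mulr_gt0// invr_gt0 exprn_gt0.
rewrite -mulrA.
clear avg; clearbody I; move: I0 hV; case: I => [r||]// r0.
  rewrite -!EFinM -!EFinD !lee_fin => h1 h2; lra.
by move=> _ _; rewrite [leRHS]gt0_muley ?leey// lte_fin mulr_gt0.
Qed.

End pointwise_bound.

(** * A function orthogonal to all Gaussians vanishes almost everywhere *)

Section orthants.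
Context (R : realType) (n : nat).
Local Notation mu n := (@lebesgue_rV R n).

Lemma measurable_rV_ball (x : 'rV[R]_n) (e : R) : measurable (ball x e).
Proof.
have [e0|e0] := ltP 0 e; last first.
  have -> : (ball x e) = set0.
    by apply/seteqP; split => y // -[]; rewrite ltNge e0.
  exact: measurable0.
have -> : (ball x e) =
   \bigcap_(i : 'I_n) (@rV_coord R n i @^-1` ball (x ord0 i) e).
  apply/seteqP; split => y.
    by move=> [_ h] i _; exact: h.
  by move=> h; split => // i j; rewrite (ord1 i); exact: h.
apply: fin_bigcap_measurable => [|i _]; first exact: finite_finset.
rewrite -[X in measurable X]setTI; apply: measurable_rV_coord => //.
exact: measurable_ball.
Qed.

(** The sigma-algebra is generated by coordinates, so openness enters through countability: an open
    set is the union of the balls with rational centre and radius [1 / (k + 1)] that it contains.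
    Other balls are replaced by the empty set to keep a countable index type. *)
Lemma open_rV_measurable (O : set 'rV[R]_n) : open O -> measurable O.
Proof.
move=> oO.
pose c (p : 'rV[rat]_n * nat) := ball (map_mx ratr p.1 : 'rV[R]_n) p.2.+1%:R^-1.
have -> : O = \bigcup_(p : 'rV[rat]_n * nat) (if `[< c p `<=` O >] then c p else set0).
  apply/seteqP; split => [x Ox|x [p _]]; last by case: asboolP => // h /h.
  have /nbhs_ballP[e /= e0 he] : nbhs x O by exact: open_nbhs_nbhs.
  have [k ke] : exists k : nat, k.+1%:R^-1 < e / 2.
    have /ltr_add_invr[k hk] : 0 < e / 2 by rewrite divr_gt0.
    by exists k; rewrite add0r in hk.
  have /choice[r rP] : forall i, exists r : rat, ball (x ord0 i) k.+1%:R^-1 (ratr r : R).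
    move=> i.
    have k0 : 0 < k.+1%:R^-1 :> R by rewrite invr_gt0.
    have h : x ord0 i - k.+1%:R^-1 < x ord0 i + k.+1%:R^-1.
      by apply: (@lt_trans _ _ (x ord0 i)); rewrite ?ltrBlDr ltrDl.
    have [r] := rat_in_itvoo h; rewrite in_itv /= => rP; exists r.
    by rewrite /ball /= ltr_distlC -[X in _ && X]/(_ < _).
  exists (\row_i r i, k) => //; case: asboolP => [_|[]].
    split => //= i j; rewrite (ord1 i) !mxE; exact/ball_sym.
  move=> y [/= _ hy]; apply: he; split => // i j; rewrite (ord1 i).
  apply: (@le_ball _ _ _ (k.+1%:R^-1 + k.+1%:R^-1)).
    by rewrite [leRHS]splitr; apply: lerD; exact: ltW.
  apply: ball_triangle (rP j) _; have := hy ord0 j; by rewrite !mxE.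
apply: countable_bigcupT_measurable; first exact: countableP.
by move=> p; case: asboolP => // _; exact: measurable_rV_ball.
Qed.

Lemma measurable_translated_diff (e : 'rV[R]_n) :
  measurable_fun setT (fun p : 'rV[R]_n * 'rV[R]_n => p.1 - (p.2 - e)).
Proof.
apply: measurable_fun_rVP => i.
rewrite (_ : _ \o _ = fun p : 'rV[R]_n * 'rV[R]_n =>
    rV_coord i p.1 - (rV_coord i p.2 - e ord0 i)); last first.
  by apply/funext => p; rewrite /rV_coord /= !mxE.
apply: measurable_funB.
  exact: (measurableT_comp (@measurable_rV_coord R n i) measurable_fst).
apply: measurable_funB => //.
exact: (measurableT_comp (@measurable_rV_coord R n i) measurable_snd).
Qed.

Lemma gauss_scale a (l : R) (v : 'rV[R]_n) : gauss a (l *: v) = gauss (a * l ^+ 2) v.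
Proof. by rewrite /gauss dotvZl dotvZr; congr expR; ring. Qed.

(* Convolving the indicator of [A] with a Gaussian and exchanging the integrals
   leaves integrals of [H] against translated Gaussians. *)
Lemma integral_shift_mollified_eq0 (H : 'rV[R]_n -> R) (A : set 'rV[R]_n) (e : 'rV[R]_n) (d : R) :
  (mu n).-integrable setT (EFin \o H) -> measurable A -> 0 < d ->
  (forall M p, 0 < M -> (\int[mu n]_x (H x * gauss M (x - p))%:E = 0)%E) ->
  let J x := fine (\int[mu n]_z (gauss 1 z * \1_A (x + e + d *: z))%:E) in
  [/\ measurable_fun setT J, forall x, 0 <= J x <= Num.sqrt pi ^+ n,
      forall x, (\int[mu n]_z (gauss 1 z * \1_A (x + e + d *: z))%:E = (J x)%:E)%E &
      (\int[mu n]_x (H x * J x)%:E = 0)%E].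
Proof.
move=> iH mA d0 H0 J.
have m1A : measurable_fun setT (\1_A : 'rV[R]_n -> R) by exact: measurable_indic.
have mg x : measurable_fun setT (fun z : 'rV[R]_n => gauss 1 z * \1_A (x + e + d *: z)).
  apply: measurable_funM; first exact: measurable_gauss.
  exact: (measurableT_comp m1A (measurable_rV_affine (x + e) d)).
have A01 x : 0 <= (\1_A x : R) <= 1.
  by rewrite indicE; case: (x \in A); rewrite /= ?lexx ?ler01.
have Jle x : (0 <= \int[mu n]_z (gauss 1 z * \1_A (x + e + d *: z))%:E <= (Num.sqrt pi ^+ n)%:E)%E.
  apply/andP; split.
    by apply: integral_ge0 => z _; rewrite lee_fin mulr_ge0 ?gauss_ge0.
  have <- : (\int[mu n]_z (gauss 1 z)%:E = (Num.sqrt pi ^+ n)%:E)%E.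
    by rewrite ge0_integral_gauss// divr1.
  apply: ge0_le_integral => //.
  - by move=> z _; rewrite lee_fin mulr_ge0 ?gauss_ge0.
  - exact/measurable_EFinP.
  - by apply/measurable_EFinP; exact: measurable_gauss.
  - by move=> z _; rewrite lee_fin ler_piMr ?gauss_ge0.
have JE x : (\int[mu n]_z (gauss 1 z * \1_A (x + e + d *: z))%:E = (J x)%:E)%E.
  rewrite /J fineK// ge0_fin_numE; last by have /andP[] := Jle x.
  by have /andP[_ h] := Jle x; apply: le_lt_trans h _; rewrite ltry.
have J01 x : 0 <= J x <= Num.sqrt pi ^+ n.
  by have := Jle x; rewrite JE !lee_fin.
pose M := d ^- 2; have M0 : 0 < M by rewrite invr_gt0 exprn_gt0.
pose G (p : 'rV[R]_n * 'rV[R]_n) := gauss M (p.1 - (p.2 - e)) * \1_A p.2.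
have mG : measurable_fun setT G.
  apply: measurable_funM.
    exact: (measurableT_comp (measurable_gauss M) (measurable_translated_diff e)).
  exact: measurableT_comp m1A measurable_snd.
have G0 p : 0 <= G p.
  by rewrite /G mulr_ge0 ?gauss_ge0//; have /andP[] := A01 p.2.
have GE x : (\int[mu n]_y (G (x, y))%:E = (d ^+ n * J x)%:E)%E.
  rewrite (@ge0_integral_rV_affine R n (x + e) d)//; last 2 first.
  - apply/measurable_EFinP; exact: (measurableT_comp mG (measurable_pair1 x)).
  - by move=> y; rewrite lee_fin G0.
  rewrite EFinM -JE; congr (_ * _)%E; apply: eq_integral => z _.
  rewrite /G /=; congr (_ * _)%:E.
  have -> : x - (x + e + d *: z - e) = d *: - z.
    by apply/rowP => i; rewrite !mxE; ring.
  by rewrite gauss_scale gaussN /M mulVf// gt_eqF ?exprn_gt0.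
have mJ : measurable_fun setT J.
  have -> : J = (fun x => fine (fubini_F (mu n) (EFin \o G) x) * d ^- n).
    apply/funext => x; rewrite /fubini_F GE /= mulrAC divff ?mul1r//.
    by rewrite gt_eqF ?exprn_gt0.
  apply: measurable_funM => //; apply: measurableT_comp => //.
  apply: measurable_fun_fubini_tonelli_F; first by exact/measurable_EFinP.
  by move=> p; rewrite lee_fin G0.
split => //.
have mH : measurable_fun setT H by apply/measurable_EFinP; exact: measurable_int iH.
pose F p := (H p.1 * G p)%:E.
have mF : measurable_fun setT F.
  apply/measurable_EFinP; apply: measurable_funM => //.
  exact: measurableT_comp mH measurable_fst.
have FE x : (\int[mu n]_y F (x, y) = (d ^+ n)%:E * (H x * J x)%:E)%E.
  rewrite /F /=; under eq_integral do rewrite EFinM.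
  rewrite integralZl//; first by rewrite GE -!EFinM; congr EFin; ring.
  apply/integrableP; split.
    by apply/measurable_EFinP; exact: (measurableT_comp mG (measurable_pair1 x)).
  under eq_integral do rewrite gee0_abs ?lee_fin ?G0//.
  by rewrite GE ltry.
have iF : (mu n \x mu n)%E.-integrable setT F.
  apply/integrable12ltyP => //.
  have iHJ : (mu n).-integrable setT (EFin \o (fun x => H x * (d ^+ n * J x))).
    apply: (integrable_mul_bounded (M := d ^+ n * Num.sqrt pi ^+ n)) => //.
      exact: measurable_funM.
    move=> x; have /andP[j0 j1] := J01 x.
    by rewrite ger0_norm ?mulr_ge0 ?exprn_ge0 ?(ltW d0)// ler_wpM2l ?exprn_ge0 ?(ltW d0).
  have /integrableP[_] := iHJ; congr (_ < _)%E; apply: eq_integral => x _ /=.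
  have -> : (fun y => `|F (x, y)|%E) = (fun y => `|H x|%:E * (G (x, y))%:E)%E.
    by apply/funext => y; rewrite /F /= normrM (ger0_norm (G0 _)) EFinM.
  rewrite ge0_integralZl//; last 2 first.
  - by apply/measurable_EFinP; exact: (measurableT_comp mG (measurable_pair1 x)).
  - by move=> y _; rewrite lee_fin G0.
  have /andP[j0 j1] := J01 x.
  by rewrite GE -EFinM normrM [X in _ * X]ger0_norm// mulr_ge0 ?exprn_ge0 ?(ltW d0).
have := @Fubini _ _ _ _ _ (mu n) (mu n) F iF.
under eq_integral do rewrite FE.
rewrite integralZl//; last first.
  apply: (integrable_mul_bounded (M := Num.sqrt pi ^+ n)) => // x.
  by have /andP[j0 j1] := J01 x; rewrite ger0_norm.
rewrite [X in _ = X -> _](_ : _ = 0%E); last first.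
  apply: integral0_eq => y _.
  rewrite /F /G /= indicE; case: (y \in A); last first.
    by rewrite integral0_eq// => x _; rewrite !mulr0.
  by under eq_integral do rewrite mulr1; exact: H0.
move=> /eqP; rewrite mule_eq0 => /orP[|/eqP//].
by rewrite eqe gt_eqF ?exprn_gt0.
Qed.

(* The shift [1 / k], large compared with the scale [1 / k ^ 2] of the Gaussian,
   makes the mollified indicators of a closed orthant converge at every point,
   including the boundary. *)
Lemma integral_eq0_of_gauss (H : 'rV[R]_n -> R) (A : set 'rV[R]_n) :
  (mu n).-integrable setT (EFin \o H) -> measurable A ->
  (forall M p, 0 < M -> (\int[mu n]_x (H x * gauss M (x - p))%:E = 0)%E) ->
  (forall x z : 'rV[R]_n, \forall k \near \oo,
     A (x + const_mx k.+1%:R^-1 + k.+1%:R^-2 *: z) <-> A x) ->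
  (\int[mu n]_(x in A) (H x)%:E = 0)%E.
Proof.
move=> iH mA H0 Alim.
have mH : measurable_fun setT H by apply/measurable_EFinP; exact: measurable_int iH.
have m1A : measurable_fun setT (\1_A : 'rV[R]_n -> R) by exact: measurable_indic.
pose e k : 'rV[R]_n := const_mx k.+1%:R^-1.
pose d k : R := k.+1%:R^-2.
have d0 k : 0 < d k by rewrite invr_gt0 exprn_gt0.
have hJ k := integral_shift_mollified_eq0 (e k) iH mA (d0 k) H0.
pose J k x := fine (\int[mu n]_z (gauss 1 z * \1_A (x + e k + d k *: z))%:E).
pose c := Num.sqrt pi ^+ n : R.
have c0 : 0 < c by rewrite exprn_gt0// sqrtr_gt0 pi_gt0.
have ind_lim x z : \forall k \near \oo, \1_A (x + e k + d k *: z) = \1_A x :> R.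
  apply: filterS (Alim x z) => k h; rewrite !indicE; congr (_%:R); congr nat_of_bool.
  by apply/idP/idP; rewrite !in_setE => ?; exact/h.
have Jlim x : (J k x)%:E @[k --> \oo] --> (c * \1_A x)%:E.
  have -> : (fun k => (J k x)%:E) =
     (fun k => \int[mu n]_z (gauss 1 z * \1_A (x + e k + d k *: z))%:E)%E.
    by apply/funext => k; have [_ _ -> _] := hJ k.
  have -> : (c * \1_A x)%:E = (\int[mu n]_z (gauss 1 z * \1_A x)%:E)%E.
    under eq_integral do rewrite mulrC EFinM.
    rewrite ge0_integralZl//; last 2 first.
    - by apply/measurable_EFinP; exact: measurable_gauss.
    - by move=> y _; rewrite lee_fin gauss_ge0.
    by rewrite ge0_integral_gauss// divr1 -EFinM mulrC.
  apply: (@dominated_cvg _ _ _ (mu n) setT measurableT _ _ (EFin \o gauss 1)).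
  - move=> k; apply/measurable_EFinP; apply: measurable_funM; first exact: measurable_gauss.
    exact: (measurableT_comp m1A (measurable_rV_affine (x + e k) (d k))).
  - move=> z _; apply: cvg_near_cst.
    by apply: filterS (ind_lim x z) => k ->.
  - by [].
  - exact: integrable_gauss.
  - move=> k z _ /=; rewrite lee_fin ger0_norm ?mulr_ge0 ?gauss_ge0//.
    by rewrite ler_piMr ?gauss_ge0// indicE; case: (_ \in _).
have HJ0 k : (\int[mu n]_x (H x * J k x)%:E = 0)%E by have [] := hJ k.
have lim1 : (\int[mu n]_x (H x * J k x)%:E)%E @[k --> \oo] -->
   (\int[mu n]_x (H x * (c * \1_A x))%:E)%E.
  apply: (@dominated_cvg _ _ _ (mu n) setT measurableT _ _ (fun x => (`|H x| * c)%:E)).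
  - move=> k; apply/measurable_EFinP; apply: measurable_funM => //.
    by have [] := hJ k.
  - move=> x _; under eq_fun do rewrite EFinM.
    rewrite EFinM; apply: cvgeZl => //; exact: Jlim.
  - by [].
  - apply: eq_integrable (integrableZl measurableT c (integrable_abse iH)) => // x _ /=.
    by rewrite mulrC EFinM.
  - move=> k x _ /=; rewrite lee_fin normrM ler_wpM2l//.
    have [_ h _ _] := hJ k; have /andP[j0 j1] := h x.
    by rewrite ger0_norm.
have z0 : (\int[mu n]_x (H x * (c * \1_A x))%:E = 0)%E.
  move: lim1; rewrite (_ : (fun k => _) = (fun=> 0%E)); last first.
    by apply/funext => k; exact: HJ0.
  by move=> h; apply: (cvg_unique _ h); [exact: ereal_hausdorff|exact: cvg_cst].
have E : (\int[mu n]_x (H x * (c * \1_A x))%:E = c%:E * \int[mu n]_(x in A) (H x)%:E)%E.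
  rewrite [in RHS]integral_mkcond -integralZl//; last first.
    apply/(integrable_mkcond _ mA); exact: integrableS iH.
  apply: eq_integral => x _; rewrite /patch indicE; case: ifPn => _.
    by rewrite mulr1 EFinM muleC.
  by rewrite !mulr0 mule0.
by move: z0; rewrite E => /eqP; rewrite mule_eq0 eqe gt_eqF//= => /eqP.
Qed.

Definition orthant (b : 'rV[R]_n) : set 'rV[R]_n := [set v | forall i, b 0 i <= v 0 i].

Lemma measurable_orthant b : measurable (orthant b).
Proof.
have -> : orthant b = \bigcap_(i : 'I_n) (@rV_coord R n i @^-1` `[b 0 i, +oo[%classic).
  apply/seteqP; split => y.
    by move=> h i _; rewrite /= in_itv/= andbT; exact: h.
  by move=> h i; have := h i I; rewrite /= in_itv/= andbT.
apply: fin_bigcap_measurable => [|i _]; first exact: finite_finset.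
rewrite -[X in measurable X]setTI; apply: measurable_rV_coord => //.
Qed.

Lemma orthantI (a b : 'rV[R]_n) :
  orthant a `&` orthant b = orthant (\row_i Num.max (a 0 i) (b 0 i)).
Proof.
apply/seteqP; split => v.
  by move=> [ha hb] i; rewrite mxE ge_max ha hb.
by move=> h; split => i; have := h i; rewrite mxE ge_max => /andP[].
Qed.

(** A coordinate half-space is the countable union of the orthants whose remaining bounds are [- k],
    and half-spaces generate. *)
Lemma measurable_rV_sub_orthant : @measurable _ 'rV[R]_n `<=` <<s range orthant >>.
Proof.
apply: smallest_sub; first exact: smallest_sigma_algebra.
rewrite -bigcup_seq/=; apply: bigcup_sub => i _.
have mi : measurable_fun setT (@rV_coord R n i : g_sigma_algebraType (range orthant) -> R).
  apply: (measurability (@RGenCInfty.G R)); first exact: RGenCInfty.measurableE.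
  move=> _ [_ [r ->] <-]; rewrite setTI.
  have -> : rV_coord i @^-1` `[r, +oo[ =
     \bigcup_k orthant (\row_j if j == i then r else - k%:R).
    apply/seteqP; split => [v|v [k _ /(_ i)]]; last by rewrite mxE eqxx /= in_itv/= andbT.
    rewrite /= in_itv/= andbT => rv.
    exists (Num.truncn (\sum_j `|v ord0 j|)).+1 => // j; rewrite mxE; case: eqP => [->//|_].
    rewrite lerNl; apply: (@le_trans _ _ `|v ord0 j|); first by rewrite -normrN ler_norm.
    apply: le_trans (ltW (truncnS_gt _)).
    by rewrite (bigD1 j)//= lerDl sumr_ge0.
  apply: bigcupT_measurable => k; apply: sub_sigma_algebra; by eexists.
by move=> B [C mC <-]; exact: mi.
Qed.

(** The integral of [H] vanishes on every orthant. Orthants are closed under intersection and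
    generate, so by Dynkin's theorem it vanishes on every measurable set. *)
Lemma ae_eq0_of_gauss (H : 'rV[R]_n -> R) :
  (mu n).-integrable setT (EFin \o H) ->
  (forall M p, 0 < M -> (\int[mu n]_x (H x * gauss M (x - p))%:E = 0)%E) ->
  ae_eq (mu n) setT (EFin \o H) (cst 0%E).
Proof.
move=> iH H0.
have orth b : (\int[mu n]_(x in orthant b) (H x)%:E = 0)%E.
  apply: integral_eq0_of_gauss => //; first exact: measurable_orthant.
  have tP k : [/\ 0 < k.+1%:R^-1 :> R, k.+1%:R^-1 <= 1 :> R & k.+1%:R^-1 * k.+1%:R = 1 :> R].
    by rewrite invr_gt0 ltr0n mulVf ?pnatr_eq0// invf_le1 ?ltr0n// ler1n.
  (* The shift points into the orthant and eventually outweighs [z / (k + 1)^2], so points of the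
     orthant, boundary included, stay in it. A point outside misses some bound strictly, and the
     perturbation tends to 0. *)
  move=> x z; have [xb|/existsNP[i /negP]] := pselect (orthant b x).
    have : \forall k \near \oo, \sum_j `|z ord0 j| < k%:R by exact: nbhs_infty_gtr.
    apply: filterS => k zk; split => // _ i; rewrite !mxE.
    rewrite -addrA (le_trans (xb i))// lerDl.
    have [t0 _ tT] := tP k; rewrite -exprVn; move: tT t0; set t := _^-1 => tT t0.
    have zT : - z 0 i <= k.+1%:R.
      apply: (@le_trans _ _ (\sum_j `|z ord0 j|)).
        rewrite (bigD1 i)//=; apply: (@le_trans _ _ `|z ord0 i|).
          by rewrite -normrN ler_norm.
        by rewrite lerDl sumr_ge0.
      by apply: le_trans (ltW zk) _; rewrite ler_nat.
    have -> : t + t ^+ 2 * z 0 i = t ^+ 2 * (k.+1%:R + z 0 i).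
      by rewrite mulrDr expr2 -[X in _ = X + _]mulrA tT mulr1.
    by rewrite mulr_ge0 ?sqr_ge0// -lerBlDr sub0r.
  rewrite -ltNge => xb.
  have : \forall k \near \oo, (1 + `|z 0 i|) / (b 0 i - x 0 i) < k%:R by exact: nbhs_infty_gtr.
  apply: filterS => k zk; split => h; last by have := h i; rewrite leNgt xb.
  exfalso; have := h i; rewrite !mxE leNgt => /negP; apply.
  have [t0 t1 tT] := tP k; rewrite -exprVn; move: tT t0 t1; set t := _^-1 => tT t0 t1.
  rewrite -addrA -ltrBrDl.
  apply: (@le_lt_trans _ _ (t * (1 + `|z 0 i|))).
    rewrite mulrDr mulr1 lerD2l expr2 -mulrA ler_wpM2l ?(ltW t0)//.
    apply: (@le_trans _ _ (t * `|z 0 i|)); first by rewrite ler_wpM2l ?(ltW t0)// ler_norm.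
    by rewrite ler_piMl.
  have bx : 0 < b 0 i - x 0 i by rewrite subr_gt0.
  rewrite -[ltRHS]mul1r -[X in _ < X * _]tT -mulrA ltr_pM2l//.
  rewrite -ltr_pdivrMr//; apply: (lt_trans zk); by rewrite ltr_nat.
(* Needed for complements in the Dynkin system; the whole space trivially satisfies the limit
   condition. *)
have HT : (\int[mu n]_x (H x)%:E = 0)%E.
  by apply: integral_eq0_of_gauss => // x z; apply: nearW.
pose D := [set B : set 'rV[R]_n | measurable B /\ (\int[mu n]_(x in B) (H x)%:E = 0)%E].
have dD : dynkin D.
  split => //.
  - move=> B [mB hB]; split; first exact: measurableC.
    move: HT; rewrite -(setUCr B) integral_setU//.
    + by rewrite hB add0e.
    + exact: measurableC.
    + by rewrite setUCr; exact: measurable_int iH.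
    + by apply/disj_setPS; rewrite setICr.
  - move=> F tF FD; split; first by apply: bigcupT_measurable => k; have [] := FD k.
    rewrite integral_bigcup//.
    + by apply: eseries0 => k _ _; have [] := FD k.
    + by move=> k; have [] := FD k.
    + apply: integrableS iH => //; by apply: bigcupT_measurable => k; have [] := FD k.
have mD : @measurable _ 'rV[R]_n `<=` D.
  apply: subset_trans measurable_rV_sub_orthant _.
  rewrite -setI_closed_g_dynkin_g_sigma_algebra; last first.
    by move=> _ _ [a _ <-] [b _ <-]; rewrite orthantI; eexists.
  apply: smallest_sub => // _ [b _ <-]; split => //; exact: measurable_orthant.
apply: integral_ae_eq => // B _ mB.
rewrite integral0; exact: (mD B mB).2.
Qed.

End orthants.

(** * The profile of the kernel as a cosine transform *)

Section schwartz_gauss.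
Context (R : realType) (n : nat).

(** Reduces directional derivatives to one real variable, where the chain rule [is_derive1_comp] can
    be used. *)
Lemma is_derive_line (f : 'rV[R]_n -> R) (x v : 'rV[R]_n) (df : R) :
  is_derive (0 : R) (1 : R) (fun h => f (h *: v + x)) df -> is_derive x v f df.
Proof.
move=> [d1 d2]; split; first exact/derivable1P.
rewrite -d2 /derive; set g1 := (fun h => h^-1 *: _); set g2 := (fun h => h^-1 *: _).
suff -> : g1 = g2 by [].
by apply/funext => h; rewrite /g1 /g2 /= addr0 scale0r add0r [_%:A]mulr1.
Qed.

Lemma is_derive_coord (x v : 'rV[R]_n) i : is_derive x v (fun x : 'rV[R]_n => x 0 i) (v 0 i).
Proof.
apply: is_derive_line.
have -> : (fun h : R => (h *: v + x) 0 i) = (v 0 i \*: (@idfun R)) + cst (x 0 i).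
  by apply/funext => h; rewrite !mxE [in RHS]/GRing.add /= [v 0 i *: _]mulrC.
by apply: is_derive_eq; rewrite /GRing.scale /= mulr1 addr0.
Qed.

Lemma differentiable_dotv (x y : 'rV[R]_n) : differentiable (fun x => dotv x y) x.
Proof.
have -> : (fun x => dotv x y) = \sum_i (y 0 i \*: (fun x : 'rV[R]_n => x 0 i)).
  by apply/funext => z; rewrite fct_sumE; apply: eq_bigr => i _; rewrite mulrC.
by apply: differentiable_sum => i; apply: differentiableZ; exact: differentiable_coord.
Qed.

Lemma differentiable_dotvv (x : 'rV[R]_n) : differentiable (fun x : 'rV[R]_n => dotv x x) x.
Proof.
have -> : (fun x : 'rV[R]_n => dotv x x) = \sum_i ((fun x : 'rV[R]_n => x 0 i) * (fun x : 'rV[R]_n => x 0 i)).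
  by apply/funext => z; rewrite fct_sumE; apply: eq_bigr.
by apply: differentiable_sum => i; apply: differentiableM; exact: differentiable_coord.
Qed.

Lemma differentiable_gauss a (x : 'rV[R]_n) : differentiable (@gauss R n a) x.
Proof.
apply: (@differentiable_comp _ _ _ _ (fun x : 'rV[R]_n => - (a * dotv x x)) expR).
  have -> : (fun x : 'rV[R]_n => - (a * dotv x x)) = - (a \*: (fun x : 'rV[R]_n => dotv x x)) by [].
  by apply: differentiableN; apply: differentiableZ; exact: differentiable_dotvv.
by apply/derivable1_diffP; have [] := @is_derive_expR R (- (a * dotv x x)).
Qed.

Lemma is_derive_gauss a (x v : 'rV[R]_n) :
  is_derive x v (@gauss R n a) (- (2 * a * dotv v x) * gauss a x).
Proof.
apply: is_derive_line.
rewrite mulrC.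
have -> : gauss a x = expR (- (a * dotv (0 *: v + x) (0 *: v + x))).
  by rewrite scale0r add0r.
apply: (@is_derive1_comp _ expR (fun h : R => - (a * dotv (h *: v + x) (h *: v + x)))).
have -> : (fun h : R => - (a * dotv (h *: v + x) (h *: v + x))) =
   - (a * dotv v v) \*: ((@idfun R) ^+ 2) + - (2 * a * dotv v x) \*: (@idfun R) + cst (- (a * dotv x x)).
  apply/funext => h; rewrite dotvDl !dotvDr !dotvZl !dotvZr (dotvC x v).
  transitivity (- (a * dotv v v) * (h * h) + - (2 * a * dotv v x) * h + - (a * dotv x x)); last by [].
  ring.
apply: is_derive_eq; rewrite /= expr1 /GRing.scale /=; ring.
Qed.

Lemma is_derive_trig_dotv (f g : R -> R) (x v y : 'rV[R]_n) :
  (forall t : R, is_derive t (1 : R) f (g t)) ->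
  is_derive x v (fun x => f (dotv x y)) (dotv v y * g (dotv x y)).
Proof.
move=> fg; apply: is_derive_line; rewrite mulrC.
have -> : g (dotv x y) = g (dotv (0 *: v + x) y) by rewrite scale0r add0r.
apply: (@is_derive1_comp _ f (fun h : R => dotv (h *: v + x) y)).
have -> : (fun h : R => dotv (h *: v + x) y) = (dotv v y \*: (@idfun R)) + cst (dotv x y).
  by apply/funext => h; rewrite dotvDl dotvZl [in RHS]/GRing.add /= [dotv v y *: _]mulrC.
by apply: is_derive_eq; rewrite /GRing.scale /= mulr1 addr0.
Qed.

(* Stable under partial derivatives, which is why coordinates are included. *)
Inductive gauss_poly (a : R) (y : 'rV[R]_n) : ('rV[R]_n -> R) -> Prop :=
| GaussCos : gauss_poly a y (fun x => gauss a x * cos (dotv x y))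
| GaussSin : gauss_poly a y (fun x => gauss a x * sin (dotv x y))
| GaussAdd f g : gauss_poly a y f -> gauss_poly a y g -> gauss_poly a y (f + g)
| GaussScale c f : gauss_poly a y f -> gauss_poly a y (c \*: f)
| GaussCoord i f : gauss_poly a y f -> gauss_poly a y ((fun x : 'rV[R]_n => x 0 i) * f).

Lemma gauss_poly_differentiable a y f : gauss_poly a y f -> forall x, differentiable f x.
Proof.
elim=> [x|x|f1 f2 _ h1 _ h2 x|c f1 _ h1 x|i f1 _ h1 x].
- apply: differentiableM; first exact: differentiable_gauss.
  apply: (@differentiable_comp _ _ _ _ (fun x => dotv x y) (@cos R)).
    exact: differentiable_dotv.
  by apply/derivable1_diffP; exact: derivable_cos.
- apply: differentiableM; first exact: differentiable_gauss.
  apply: (@differentiable_comp _ _ _ _ (fun x => dotv x y) (@sin R)).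
    exact: differentiable_dotv.
  by apply/derivable1_diffP; exact: derivable_sin.
- by apply: differentiableD.
- by apply: differentiableZ.
- by apply: differentiableM => //; exact: differentiable_coord.
Qed.

Lemma dotv_delta i (x : 'rV[R]_n) : dotv (delta_mx 0 i) x = x 0 i.
Proof.
rewrite /dotv (bigD1 i)//= big1 ?addr0 => [|j ji]; first by rewrite mxE !eqxx mul1r.
by rewrite mxE eqxx (negbTE ji) mul0r.
Qed.

Lemma gauss_poly_partial a y f : gauss_poly a y f -> forall j,
  gauss_poly a y (fun x => 'D_(delta_mx 0 j) f x).
Proof.
elim=> [j|j|f1 f2 h1 g1 h2 g2 j|c f1 h1 g1 j|i f1 h1 g1 j].
- have -> : (fun x => 'D_(delta_mx 0 j) (fun x => gauss a x * cos (dotv x y)) x) =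
     (- (2 * a)) \*: ((fun x : 'rV[R]_n => x 0 j) * (fun x => gauss a x * cos (dotv x y))) +
     (- y 0 j) \*: (fun x => gauss a x * sin (dotv x y)).
    apply/funext => x.
    have h := @is_deriveM _ _ _ _ _ _ _ _ (is_derive_gauss a x (delta_mx 0 j))
      (is_derive_trig_dotv x (delta_mx 0 j) y (@is_derive_cos R)).
    rewrite [LHS](@derive_val _ _ _ _ _ _ _ h) !dotv_delta.
    transitivity (- (2 * a) * (x 0 j * (gauss a x * cos (dotv x y))) +
      - y 0 j * (gauss a x * sin (dotv x y))); last by [].
    rewrite /GRing.scale /=; ring.
  by apply: GaussAdd; apply: GaussScale; [apply: GaussCoord; exact: GaussCos|exact: GaussSin].
- have -> : (fun x => 'D_(delta_mx 0 j) (fun x => gauss a x * sin (dotv x y)) x) =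
     (- (2 * a)) \*: ((fun x : 'rV[R]_n => x 0 j) * (fun x => gauss a x * sin (dotv x y))) +
     (y 0 j) \*: (fun x => gauss a x * cos (dotv x y)).
    apply/funext => x.
    have h := @is_deriveM _ _ _ _ _ _ _ _ (is_derive_gauss a x (delta_mx 0 j))
      (is_derive_trig_dotv x (delta_mx 0 j) y (@is_derive_sin R)).
    rewrite [LHS](@derive_val _ _ _ _ _ _ _ h) !dotv_delta.
    transitivity (- (2 * a) * (x 0 j * (gauss a x * sin (dotv x y))) +
      y 0 j * (gauss a x * cos (dotv x y))); last by [].
    rewrite /GRing.scale /=; ring.
  by apply: GaussAdd; apply: GaussScale; [apply: GaussCoord; exact: GaussSin|exact: GaussCos].
- have -> : (fun x => 'D_(delta_mx 0 j) (f1 + f2) x) =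
     (fun x => 'D_(delta_mx 0 j) f1 x) + (fun x => 'D_(delta_mx 0 j) f2 x).
    by apply/funext => x; rewrite deriveD//; apply: diff_derivable; [exact: (gauss_poly_differentiable h1)|exact: (gauss_poly_differentiable h2)].
  exact: GaussAdd.
- have -> : (fun x => 'D_(delta_mx 0 j) (c \*: f1) x) =
     c \*: (fun x => 'D_(delta_mx 0 j) f1 x).
    by apply/funext => x; rewrite deriveZ//; apply: diff_derivable; exact: (gauss_poly_differentiable h1).
  exact: GaussScale.
- have -> : (fun x => 'D_(delta_mx 0 j) ((fun x : 'rV[R]_n => x 0 i) * f1) x) =
     (fun x : 'rV[R]_n => x 0 i) * (fun x => 'D_(delta_mx 0 j) f1 x) + ((delta_mx 0 j : 'rV[R]_n) 0 i) \*: f1.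
    apply/funext => x; rewrite deriveM//.
    + by rewrite [X in _ + _ *: X](@derive_val _ _ _ _ _ _ _ (is_derive_coord x (delta_mx 0 j) i)) [X in _ + X]mulrC.
    + by have [] := is_derive_coord x (delta_mx 0 j) i.
    + by apply: diff_derivable; exact: (gauss_poly_differentiable h1).
  by apply: GaussAdd; [exact: GaussCoord|exact: GaussScale].
Qed.

(** Raise [t / k <= exp (t / k)] to the power [k]. *)
Lemma expr_le_expR (k : nat) : exists2 C : R, 0 < C & forall t, 0 <= t -> t ^+ k <= C * expR t.
Proof.
case: k => [|k].
  by exists 1 => // t t0; rewrite expr0 mul1r -[leLHS]expR0 ler_expR.
exists (k.+1%:R ^+ k.+1); first by rewrite exprn_gt0.
move=> t t0; have k0 : 0 < k.+1%:R :> R by [].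
have -> : expR t = expR (t / k.+1%:R) ^+ k.+1.
  by rewrite -expRM_natr divfK// gt_eqF.
rewrite -exprMn lerXn2r ?nnegrE ?mulr_ge0 ?expR_ge0//.
rewrite mulrC -ler_pdivrMr//; apply: le_trans (expR_ge1Dx _).
by rewrite lerDr.
Qed.

(** The power [k] is quantified after the induction on [f] because a coordinate factor is absorbed
    by passing from [k] to [k + 1]. *)
Lemma gauss_poly_bound a y f : 0 < a -> gauss_poly a y f -> forall k : nat, exists M : R,
  forall x, enorm x ^+ k * `|f x| <= M.
Proof.
move=> a0; have base (h : R -> R) k : (forall t, `|h t| <= 1) ->
  exists M : R, forall x : 'rV[R]_n, enorm x ^+ k * `|gauss a x * h (dotv x y)| <= M.
  move=> h1; have [C C0 HC] := expr_le_expR k.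
  exists (1 + C / a ^+ k) => x; rewrite normrM mulrA.
  apply: (@le_trans _ _ (enorm x ^+ k * gauss a x)).
    by rewrite (ger0_norm (gauss_ge0 _ _)) ler_piMr// mulr_ge0 ?gauss_ge0 ?exprn_ge0 ?enorm_ge0.
  have e1 : enorm x ^+ k <= 1 + dotv x x ^+ k.
    rewrite -enorm_sqr -exprM mulnC exprM; set e := enorm x ^+ k.
    have := sqr_ge0 (e - 1); have := sqr_ge0 e; nra.
  apply: (le_trans (ler_wpM2r (gauss_ge0 _ _) e1)).
  rewrite mulrDl mul1r lerD//.
    by rewrite /gauss -[leRHS]expR0 ler_expR oppr_le0 mulr_ge0 ?dotvv_ge0 ?ltW.
  rewrite ler_pdivlMr ?exprn_gt0// mulrAC -exprMn -ler_pdivlMr ?gauss_gt0//.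
  rewrite /gauss -expRN opprK (mulrC a); apply: HC; by rewrite mulr_ge0 ?dotvv_ge0 ?ltW.
elim=> [k|k|f1 f2 _ h1 _ h2 k|c f1 _ h1 k|i f1 _ h1 k].
- by apply: (base (@cos R)); exact: norm_cos_le1.
- by apply: (base (@sin R)); exact: norm_sin_le1.
- have [M1 H1] := h1 k; have [M2 H2] := h2 k; exists (M1 + M2) => x.
  apply: le_trans (lerD (H1 x) (H2 x)); rewrite -mulrDr ler_wpM2l ?exprn_ge0 ?enorm_ge0//.
  exact: ler_normD.
- have [M1 H1] := h1 k; exists (`|c| * M1) => x.
  by rewrite /= normrM mulrCA ler_wpM2l.
- have [M1 H1] := h1 k.+1; exists M1 => x; apply: le_trans (H1 x).
  rewrite normrM mulrA exprSr ler_wpM2r// ler_wpM2l ?exprn_ge0 ?enorm_ge0//.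
  rewrite -sqrtr_sqr /enorm ler_wsqrtr// /dotv (bigD1 i)//= -expr2 lerDl.
  by apply: sumr_ge0 => j _; rewrite -expr2 sqr_ge0.
Qed.

Lemma gauss_poly_iter_partial a y f s : gauss_poly a y f -> gauss_poly a y (iter_partial s f).
Proof. by move=> h; elim: s => //= i s IH; exact: gauss_poly_partial. Qed.

Lemma schwartz_gauss_poly a y f : 0 < a -> gauss_poly a y f -> schwartz f.
Proof.
move=> a0 h; split => [s x|s k].
  by apply: (@gauss_poly_differentiable a y); exact: gauss_poly_iter_partial.
by apply: (@gauss_poly_bound a y) => //; exact: gauss_poly_iter_partial.
Qed.

End schwartz_gauss.

(** * Identification of the profile by Gaussian tests *)

Section profile.
Context (R : realType) (n : nat).
Local Notation mu := (@lebesgue_rV R n).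

Lemma integral_rV_translate (F : 'rV[R]_n -> \bar R) (a : 'rV[R]_n) :
  measurable_fun setT F -> (\int[mu]_x F x = \int[mu]_x F (x + a)%R)%E.
Proof.
move=> mF.
have tr (G : 'rV[R]_n -> \bar R) : measurable_fun setT G -> (forall x, 0 <= G x)%E ->
    (\int[mu]_x G x = \int[mu]_x G (x + a)%R)%E.
  move=> mG G0; rewrite (@ge0_integral_rV_affine R n a 1)// expr1n mul1e.
  by apply: eq_integral => x _; rewrite scale1r addrC.
rewrite integralE [RHS]integralE; congr (_ - _)%E.
  rewrite (tr _ (measurable_funepos mF)) => [|x]; last exact: funepos_ge0.
  by apply: eq_integral => x _; rewrite !funeposE.
rewrite (tr _ (measurable_funeneg mF)) => [|x]; last exact: funeneg_ge0.
by apply: eq_integral => x _; rewrite !funenegE.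
Qed.

(** Completing the square. *)
Lemma gauss_mul b M (x p : 'rV[R]_n) : 0 < b + M ->
  gauss b x * gauss M (x - p) =
  gauss (b + M) (x - (M / (b + M)) *: p) * expR (- (b * M / (b + M) * dotv p p)).
Proof.
move=> bM; rewrite /gauss -!expRD; congr expR.
rewrite !dotvBl !dotvBr !dotvZl !dotvZr (dotvC p x).
by field; rewrite gt_eqF.
Qed.

Let c0 : R := (2 * pi) `^ (- (n%:R / 2)).

(** The masses of a Gaussian and of its transform multiply to [(2 pi)^n]: this is Fourier inversion
    for Gaussians. *)
Lemma fourier_const a : 0 < a ->
  c0 ^+ 2 * Num.sqrt (pi / a) ^+ n * Num.sqrt (pi / (4 * a)^-1) ^+ n = 1.
Proof.
move=> a0; have p0 := pi_gt0 R.
rewrite -mulrA -exprMn -sqrtrM ?divr_ge0 ?(ltW p0) ?(ltW a0)//.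
have -> : pi / a * (pi / (4 * a)^-1) = (2 * pi) ^+ 2 :> R by field; rewrite gt_eqF.
rewrite sqrtr_sqr ger0_norm ?mulr_ge0 ?(ltW p0)//.
rewrite /c0 -powR_mulrn ?powR_ge0// -powRrM -powR_mulrn ?mulr_ge0 ?(ltW p0)//.
rewrite -powRD; last by rewrite (gt_eqF (mulr_gt0 _ p0)) ?implybT.
by rewrite (_ : _ + _ = 0) ?powRr0//; field.
Qed.

Lemma fourier_re_gauss_cos a (x y : 'rV[R]_n) : 0 < a ->
  fourier_re (fun x => gauss a x * cos (dotv x y)) x =
  c0 * (Num.sqrt (pi / a) ^+ n * 2^-1 * (gauss (4 * a)^-1 (x - y) + gauss (4 * a)^-1 (x + y))).
Proof.
move=> a0; rewrite /fourier_re; congr (_ * _).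
transitivity (\int[mu]_xi (2^-1 * (gauss a xi * cos (dotv xi (x - y)) + gauss a xi * cos (dotv xi (x + y))))).
  congr fine; apply: eq_integral => xi _; congr EFin.
  rewrite dotvBr dotvDr cosB cosD; by field.
rewrite RintegralZl//; last first.
  exact: (integrableD measurableT (integrable_gauss_cos _ a0) (integrable_gauss_cos _ a0)).
rewrite RintegralD//; [|exact: integrable_gauss_cos..].
rewrite !(gauss_rV_fourier _ a0).1; ring.
Qed.

Lemma fourier_im_gauss_sin a (x y : 'rV[R]_n) : 0 < a ->
  fourier_im (fun x => gauss a x * sin (dotv x y)) x =
  - (c0 * (Num.sqrt (pi / a) ^+ n * 2^-1 * (gauss (4 * a)^-1 (x - y) - gauss (4 * a)^-1 (x + y)))).
Proof.
move=> a0; rewrite /fourier_im; congr (- (_ * _)).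
transitivity (\int[mu]_xi (2^-1 * (gauss a xi * cos (dotv xi (x - y)) - gauss a xi * cos (dotv xi (x + y))))).
  congr fine; apply: eq_integral => xi _; congr EFin.
  rewrite dotvBr dotvDr cosB cosD; by field.
rewrite RintegralZl//; last first.
  exact: (integrableB measurableT (integrable_gauss_cos _ a0) (integrable_gauss_cos _ a0)).
rewrite RintegralB//; [|exact: integrable_gauss_cos..].
rewrite !(gauss_rV_fourier _ a0).1; ring.
Qed.

(** The cosine test produces the sum of the Gaussians centred at [y] and [- y], the sine test their
    difference. Since the imaginary pairing vanishes, combining the two isolates the Gaussian at
    [y]. *)
Lemma fourier_gauss_test (f w : 'rV[R]_n -> R) a (y : 'rV[R]_n) : 0 < a ->
  is_fourier_transform f w ->
  mu.-integrable setT (fun x => (f x * gauss (4 * a)^-1 (x - y))%:E) /\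
  c0 * Num.sqrt (pi / a) ^+ n * \int[mu]_x (f x * gauss (4 * a)^-1 (x - y)) =
  \int[mu]_x (w x * (gauss a x * cos (dotv x y))).
Proof.
move=> a0 [mf mw FT].
have [i1 _ _ e1 _] := FT _ (schwartz_gauss_poly a0 (GaussCos a y)).
have [_ i2 _ _ e2] := FT _ (schwartz_gauss_poly a0 (GaussSin a y)).
pose A := c0 * Num.sqrt (pi / a) ^+ n.
have A0 : 0 < A.
  rewrite mulr_gt0 ?powR_gt0 ?mulr_gt0 ?pi_gt0// exprn_gt0// sqrtr_gt0.
  by rewrite divr_gt0// pi_gt0.
have E x : A * (f x * gauss (4 * a)^-1 (x - y)) =
   f x * fourier_re (fun x => gauss a x * cos (dotv x y)) x -
   f x * fourier_im (fun x => gauss a x * sin (dotv x y)) x.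
  rewrite fourier_re_gauss_cos// fourier_im_gauss_sin// /A; by field.
have iA : mu.-integrable setT (fun x => (A * (f x * gauss (4 * a)^-1 (x - y)))%:E).
  by apply: eq_integrable (integrableB measurableT i1 i2) => // x _; rewrite -EFinB E.
have iF : mu.-integrable setT (fun x => (f x * gauss (4 * a)^-1 (x - y))%:E).
  by apply: eq_integrable (integrableZl measurableT A^-1 iA) => // x _; rewrite -EFinM mulKf// gt_eqF.
split => //.
rewrite -RintegralZl// e1 -[RHS]subr0 [X in _ = _ - X]e2 -RintegralB//.
congr fine; apply: eq_integral => x _; congr EFin; exact: E.
Qed.

Lemma integral_gauss_cos_translate b (xi y : 'rV[R]_n) : 0 < b ->
  \int[mu]_x (gauss b (x - y) * cos (dotv xi x)) =
  Num.sqrt (pi / b) ^+ n * gauss (4 * b)^-1 xi * cos (dotv xi y).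
Proof.
move=> b0; rewrite /Rintegral (integral_rV_translate y); last first.
  apply/measurable_EFinP; apply: measurable_funM.
    have := measurableT_comp (measurable_gauss b) (measurable_rV_affine (- y) 1).
    by move=> h; move: h; congr measurable_fun; apply/funext => x /=; rewrite scale1r addrC.
  by under eq_fun do rewrite dotvC; exact: measurable_cos_dotv.
transitivity (\int[mu]_x (cos (dotv xi y) * (gauss b x * cos (dotv x xi)) -
    sin (dotv xi y) * (gauss b x * sin (dotv x xi)))).
  congr fine; apply: eq_integral => x _; congr EFin.
  rewrite addrK dotvDr cosD (dotvC xi x); ring.
have [e1 e2] := gauss_rV_fourier xi b0.
rewrite RintegralB//; last 2 first.
- exact: (integrableZl measurableT _ (integrable_gauss_cos _ b0)).
- exact: (integrableZl measurableT _ (integrable_gauss_sin _ b0)).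
rewrite !RintegralZl//; last 2 first.
- exact: integrable_gauss_sin.
- exact: integrable_gauss_cos.
rewrite e1 e2; ring.
Qed.

Lemma measurable_gauss_translate b (y : 'rV[R]_n) :
  measurable_fun setT (fun x : 'rV[R]_n => gauss b (x - y)).
Proof.
have := measurableT_comp (measurable_gauss b) (measurable_rV_affine (- y) 1).
by move=> h; move: h; congr measurable_fun; apply/funext => x /=; rewrite scale1r addrC.
Qed.

Lemma integrable_gauss_translate b (y : 'rV[R]_n) : 0 < b ->
  mu.-integrable setT (fun x => (gauss b (x - y))%:E).
Proof.
move=> b0; have mg := measurable_gauss_translate b y.
apply/integrableP; split; first exact/measurable_EFinP.
under eq_integral do rewrite gee0_abs ?lee_fin ?gauss_ge0//.
rewrite (integral_rV_translate y); last exact/measurable_EFinP.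
by under eq_integral do rewrite addrK; rewrite ge0_integral_gauss// ltry.
Qed.

(** Fubini, justified by integrability of [w] and of the Gaussian. With [a = 1 / (4 b)] the right
    side is the one of [fourier_gauss_test], so the profile and the kernel can be compared. *)
Lemma kern_gauss_test (w : 'rV[R]_n -> R) b (y : 'rV[R]_n) : 0 < b ->
  mu.-integrable setT (EFin \o w) ->
  mu.-integrable setT (fun x => (kern w x * gauss b (x - y))%:E) /\
  \int[mu]_x (kern w x * gauss b (x - y)) =
  Num.sqrt (pi / b) ^+ n * \int[mu]_x (w x * (gauss (4 * b)^-1 x * cos (dotv x y))).
Proof.
move=> b0 iw.
have mw : measurable_fun setT w by apply/measurable_EFinP; exact: measurable_int iw.
have mG := measurable_gauss_translate b y.
have ig := integrable_gauss_translate y b0.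
have mw2 : measurable_fun setT (fun p : 'rV[R]_n * 'rV[R]_n => w p.2).
  exact: measurableT_comp mw measurable_snd.
have mG1 : measurable_fun setT (fun p : 'rV[R]_n * 'rV[R]_n => gauss b (p.1 - y)).
  exact: (measurableT_comp mG measurable_fst).
have mcos : measurable_fun setT (fun p : 'rV[R]_n * 'rV[R]_n => cos (dotv p.2 p.1)).
  apply: (measurableT_comp (continuous_measurable_fun (@continuous_cos R))).
  apply: measurable_sum => i; apply: measurable_funM.
    exact: (measurableT_comp (@measurable_rV_coord R n i) measurable_snd).
  exact: (measurableT_comp (@measurable_rV_coord R n i) measurable_fst).
pose F0 (p : 'rV[R]_n * 'rV[R]_n) := w p.2 * gauss b (p.1 - y).
have iF0 : (mu \x mu)%E.-integrable setT (EFin \o F0).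
  apply/integrable12ltyP; first by apply/measurable_EFinP; exact: measurable_funM.
  have [r rE] : exists r : R, (\int[mu]_x `|(w x)%:E| = r%:E)%E.
    have /fineK : (\int[mu]_x `|(w x)%:E|)%E \is a fin_num.
      apply: integrable_fin_num => //; exact: (integrable_abse iw).
    by move=> <-; eexists.
  have -> : (\int[mu]_x \int[mu]_y0 `|(EFin \o F0) (x, y0)| =
     \int[mu]_x (r%:E * (gauss b (x - y))%:E))%E.
    apply: eq_integral => x _; rewrite -rE muleC -ge0_integralZl//; last 2 first.
    - by apply: measurableT_comp => //; exact/measurable_EFinP.
    - by rewrite lee_fin gauss_ge0.
    apply: eq_integral => xi _.
    by rewrite /F0 /= normrM (ger0_norm (gauss_ge0 _ _)) EFinM muleC.
  have := integrableZl measurableT r ig.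
  have r0 : 0 <= r by rewrite -lee_fin -rE; apply: integral_ge0.
  move=> /integrableP[_]; congr (_ < _)%E; apply: eq_integral => x _.
  by rewrite gee0_abs// -EFinM lee_fin mulr_ge0 ?gauss_ge0.
pose F (p : 'rV[R]_n * 'rV[R]_n) := (F0 p * cos (dotv p.2 p.1))%:E.
have iF : (mu \x mu)%E.-integrable setT F.
  apply: (integrable_mul_bounded iF0 mcos (M := 1)) => p; exact: norm_cos_le1.
have FE x : (\int[mu]_xi F (x, xi) = (kern w x * gauss b (x - y))%:E)%E.
  have ic := integrable_cos x iw.
  rewrite /kern /Rintegral EFinM fineK; last exact: integrable_fin_num.
  rewrite muleC -integralZl//; apply: eq_integral => xi _.
  by rewrite /F /F0 /= -EFinM; congr EFin; ring.
have ic xi : mu.-integrable setT (fun x => (gauss b (x - y) * cos (dotv xi x))%:E).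
  apply: (integrable_mul_bounded ig (M := 1)) => [|x]; last exact: norm_cos_le1.
  by under eq_fun do rewrite dotvC; exact: measurable_cos_dotv.
have FE2 xi : (\int[mu]_x F (x, xi) =
    (Num.sqrt (pi / b) ^+ n * (w xi * (gauss (4 * b)^-1 xi * cos (dotv xi y))))%:E)%E.
  transitivity ((w xi)%:E * \int[mu]_x (gauss b (x - y) * cos (dotv xi x))%:E)%E.
    rewrite -integralZl//; apply: eq_integral => x _.
    by rewrite /F /F0 /= -EFinM; congr EFin; ring.
  rewrite -[X in (_ * X)%E]fineK; last exact: integrable_fin_num.
  have := integral_gauss_cos_translate xi y b0; rewrite /Rintegral => ->.
  by rewrite -EFinM; congr EFin; ring.
have h := @Fubini _ _ _ _ _ mu mu F iF.
have iK : mu.-integrable setT (fun x => (kern w x * gauss b (x - y))%:E).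
  by apply: eq_integrable (integrable_fubini_F iF) => // x _; rewrite /fubini_F FE.
split => //.
rewrite -RintegralZl//; last first.
  apply: (integrable_mul_bounded iw (M := 1)) => [|x].
    by apply: measurable_funM; [exact: measurable_gauss|exact: measurable_cos_dotv].
  rewrite normrM (ger0_norm (gauss_ge0 _ _)) mulr_ile1 ?gauss_ge0 ?norm_cos_le1//.
  by rewrite /gauss -[leRHS]expR0 ler_expR oppr_le0 mulr_ge0 ?dotvv_ge0// invr_ge0 mulr_ge0 ?ltW.
rewrite /Rintegral; congr fine.
under eq_integral do rewrite -FE.
by rewrite h; apply: eq_integral => xi _; exact: FE2.
Qed.

(** The difference of the two sides is orthogonal to all translated Gaussians but is not known to be
    integrable. Multiplying it by [gauss 1] makes it so, and by [gauss_mul] the orthogonality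
    survives. *)
Lemma fourier_profile_ae (m c1 c2 : R) (f w : 'rV[R]_n -> R) :
  n%:R / 2 < m -> 0 < c1 -> 0 < c2 ->
  (forall xi, c1 * bessel m xi <= w xi <= c2 * bessel m xi) ->
  is_fourier_transform f w ->
  ae_eq mu setT (EFin \o f) (fun x => (c0 * kern w x)%:E).
Proof.
move=> nm c10 c20 wb FT; have [mf mw _] := FT.
have wi : mu.-integrable setT (EFin \o w).
  apply: (@le_integrable _ _ _ mu setT measurableT _ (EFin \o (fun xi => c2 * bessel m xi))).
  - exact/measurable_EFinP.
  - move=> xi _; have b0 := bessel_gt0 m xi; have /andP[w1 w2] := wb xi.
    rewrite /= lee_fin !ger0_norm//; first by rewrite mulr_ge0// ltW.
    by apply: le_trans w1; rewrite mulr_ge0// ltW.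
  - exact: (integrableZl measurableT c2 (integrable_bessel nm)).
have key b (y : 'rV[R]_n) : 0 < b ->
  mu.-integrable setT (fun x => ((f x - c0 * kern w x) * gauss b (x - y))%:E) /\
  (\int[mu]_x ((f x - c0 * kern w x) * gauss b (x - y))%:E = 0)%E.
  move=> b0; have a0 : 0 < (4 * b)^-1 by rewrite invr_gt0 mulr_gt0.
  have := fourier_gauss_test y a0 FT.
  have -> : (4 * (4 * b)^-1)^-1 = b by field; rewrite gt_eqF.
  move=> [i1 e1]; have [i2 e2] := kern_gauss_test y b0 wi.
  have i3 := integrableZl measurableT c0 i2.
  have E x : ((f x - c0 * kern w x) * gauss b (x - y))%:E =
     ((f x * gauss b (x - y))%:E - c0%:E * (kern w x * gauss b (x - y))%:E)%E.
    by rewrite -EFinM -EFinB; congr EFin; ring.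
  have i4 : mu.-integrable setT (fun x => ((f x - c0 * kern w x) * gauss b (x - y))%:E).
    by apply: eq_integrable (integrableB measurableT i1 i3) => // x _; rewrite E.
  split => //.
  under eq_integral do rewrite E.
  rewrite integralB// integralZl//.
  rewrite -[X in (X - _)%E]fineK; last exact: integrable_fin_num.
  rewrite -[X in (_ - _ * X)%E]fineK; last exact: integrable_fin_num.
  move: e1 e2; rewrite /Rintegral => e1 e2; rewrite e2 -e1 -EFinM -EFinB; congr EFin.
  have := fourier_const a0; have -> : (4 * (4 * b)^-1)^-1 = b by field; rewrite gt_eqF.
  set P := fine _; set A := _ ^+ n; set B := _ ^+ n => h.
  have -> : c0 * (B * (c0 * A * P)) = c0 ^+ 2 * A * B * P by ring.
  by rewrite h mul1r subrr.
have := @ae_eq0_of_gauss R n (fun x => (f x - c0 * kern w x) * gauss 1 x).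
move=> H; have : ae_eq mu setT (EFin \o (fun x => (f x - c0 * kern w x) * gauss 1 x)) (cst 0%E).
  apply: H.
    have [+ _] := key 1 0 ltr01; apply: eq_integrable => // x _ /=.
    by rewrite subr0.
  move=> M p M0; have M1 : 0 < 1 + M by rewrite addr_gt0.
  have [i e] := key (1 + M) ((M / (1 + M)) *: p) M1.
  have E x : ((f x - c0 * kern w x) * gauss 1 x * gauss M (x - p))%:E =
    ((expR (- (1 * M / (1 + M) * dotv p p)))%:E *
     ((f x - c0 * kern w x) * gauss (1 + M) (x - (M / (1 + M)) *: p))%:E)%E.
    by rewrite -EFinM -mulrA gauss_mul//; congr EFin; ring.
  by under eq_integral do rewrite E; rewrite integralZl// e mule0.
apply: filterS => x /= h xT; have := h xT => -[/eqP].
by rewrite mulf_eq0 (gt_eqF (gauss_gt0 _ _)) orbF subr_eq0 => /eqP ->.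
Qed.

End profile.

(** * Point sets and norms *)

Section assembly.
Context (R : realType) (n : nat).
Local Notation mu := (@lebesgue_rV R n).

(** The infimum is attained because there are finitely many pairs; [2 <= N] makes their set
    nonempty. *)
Lemma separation_distance_spec N (X : 'I_N -> 'rV[R]_n) : (2 <= N)%N -> injective X ->
  0 < separation_distance X /\ well_separated X (separation_distance X).
Proof.
move=> N2 injX; rewrite /separation_distance; set S := [set _ | _ in _].
have N0 : (0 < N)%N by exact: ltn_trans N2.
pose p0 : 'I_N * 'I_N := (Ordinal N0, Ordinal N2).
have P0 : p0.1 != p0.2 by [].
have S0 : S !=set0 by exists (enorm (X p0.1 - X p0.2)); exists p0.
pose p1 := [arg min_(p < p0 | p.1 != p.2) enorm (X p.1 - X p.2)]%O.
have [p1P p1min] : p1.1 != p1.2 /\ lbound S (enorm (X p1.1 - X p1.2)).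
  rewrite /p1; case: arg_minP => //= i iP imin; split => // _ [p pP <-]; exact: imin.
have e0 : 0 < enorm (X p1.1 - X p1.2).
  rewrite lt0r enorm_ge0 andbT; apply: contraNneq p1P => e.
  apply/eqP/injX; apply/eqP; rewrite -subr_eq0; apply/eqP.
  have : dotv (X p1.1 - X p1.2) (X p1.1 - X p1.2) = 0 by rewrite -enorm_sqr e expr0n.
  move=> /eqP; rewrite psumr_eq0 => [/allP h|i _]; last by rewrite -expr2 sqr_ge0.
  apply/rowP => i; have := h i (mem_index_enum _); rewrite /= mulf_eq0 orbb => /eqP ->.
  by rewrite mxE.
have e1 : enorm (X p1.1 - X p1.2) <= inf S by exact: lb_le_inf.
split; first by rewrite mulr_gt0// ?invr_gt0//; apply: lt_le_trans e1.
move=> i j ij; rewrite mulrA divff ?pnatr_eq0// mul1r.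
apply: ge_inf; first by exists (enorm (X p1.1 - X p1.2)).
by exists (i, j).
Qed.

(** Passes from the maximum norm to the Euclidean one; the added 1 keeps [M] positive in dimension
    0. *)
Lemma bounded_set_enorm (Omega : set 'rV[R]_n) : bounded_set Omega ->
  exists2 M : R, 0 < M & forall x, Omega x -> enorm x <= M.
Proof.
move=> /pinfty_ex_gt0[M M0 bM].
exists (Num.sqrt (n%:R * M ^+ 2) + 1); first by rewrite ltr_wpDl ?sqrtr_ge0.
move=> x xO; apply: (@le_trans _ _ (Num.sqrt (n%:R * M ^+ 2))); last by rewrite lerDl.
rewrite ler_wsqrtr// dotv_sq_le// => i.
apply: le_trans (bM x xO).
have -> : `|x| = mx_norm x by [].
rewrite mx_normrE; exact: (le_bigmax _ (fun ij => `|x ij.1 ij.2|) (0, i)).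
Qed.

(* Needed because [0 `^ (- (d / 2))] is [0], not infinity. *)
Lemma fill_distance_gt0 N (Omega : set 'rV[R]_n) (X : 'I_N -> 'rV[R]_n) (q : R) :
  (0 < N)%N -> bounded_set Omega -> interior_cone_condition Omega ->
  0 < q -> well_separated X q -> (forall j, Omega (X j)) -> 0 < fill_distance Omega X.
Proof.
move=> N0 bO [theta [r [th r0 cone]]] q0 sep XO.
pose j0 : 'I_N := Ordinal N0.
have [xi xi1 hxi] := cone _ (XO j0).
(* The point at distance [l] from [X j0] along the cone axis is at distance at least [2 q - l >= l]
   from the other nodes, so the fill distance is at least [l]. *)
pose l := Num.min r q; have l0 : 0 < l by rewrite lt_min r0.
have lr : l <= r by rewrite ge_min lexx.
have lq : l <= q by rewrite ge_min lexx orbT.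
have xO : Omega (X j0 + l *: xi).
  apply: hxi => //; last by rewrite (ltW l0).
  by rewrite -enorm_sqr xi1 expr1n cos_le1.
have [M M0 HM] := bounded_set_enorm bO.
apply: (lt_le_trans l0).
pose m x := inf (range (fun j => enorm (x - X j))).
have lbm x : has_lbound (range (fun j => enorm (x - X j))).
  by exists 0 => _ [j _ <-]; exact: enorm_ge0.
have rm x : range (fun j => enorm (x - X j)) !=set0.
  by exists (enorm (x - X j0)); exists j0.
apply: (@le_trans _ _ (m (X j0 + l *: xi))).
  apply: lb_le_inf; first exact: rm.
  have nl : enorm (l *: xi) = l by rewrite enormZ xi1 mulr1 ger0_norm ?ltW.
  move=> _ [j _ <-]; have [->|jj0] := eqVneq j j0.
    by rewrite addrAC subrr add0r nl.
  have h := sep j0 j; rewrite eq_sym in jj0; have {}h := h jj0.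
  have : enorm (X j0 - X j) <= enorm (X j0 + l *: xi - X j) + enorm (- (l *: xi)).
    by apply: le_trans (enorm_triangle _ _); rewrite addrAC addrK.
  by rewrite enormN nl; lra.
apply: ub_le_sup; last by exists (X j0 + l *: xi).
(* An element bounds [sup] from below only when the set has an upper bound, which boundedness of
   [Omega] supplies. *)
exists (M + M) => _ [x Ox <-]; apply: (@le_trans _ _ (enorm (x - X j0))).
  by apply: ge_inf => //; exists j0.
apply: (le_trans (enorm_triangle _ _)); rewrite enormN.
by rewrite lerD// HM.
Qed.

Lemma ae_translate (P : 'rV[R]_n -> Prop) (a : 'rV[R]_n) :
  {ae mu, forall x, P x} -> {ae mu, forall x, P (x - a)}.
Proof.
move=> [N [mN N0 PN]]; exists ((fun x : 'rV[R]_n => x - a) @^-1` N).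
have ma : measurable_fun setT (fun x : 'rV[R]_n => x - a).
  have := measurable_rV_affine (- a) 1.
  by congr measurable_fun; apply/funext => x; rewrite scale1r addrC.
have mNa : measurable ((fun x : 'rV[R]_n => x - a) @^-1` N).
  by rewrite -[X in measurable X]setTI; exact: ma.
split => //; last by move=> x /= h; apply: PN.
have h1 := @integral_indic _ _ R mu setT measurableT _ mN.
have h2 := @integral_indic _ _ R mu setT measurableT _ mNa.
rewrite !setIT in h1 h2.
apply: etrans N0; apply: etrans (etrans (esym h2) _) h1.
rewrite [RHS](integral_rV_translate (- a)).
  by [].
by apply/measurable_EFinP; exact: measurable_indic.
Qed.

Lemma kernel_profile_sum_ae (phi : 'rV[R]_n -> 'rV[R]_n -> R) (w : 'rV[R]_n -> R) (c : R)
    N (X : 'I_N -> 'rV[R]_n) (a : 'I_N -> R) :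
  ae_eq mu setT (EFin \o kernel_profile phi) (fun x => (c * kern w x)%:E) ->
  {ae mu, forall y, \sum_(j < N) a j * kernel_profile phi (y - X j) = c * kcomb w X a y}.
Proof.
move=> h.
have hj j : {ae mu, forall y, kernel_profile phi (y - X j) = c * kern w (y - X j)}.
  apply: (ae_translate (P := fun x => kernel_profile phi x = c * kern w x)).
  by apply: filterS h => x /(_ I) [].
have hall : {ae mu, forall y, forall j, kernel_profile phi (y - X j) = c * kern w (y - X j)}.
  exact: filter_forall.
apply: filterS hall => y hy; rewrite /kcomb mulr_sumr; apply: eq_bigr => j _.
by rewrite hy mulrCA.
Qed.

Lemma Lp_norm_on_infty_le (Omega : set 'rV[R]_n) (u : 'rV[R]_n -> R) (B : \bar R) :
  (0 <= B)%E -> {ae mu, forall y, Omega y -> (`|u y|%:E <= B)%E} ->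
  (Lp_norm_on Omega +oo u <= B)%E.
Proof.
move=> B0 h; rewrite /Lp_norm_on unlock /Lnorm; case: ifPn => // _.
apply/ess_supP; apply: filterS h => y hy /=.
rewrite /patch; case: ifPn => [|_]; first by rewrite inE => /hy.
by rewrite (_ : point = 0%E)// abse0.
Qed.

Lemma Lp_norm_on_two (Omega : set 'rV[R]_n) (u g : 'rV[R]_n -> R) :
  measurable Omega -> measurable_fun Omega u -> measurable_fun Omega g ->
  {ae mu, forall y, Omega y -> u y = g y} ->
  (Lp_norm_on Omega 2%:E u = (\int[mu]_(y in Omega) (g y ^+ 2)%:E) `^ 2^-1)%E.
Proof.
move=> mO mu_ mg ug; rewrite /Lp_norm_on unlock /Lnorm; congr (_ `^ _)%E.
transitivity (\int[mu]_(y in Omega) (u y ^+ 2)%:E)%E.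
  rewrite [RHS]integral_mkcond; apply: eq_integral => y _.
  rewrite /patch; case: ifPn => _; last by rewrite /= normr0 powR0.
  by rewrite /= powR_mulrn// -normrX ger0_norm ?sqr_ge0.
apply: ge0_ae_eq_integral => //.
- by apply/measurable_EFinP; exact: measurable_funX.
- by apply/measurable_EFinP; exact: measurable_funX.
- by move=> y _; rewrite lee_fin sqr_ge0.
- by move=> y _; rewrite lee_fin sqr_ge0.
by apply: filterS ug => y h Oy; rewrite h.
Qed.

End assembly.

Theorem theorem4p10 (R : realType) (d : nat) (Omega : set 'rV[R]_d)
    (phi : 'rV[R]_d -> 'rV[R]_d -> R) (m rho : R)
    (hOmega : bounded_lipschitz_domain Omega)
    (hcone : interior_cone_condition Omega)
    (hpd : positive_definite phi)
    (hti : translation_invariant phi)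
    (hm : d%:R / 2 < m)
    (hhat : exists2 phihat : 'rV[R]_d -> R,
       is_fourier_transform (kernel_profile phi) phihat &
       comparable_funs phihat
         (fun xi => (1 + enorm xi ^+ 2) `^ (- m))) :
  exists2 C : R, 0 < C &
    forall (N : nat) (X : 'I_N -> 'rV[R]_d),
      (2 <= N)%N -> injective X -> (forall j, Omega (X j)) ->
      mesh_ratio Omega X <= rho ->
      forall u, trial_space X phi Omega u ->
        (Lp_norm_on Omega +oo u <=
         (C * fill_distance Omega X `^ (- (d%:R / 2)))%:E
           * Lp_norm_on Omega 2%:E u)%E.
Proof.
have [oO _ bO _] := hOmega; have mO := open_rV_measurable oO.
have [w FT [c1 [c2 [c10 c20 wb']]]] := hhat.
have wb xi : c1 * bessel m xi <= w xi <= c2 * bessel m xi.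
  by have := wb' xi; rewrite enorm_sqr.
have [mf mw _] := FT.
pose c0 : R := (2 * pi) `^ (- (d%:R / 2)).
have c00 : 0 < c0 by rewrite powR_gt0 ?mulr_gt0 ?pi_gt0.
have fK := fourier_profile_ae hm c10 c20 wb FT.
have [M M0 HM] := bounded_set_enorm bO.
have [C C0 HC] := kcomb_pointwise_bound hm mw c10 c20 wb mO hcone M0.
(* From [h <= (|rho| + 1) q] comes [q^(- d) <= (|rho| + 1)^d h^(- d)]; the square root undoes the
   squares in the pointwise bound. Using [|rho| + 1] keeps the constant positive whatever the sign
   of [rho]. *)
exists (Num.sqrt (C * (`|rho| + 1) ^+ d)).
  by rewrite sqrtr_gt0 mulr_gt0// exprn_gt0// ltr_wpDl.
move=> N X N2 injX XO rhoX u [a ua].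
have [q0 sep] := separation_distance_spec N2 injX.
set q := separation_distance X in q0 sep.
have h0 : 0 < fill_distance Omega X.
  exact: (fill_distance_gt0 (ltnW N2) bO hcone q0 sep XO).
set h := fill_distance Omega X in h0 *.
(* Two nodes are at distance at least [2 q] and at most [2 M], so the bound of the domain can serve
   as [qm]. *)
have qM : q <= M.
  have := sep (Ordinal (ltnW N2)) (Ordinal N2) isT.
  have := enorm_triangle (X (Ordinal (ltnW N2))) (- X (Ordinal N2)).
  rewrite enormN; have := HM _ (XO (Ordinal (ltnW N2))); have := HM _ (XO (Ordinal N2)).
  lra.
have hq : h <= (`|rho| + 1) * q.
  rewrite -ler_pdivrMr//; apply: le_trans rhoX _.
  by apply: le_trans (ler_norm _) _; rewrite lerDl.
have qh : q ^- d <= (`|rho| + 1) ^+ d * h ^- d.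
  have r0 : 0 < `|rho| + 1 by rewrite ltr_wpDl.
  rewrite ler_pdivlMr ?exprn_gt0// mulrC -ler_pdivlMr ?invr_gt0 ?exprn_gt0// invrK.
  by rewrite -exprMn lerXn2r// nnegrE ?(ltW h0)// ltW// mulr_gt0.
pose U := kcomb w X a.
have mU : measurable_fun setT U by exact: (measurable_kcomb hm mw c10 c20 wb).
have uE y : Omega y -> u y = \sum_(j < N) a j * kernel_profile phi (y - X j).
  move=> Oy; rewrite ua//; apply: eq_bigr => j _; congr (_ * _).
  by rewrite /kernel_profile -[RHS](hti _ _ (X j)) subrK add0r.
have uae : {ae @lebesgue_rV R d, forall y, Omega y -> u y = c0 * U y}.
  have := kernel_profile_sum_ae X a fK.
  by apply: filterS => y hy Oy; rewrite uE.
have mu_ : measurable_fun Omega u.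
  suff g : measurable_fun Omega (fun y => \sum_(j < N) a j * kernel_profile phi (y - X j)).
    by apply: eq_measurable_fun g => y; rewrite inE => /uE ->.
  apply: measurable_funTS; apply: measurable_sum => j; apply: measurable_funM => //.
  have := measurableT_comp mf (measurable_rV_affine (- X j) 1).
  by move=> e; move: e; congr measurable_fun; apply/funext => x /=; rewrite scale1r addrC.
rewrite (Lp_norm_on_two (g := fun y => c0 * U y) mO mu_ _ uae); last first.
  by apply: measurable_funTS; exact: measurable_funM.
set I := (\int[_]_(y in _) _)%E.
have K0 : 0 < Num.sqrt (C * (`|rho| + 1) ^+ d) * h `^ (- (d%:R / 2)).
  rewrite mulr_gt0 ?powR_gt0// sqrtr_gt0 mulr_gt0// exprn_gt0// ltr_wpDl//.
apply: Lp_norm_on_infty_le; first by rewrite mule_ge0 ?poweR_ge0// lee_fin ltW.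
apply: filterS uae => y hy Oy; rewrite hy//.
have IE : I = ((c0 ^+ 2)%:E * \int[@lebesgue_rV R d]_(y in Omega) (U y ^+ 2)%:E)%E.
  rewrite -ge0_integralZl//.
  - by apply: eq_integral => z _; rewrite -EFinM exprMn.
  - by apply/measurable_EFinP; apply: measurable_funTS; exact: measurable_funX.
  - by move=> z _; rewrite lee_fin sqr_ge0.
  - by rewrite lee_fin sqr_ge0.
have qqM : 0 < q <= M by rewrite q0.
have := HC N X a q qqM sep XO y Oy; rewrite -/U; move: IE.
have J0 : (0 <= \int[@lebesgue_rV R d]_(y in Omega) (U y ^+ 2)%:E)%E.
  by apply: integral_ge0 => z _; rewrite lee_fin sqr_ge0.
move: J0; case: (\int[@lebesgue_rV R d]_(y in Omega) (U y ^+ 2)%:E)%E => [r||]//.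
  rewrite lee_fin -!EFinM lee_fin => r0 -> Ur; rewrite poweR_EFin -EFinM lee_fin.
  have c2r : 0 <= c0 ^+ 2 * r by exact: mulr_ge0 (sqr_ge0 _) r0.
  have Kr : 0 <= C * (`|rho| + 1) ^+ d.
    by apply: (mulr_ge0 (ltW C0)); rewrite exprn_ge0// addr_ge0.
  rewrite powR12_sqrt// -(@ler_pXn2r _ 2)// ?nnegrE ?(mulr_ge0 (ltW K0) (sqrtr_ge0 _))//.
  rewrite -normrX ger0_norm ?sqr_ge0// exprMn [leRHS]exprMn (sqr_sqrtr c2r).
  rewrite [leRHS]mulrCA ler_wpM2l ?sqr_ge0//.
  apply: (le_trans Ur); rewrite ler_wpM2r// [leRHS]exprMn (sqr_sqrtr Kr).
  rewrite -[X in _ <= _ * X]powR_mulrn ?powR_ge0// -powRrM.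
  have -> : - (d%:R / 2) * 2%:R = - d%:R :> R by field.
  by rewrite powRN powR_mulrn ?(ltW h0)// -mulrA ler_wpM2l ?(ltW C0).
(* If the integral is infinite, so is the right-hand side. *)
move=> _ -> _; rewrite gt0_muley ?lte_fin ?exprn_gt0// poweRyr ?invr_neq0//.
by rewrite gt0_muley ?lte_fin// leey.
Qed.
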